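(* Let $K$ be a real valued field (of any characteristic), $x=(x_1,\dots,x_n)$, $\mathfrak m=\langle x_1,\dots,x_n\rangle\subset K\{x\}$. Let $f\in\mathfrak m^2$ and assume that $\dim_K\mathfrak m/\langle\frac{\partial f}{\partial x_1},\dots,\frac{\partial f}{\partial x_n}\rangle<\infty$. Let $g_1,\dots,g_p\in\mathfrak m$ be representatives of a generating system (resp. a basis) of the $K$-vector space $\mathfrak m/\langle\frac{\partial f}{\partial x_1},\dots,\frac{\partial f}{\partial x_n}\rangle$ and let $s=(s_1,\dots,s_p)$ be new variables. Then $$F(x,s):=f(x)+\sum_{i=1}^pg_i(x)s_i\in K\{x,s\}$$ is a right-versal (resp. right-semiuniversal) unfolding of $f$.
   Context: A real valued field is a field $K$ with a map $|\ |:K\to\mathbb R_{\ge 0}$ such that $|a|=0\Leftrightarrow a=0$, $|ab|=|a||b|$, $|a+b|\le|a|+|b|$ (the trivial valuation is allowed; $K$ need not be complete). $K\{x\}$ is the local ring of convergent power series, i.e. of those $\sum c_\alpha x^\alpha\in K[[x]]$ with $\sum|c_\alpha|\varepsilon^\alpha<\infty$ for some $\varepsilon\in(\mathbb R_{>0})^n$. An analytic $K$-algebra is a $K$-algebra isomorphic to $K\{t_1,\dots,t_q\}/J$ with $J$ a proper ideal; morphisms are local $K$-algebra homomorphisms. Unfoldings. Let $f\in\mathfrak m$. An unfolding of $f$ with parameter space $K\{t\}$, $t=(t_1,\dots,t_q)$, is a power series $G\in K\{x,t\}$ with $G(x,0)=f$. More generally, an unfolding over an analytic algebra $S=K\{t\}/J$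 is an element $G\in S\{x\}:=K\{x,t\}/JK\{x,t\}$ with $G(x,0)=f$. Let $F\in K\{x,s\}$ be an unfolding of $f$ over $K\{s\}$, $s=(s_1,\dots,s_p)$, and $G$ an unfolding of $f$ over $S=K\{t\}/J$. $G$ is right induced from $F$ via a morphism $\phi:K\{s\}\to S$, $\phi(s_j)=\phi_j(t)$, if there are $\Phi=(\Phi_1,\dots,\Phi_n)$ with $\Phi_i\in S\{x\}$, $\Phi_i(x,0)=x_i$, and $\alpha\in S$ with $\alpha(0)=0$, such that $$G(\Phi(x,t),t)=F(x,\phi(t))+\alpha(t).$$ $F$ is right complete if every unfolding of $f$ (over any $K\{t\}$) is right induced from $F$ via some $\phi$. $F$ is right versal if it is right complete and has the lifting property: for every unfolding $G$ of $f$ over $S$, every surjection $k:S\to S'$ of analytic algebras and every morphism $\phi':K\{s\}\to S'$ such that the unfolding over $S'$ obtained from $G$ by applying $k$ is right induced from $F$ via $\phi'$, there is a morphism $\phi:K\{s\}\to S$ with $k\circ\phi=\phi'$ such that $G$ is right induced from $F$ via $\phi$. $F$ is right semiuniversal if it is right versal and for every unfolding $G$ over $S$ the cotangent map $\mathfrak m_{K\{s\}}/\mathfrak m_{K\{s\}}^2\to\mathfrak m_S/\mathfrak m_S^2$ of a morphism $\phi$ via which $G$ is right induced from $F$ is uniquely determined by $F$ and $G$. *)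

(* Defs.v *)
From HB Require Import structures.
From mathcomp Require Import all_boot all_order all_algebra.
(* mpoly must be imported before the analysis files (notation levels clash in
   the other order). *)
From mathcomp Require Import mpoly.
From mathcomp Require Import boolp classical_sets reals constructive_ereal.
From mathcomp Require Import cardinality fsbigop ereal esum.

Set Implicit Arguments.
Unset Strict Implicit.
Unset Printing Implicit Defensive.

Import Order.TTheory GRing.Theory Num.Theory.
Local Open Scope ring_scope.
Local Open Scope quotient_scope.

Record real_valuation (R : realType) (K : fieldType) := RealValuation {
  rval :> K -> R;
  rval_ge0 : forall a, 0 <= rval a;
  rval_eq0 : forall a, rval a = 0 <-> a = 0;
  rvalM : forall a b, rval (a * b) = rval a * rval b;
  rval_leD : forall a b, rval (a + b) <= rval a + rval b }.

(** * Formal power series in [n] variables *)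

Record fps (K : fieldType) (n : nat) := Fps { fcoef :> 'X_{1..n} -> K }.

Section FpsRing.
Variables (K : fieldType) (n : nat).
Implicit Types (a b c : fps K n) (m : 'X_{1..n}) (d : nat).

Lemma fpsP a b : (forall m, a m = b m) -> a = b.
Proof. by case: a b => [a] [b] /= H; congr Fps; apply/funext. Qed.

HB.instance Definition _ := gen_eqMixin (fps K n).
HB.instance Definition _ := gen_choiceMixin (fps K n).

Definition fps_zero : fps K n := Fps (fun=> 0).
Definition fps_opp a : fps K n := Fps (fun m => - a m).
Definition fps_add a b : fps K n := Fps (fun m => a m + b m).

Lemma fps_addA : associative fps_add.
Proof. by move=> a b c; apply/fpsP => m /=; rewrite addrA. Qed.
Lemma fps_addC : commutative fps_add.
Proof. by move=> a b; apply/fpsP => m /=; rewrite addrC. Qed.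
Lemma fps_add0 : left_id fps_zero fps_add.
Proof. by move=> a; apply/fpsP => m /=; rewrite add0r. Qed.
Lemma fps_addN : left_inverse fps_zero fps_opp fps_add.
Proof. by move=> a; apply/fpsP => m /=; rewrite addNr. Qed.

HB.instance Definition _ :=
  GRing.isZmodule.Build (fps K n) fps_addA fps_addC fps_add0 fps_addN.

Definition fps_one : fps K n := Fps (fun m => (m == 0%MM)%:R).
Definition fps_mul a b : fps K n :=
  Fps (fun m => \sum_(k : 'X_{1..n < (mdeg m).+1, (mdeg m).+1}
                    | m == (k.1 + k.2)%MM) a k.1 * b k.2).

Definition fps_trunc d a : {mpoly K[n]} :=
  \sum_(m : 'X_{1..n < d}) a m *: 'X_[m].

Lemma mcoeff_trunc d a m :
  (fps_trunc d a)@_m = if (mdeg m < d)%N then a m else 0.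
Proof.
rewrite /fps_trunc raddf_sum /=; case: ifP => [lt_md|nlt_md].
  rewrite (bigD1 (BMultinom lt_md)) //= mcoeffZ mcoeffX eqxx mulr1.
  rewrite big1 ?addr0 // => k /eqP nk.
  rewrite mcoeffZ mcoeffX; case: eqP => [e|]; last by rewrite mulr0.
  by case: nk; apply/val_inj.
rewrite big1 // => k _; rewrite mcoeffZ mcoeffX; case: eqP => [e|].
  by move: nlt_md; rewrite -e bmdeg.
by rewrite mulr0.
Qed.

Lemma mcoeffM_agree d (p p' q q' : {mpoly K[n]}) :
    (forall m, (mdeg m < d)%N -> p@_m = p'@_m) ->
    (forall m, (mdeg m < d)%N -> q@_m = q'@_m) ->
  forall m, (mdeg m < d)%N -> (p * q)@_m = (p' * q')@_m.
Proof.
move=> hp hq m lt_md; rewrite !mcoeffM; apply/eq_bigr => k _.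
by rewrite hp ?hq // (leq_trans (bmdeg _) lt_md).
Qed.

Lemma fps_mulE d a b m : (mdeg m < d)%N ->
  fps_mul a b m = (fps_trunc d a * fps_trunc d b)@_m.
Proof.
move=> lt_md; have -> : fps_mul a b m =
    (fps_trunc (mdeg m).+1 a * fps_trunc (mdeg m).+1 b)@_m.
  by rewrite mcoeffM /=; apply/eq_bigr => k _; rewrite !mcoeff_trunc !bmdeg.
apply: (@mcoeffM_agree (mdeg m).+1) => // k lt_k; rewrite !mcoeff_trunc lt_k.
  by rewrite (leq_ltn_trans _ lt_md).
by rewrite (leq_ltn_trans _ lt_md).
Qed.

Lemma fps_trunc_mul d a b m : (mdeg m < d)%N ->
  (fps_trunc d (fps_mul a b))@_m = (fps_trunc d a * fps_trunc d b)@_m.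
Proof. by move=> lt_md; rewrite mcoeff_trunc lt_md (@fps_mulE d). Qed.

Lemma fps_mulA : associative fps_mul.
Proof.
move=> a b c; apply/fpsP => m; rewrite !(fps_mulE _ _ (ltnSn _)).
set d := _.+1; have lt_md : (mdeg m < d)%N by [].
transitivity (fps_trunc d a * (fps_trunc d b * fps_trunc d c))@_m.
  by apply: (@mcoeffM_agree d) => // k lt_k; rewrite fps_trunc_mul.
rewrite mulrA; apply: (@mcoeffM_agree d) => // k lt_k.
by rewrite fps_trunc_mul.
Qed.

Lemma fps_mulC : commutative fps_mul.
Proof.
by move=> a b; apply/fpsP => m; rewrite !(fps_mulE _ _ (ltnSn _)) mulrC.
Qed.

Lemma fps_mul1 : left_id fps_one fps_mul.
Proof.
move=> a; apply/fpsP => m; rewrite (fps_mulE _ _ (ltnSn _)).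
rewrite (_ : a m = (1 * fps_trunc (mdeg m).+1 a)@_m); last first.
  by rewrite mul1r mcoeff_trunc ltnSn.
apply: (@mcoeffM_agree (mdeg m).+1) => // k lt_k.
by rewrite mcoeff_trunc lt_k mcoeff1.
Qed.

Lemma fps_mulDl : left_distributive fps_mul fps_add.
Proof.
move=> a b c; apply/fpsP => m /=; rewrite -big_split.
by apply/eq_bigr => k _; rewrite mulrDl.
Qed.

Lemma fps_oner_neq0 : fps_one != fps_zero.
Proof.
apply/eqP => /(congr1 (fun a : fps K n => a 0%MM)) /= /eqP.
by rewrite eqxx oner_eq0.
Qed.

HB.instance Definition _ := GRing.Zmodule_isComNzRing.Build (fps K n)
  fps_mulA fps_mulC fps_mul1 fps_mulDl fps_oner_neq0.

Definition fps_scale (l : K) a : fps K n := Fps (fun m => l * a m).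

Lemma fps_scaleA (l l' : K) a :
  fps_scale l (fps_scale l' a) = fps_scale (l * l') a.
Proof. by apply/fpsP => m /=; rewrite mulrA. Qed.
Lemma fps_scale1 : left_id 1 fps_scale.
Proof. by move=> a; apply/fpsP => m /=; rewrite mul1r. Qed.
Lemma fps_scaleDr : right_distributive fps_scale +%R.
Proof. by move=> l a b; apply/fpsP => m /=; rewrite mulrDr. Qed.
Lemma fps_scaleDl a : {morph fps_scale^~ a : l l' / l + l'}.
Proof. by move=> l l'; apply/fpsP => m /=; rewrite mulrDl. Qed.

HB.instance Definition _ := GRing.Zmodule_isLmodule.Build K (fps K n)
  fps_scaleA fps_scale1 fps_scaleDr fps_scaleDl.

Lemma fps_scaleAl (l : K) a b : l *: (a * b) = (l *: a) * b.
Proof.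
apply/fpsP => m /=; rewrite mulr_sumr.
by apply/eq_bigr => k _; rewrite mulrA.
Qed.
HB.instance Definition _ :=
  GRing.Lmodule_isLalgebra.Build K (fps K n) fps_scaleAl.

Lemma fps_scaleAr (l : K) a b : l *: (a * b) = a * (l *: b).
Proof. by rewrite mulrC fps_scaleAl mulrC. Qed.
HB.instance Definition _ :=
  GRing.Lalgebra_isAlgebra.Build K (fps K n) fps_scaleAr.

Definition fpsX (i : 'I_n) : fps K n := Fps (fun m => (m == U_(i)%MM)%:R).

Definition fps_deriv (i : 'I_n) a : fps K n :=
  Fps (fun m => a (m + U_(i))%MM *+ (m i).+1).

End FpsRing.

(* The formal composite [a (Phi_1, ..., Phi_k)], meaningful when the [Phi_i]
   have no constant term: then a monomial of degree larger than [mdeg m] in the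
   [Phi_i] does not contribute to the coefficient at [m]. *)
Definition fps_subst (K : fieldType) (k n : nat) (a : fps K k)
    (Phi : 'I_k -> fps K n) : fps K n :=
  Fps (fun m => \sum_(l : 'X_{1..k < (mdeg m).+1})
                  a l * (\prod_(i < k) Phi i ^+ l i) m).

Section Monomials.
Variable n : nat.
Implicit Types (m : 'X_{1..n}) (d : nat).

(* The monomials of degree less than [d], without repetition. *)
Definition mons d : seq 'X_{1..n} :=
  map (@bmnm n d) (index_enum _).

Lemma mons_uniq d : uniq (mons d).
Proof. by rewrite map_inj_uniq ?index_enum_uniq //; exact: val_inj. Qed.

Lemma mem_mons d m : (m \in mons d) = (mdeg m < d)%N.
Proof.
apply/mapP/idP => [[k _ ->]|lt_md]; first exact: bmdeg.
by exists (BMultinom lt_md) => //; rewrite mem_index_enum.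
Qed.

Lemma big_mons (T : Type) (idx : T) (op : T -> T -> T) d
    (P : pred 'X_{1..n}) (F : 'X_{1..n} -> T) :
  \big[op/idx]_(m : 'X_{1..n < d} | P (bmnm m)) F (bmnm m) =
  \big[op/idx]_(m <- mons d | P m) F m.
Proof. by rewrite big_map. Qed.

Lemma big_mons_widen (V : nmodType) d d' (F : 'X_{1..n} -> V) : (d <= d')%N ->
    (forall m, (d <= mdeg m)%N -> F m = 0) ->
  \sum_(m <- mons d) F m = \sum_(m <- mons d') F m.
Proof.
move=> le_d hF; rewrite [RHS](bigID (fun m => mdeg m < d)%N) /=.
rewrite [X in _ = _ + X]big1 ?addr0 => [|m]; last by rewrite -leqNgt => /hF.
rewrite -[RHS]big_filter; apply: perm_big; apply: uniq_perm; rewrite ?filter_uniq ?mons_uniq //.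
move=> m; rewrite mem_filter !mem_mons; case: ltnP => //= lt_m.
by rewrite (leq_trans lt_m).
Qed.

Lemma ler_sum_sub (R : realType) (s t : seq 'X_{1..n}) (F : 'X_{1..n} -> R) :
    uniq s -> uniq t -> {subset s <= t} -> (forall m, 0 <= F m) ->
  \sum_(m <- s) F m <= \sum_(m <- t) F m.
Proof.
move=> us ut sub F0; rewrite [leRHS](bigID (mem s)) /=.
rewrite (_ : \sum_(m <- t | m \in s) F m = \sum_(m <- s) F m) ?lerDl ?sumr_ge0 //.
rewrite -[LHS]big_filter; apply: perm_big; apply: uniq_perm; rewrite ?filter_uniq //.
by move=> m; rewrite mem_filter andb_idr // => /sub.
Qed.
End Monomials.


Section FpsSubst.
Variable K : fieldType.

Lemma fps_mulwE n d (a b : fps K n) (m : 'X_{1..n}) : (mdeg m < d)%N ->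
  (a * b) m =
  \sum_(k <- mons n d) \sum_(l <- mons n d | m == (k + l)%MM) a k * b l.
Proof.
move=> lt_md; rewrite [LHS](fps_mulE _ _ lt_md) (mcoeff_poly_mul _ _ lt_md).
rewrite -(big_mons _ _ _ xpredT).
under [RHS]eq_bigr => k _ do rewrite -(big_mons _ _ _ (fun l => m == (k + l)%MM)).
rewrite [RHS]pair_big_dep /=.
by apply/eq_bigr => k _; rewrite !mcoeff_trunc !bmdeg.
Qed.

Lemma fps_coef_sum n (I : Type) (r : seq I) (P : pred I) (F : I -> fps K n) m :
  (\sum_(i <- r | P i) F i) m = \sum_(i <- r | P i) F i m.
Proof. by elim/big_rec2: _ => //= i x a _ <-. Qed.

Lemma fps_coefZ n (c : K) (a : fps K n) m : (c *: a) m = c * a m.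
Proof. by []. Qed.

Definition fps_agree n d (a b : fps K n) :=
  forall m : 'X_{1..n}, (mdeg m < d)%N -> a m = b m.

Lemma fps_agreeM n d (a a' b b' : fps K n) :
  fps_agree d a a' -> fps_agree d b b' -> fps_agree d (a * b) (a' * b').
Proof.
move=> ha hb m lt_md; rewrite !(fps_mulwE _ _ lt_md).
apply/eq_big_seq => k; rewrite mem_mons => lt_k.
rewrite big_seq_cond [RHS]big_seq_cond; apply/eq_bigr => l.
by rewrite mem_mons => /andP[lt_l _]; rewrite ha ?hb.
Qed.

Lemma fps_agreeX n d (a a' : fps K n) j :
  fps_agree d a a' -> fps_agree d (a ^+ j) (a' ^+ j).
Proof. by move=> ha; elim: j => // j IH; rewrite !exprS; apply: fps_agreeM. Qed.

Definition fps_ord n d (a : fps K n) :=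
  forall m : 'X_{1..n}, (mdeg m < d)%N -> a m = 0.

Lemma fps_ordM n d d' (a b : fps K n) :
  fps_ord d a -> fps_ord d' b -> fps_ord (d + d') (a * b).
Proof.
move=> ha hb m lt_m; rewrite (fps_mulwE _ _ (ltnSn _)).
apply: big1_seq => k _; apply: big1_seq => l /andP[/eqP e _].
case: (ltnP (mdeg k) d) => [/ha ->|le_k]; first by rewrite mul0r.
rewrite hb ?mulr0 // -(ltn_add2l d) (leq_ltn_trans _ lt_m) //.
by rewrite e mdegD leq_add2r.
Qed.

Lemma fps_ordX n d (a : fps K n) j : fps_ord d a -> fps_ord (d * j) (a ^+ j).
Proof.
move=> ha; elim: j => [|j IH]; first by move=> m; rewrite muln0.
by rewrite exprS mulnS; apply: fps_ordM.
Qed.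

Definition fps_pow k n (Phi : 'I_k -> fps K n) (l : 'X_{1..k}) : fps K n :=
  \prod_(i < k) Phi i ^+ l i.

Lemma fps_powD k n (Phi : 'I_k -> fps K n) l l' :
  fps_pow Phi (l + l')%MM = fps_pow Phi l * fps_pow Phi l'.
Proof.
by rewrite /fps_pow -big_split; apply/eq_bigr => i _; rewrite mnmDE exprD.
Qed.

Lemma fps_pow_ord k n (Phi : 'I_k -> fps K n) l :
  (forall i, Phi i 0%MM = 0) -> fps_ord (mdeg l) (fps_pow Phi l).
Proof.
move=> Phi0; rewrite mdegE /fps_pow.
apply: (big_ind2 (fun d x => fps_ord d x)) => [m|d x d' y|i _] //.
  exact: fps_ordM.
have := @fps_ordX n 1 (Phi i) (l i); rewrite mul1n; apply=> m.
by rewrite ltnS leqn0 mdeg_eq0 => /eqP ->.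
Qed.

Lemma fps_substE k n d (a : fps K k) (Phi : 'I_k -> fps K n) :
    (forall i, Phi i 0%MM = 0) ->
  fps_agree d (fps_subst a Phi) (\sum_(l <- mons k d) a l *: fps_pow Phi l).
Proof.
move=> Phi0 m lt_m; rewrite fps_coef_sum /=.
rewrite (big_mons _ _ _ xpredT (fun l => a l * fps_pow Phi l m)).
by apply: big_mons_widen => // l lt_l; rewrite fps_pow_ord ?mulr0.
Qed.

Lemma fps_subst0 k n (Phi : 'I_k -> fps K n) : fps_subst 0 Phi = 0.
Proof. by apply/fpsP => m /=; rewrite big1 // => l _; rewrite mul0r. Qed.

Lemma fps_substD k n (a b : fps K k) (Phi : 'I_k -> fps K n) :
  fps_subst (a + b) Phi = fps_subst a Phi + fps_subst b Phi.
Proof.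
apply/fpsP => m /=; rewrite -big_split.
by apply/eq_bigr => l _; rewrite mulrDl.
Qed.

Lemma fps_substZ k n c (a : fps K k) (Phi : 'I_k -> fps K n) :
  fps_subst (c *: a) Phi = c *: fps_subst a Phi.
Proof.
apply/fpsP => m /=; rewrite mulr_sumr.
by apply/eq_bigr => l _; rewrite mulrA.
Qed.

Lemma fps_subst1 k n (Phi : 'I_k -> fps K n) : fps_subst 1 Phi = 1.
Proof.
apply/fpsP => m; rewrite /=.
rewrite (big_mons _ _ _ xpredT (fun l => (l == 0%MM)%:R * fps_pow Phi l m)).
rewrite (bigD1_seq 0%MM) ?mons_uniq ?mem_mons ?mdeg0 //= eqxx mul1r.
rewrite big1 ?addr0 => [|l /negPf ->]; last by rewrite mul0r.
by rewrite /fps_pow big1 // => i _; rewrite mnm0E expr0.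
Qed.

Lemma fps_substM k n (a b : fps K k) (Phi : 'I_k -> fps K n) :
    (forall i, Phi i 0%MM = 0) ->
  fps_subst (a * b) Phi = fps_subst a Phi * fps_subst b Phi.
Proof.
move=> Phi0; apply/fpsP => m; set d := (mdeg m).+1.
have lt_m : (mdeg m < d)%N by [].
rewrite (fps_agreeM (fps_substE a Phi0) (fps_substE b Phi0) lt_m).
rewrite (fps_substE _ Phi0 lt_m) mulr_suml !fps_coef_sum.
under eq_big_seq => l.
  rewrite mem_mons => lt_l; rewrite fps_coefZ (fps_mulwE _ _ lt_l) mulr_suml.
  under eq_bigr do rewrite big_mkcond mulr_suml.
  over.
rewrite exchange_big; apply/eq_bigr => i _; rewrite exchange_big.
rewrite mulr_sumr fps_coef_sum; apply/eq_bigr => j _.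
rewrite -scalerAl -scalerAr scalerA fps_coefZ -fps_powD.
case: (ltnP (mdeg (i + j)%MM) d) => [lt_d|le_d].
  rewrite (bigD1_seq (i + j)%MM) ?mons_uniq ?mem_mons //= eqxx.
  by rewrite big1 ?addr0 // => l /negPf ->; rewrite mul0r.
rewrite (fps_pow_ord Phi0 (leq_trans lt_m le_d)) mulr0.
rewrite big1_seq // => l /andP[_].
by rewrite mem_mons; case: eqP => [->|_]; rewrite ?mul0r // ltnNge le_d.
Qed.

Lemma fps_substX k n (i : 'I_k) (Phi : 'I_k -> fps K n) :
  (forall i, Phi i 0%MM = 0) -> fps_subst (fpsX K i) Phi = Phi i.
Proof.
move=> Phi0; apply/fpsP => m.
rewrite (fps_substE _ Phi0 (leqnSn _ : (mdeg m < (mdeg m).+2)%N)).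
rewrite fps_coef_sum (bigD1_seq U_(i)%MM) ?mons_uniq ?mem_mons ?mdeg1 //=.
rewrite eqxx mul1r big1 ?addr0 => [|l /negPf ->]; last by rewrite mul0r.
suff -> : fps_pow Phi U_(i)%MM = Phi i by [].
rewrite /fps_pow (bigD1 i) //= mnm1E eqxx expr1 big1 ?mulr1 // => j ne.
by rewrite mnm1E eq_sym (negPf ne) expr0.
Qed.

Definition fps_mon n (l : 'X_{1..n}) : fps K n := Fps (fun m => (m == l)%:R).

Lemma fps_monM n (l l' : 'X_{1..n}) : fps_mon l * fps_mon l' = fps_mon (l + l')%MM.
Proof.
apply/fpsP => m; rewrite /=.
set d := (maxn (mdeg m) (maxn (mdeg l) (mdeg l'))).+1.
have lt_m : (mdeg m < d)%N by rewrite ltnS leq_maxl.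
rewrite [LHS](fps_mulwE (fps_mon l) (fps_mon l') lt_m).
rewrite (bigD1_seq l) ?mons_uniq ?mem_mons ?ltnS ?leq_max ?leqnn ?orbT //=.
rewrite [X in _ + X]big1 ?addr0 => [|k /negPf kl]; last first.
  by apply: big1 => k' _; rewrite kl mul0r.
rewrite eqxx big_mkcond.
rewrite (bigD1_seq l') ?mons_uniq ?mem_mons ?ltnS ?leq_max ?leqnn ?orbT //=.
rewrite eqxx mulr1 big1 ?addr0 => [|k /negPf ->]; first by case: eqP.
by rewrite mulr0 if_same.
Qed.

Lemma fps_powX n (l : 'X_{1..n}) : fps_pow (@fpsX K n) l = fps_mon l.
Proof.
rewrite [in RHS](multinomUE_id l) /fps_pow.
elim/big_rec2: _ => [|i x y _ ->]; first exact/fpsP.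
rewrite -fps_monM; congr (_ * _).
elim: (l i) => [|j IH]; first by rewrite expr0 mulm0n; apply/fpsP.
by rewrite exprS IH mulmS -fps_monM.
Qed.

Lemma fps_substXid n (a : fps K n) : fps_subst a (@fpsX K n) = a.
Proof.
have X0 (i : 'I_n) : fpsX K i 0%MM = 0 by rewrite /= eq_sym mnm1_eq0.
apply/fpsP => m; rewrite (fps_substE a X0 (ltnSn _)) fps_coef_sum.
rewrite (bigD1_seq m) ?mons_uniq ?mem_mons //= fps_powX /= eqxx mulr1.
rewrite big1 ?addr0 // => l /negPf lm.
by rewrite fps_powX /= eq_sym lm mulr0.
Qed.

Lemma fps_subst_comp k n r (a : fps K k) (Phi : 'I_k -> fps K n)
    (Psi : 'I_n -> fps K r) :
    (forall i, Phi i 0%MM = 0) -> (forall i, Psi i 0%MM = 0) ->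
  fps_subst (fps_subst a Phi) Psi = fps_subst a (fun i => fps_subst (Phi i) Psi).
Proof.
move=> Phi0 Psi0.
have PP0 i : fps_subst (Phi i) Psi 0%MM = 0.
  rewrite (fps_substE _ Psi0 (_ : (mdeg (0%MM : 'X_{1..r}) < 1)%N)) ?mdeg0 //.
  rewrite fps_coef_sum big1_seq // => l /andP[_].
  by rewrite mem_mons ltnS leqn0 mdeg_eq0 => /eqP ->; rewrite fps_coefZ Phi0 mul0r.
apply/fpsP => m; set d := (mdeg m).+1; have lt_m : (mdeg m < d)%N by [].
rewrite (fps_substE _ PP0 lt_m).
have substS I (s : seq I) (F : I -> fps K n) :
    fps_subst (\sum_(i <- s) F i) Psi = \sum_(i <- s) fps_subst (F i) Psi.
  elim/big_rec2: _ => [|i x y _ <-]; first exact: fps_subst0.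
  by rewrite fps_substD.
have substX l : fps_subst (fps_pow Phi l) Psi =
                fps_pow (fun i => fps_subst (Phi i) Psi) l.
  rewrite /fps_pow; elim/big_rec2: _ => [|i x y _ <-]; first exact: fps_subst1.
  rewrite fps_substM //; congr (_ * _); elim: (l i) => [|j IH].
    by rewrite !expr0 fps_subst1.
  by rewrite !exprS fps_substM // IH.
rewrite (eq_bigr (fun l => fps_subst (a l *: fps_pow Phi l) Psi)); last first.
  by move=> l _; rewrite fps_substZ substX.
rewrite -substS !(fps_substE _ Psi0 lt_m) !fps_coef_sum.
apply/eq_big_seq => l; rewrite mem_mons => lt_l.
by rewrite !fps_coefZ (fps_substE _ Phi0 lt_l).
Qed.
End FpsSubst.

(** * Convergent power series *)

Definition fps_conv (R : realType) (K : fieldType) (v : real_valuation R K)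
    (n : nat) (a : fps K n) : Prop :=
  exists2 e : 'I_n -> R, (forall i, 0 < e i) &
    (\esum_(m in [set: 'X_{1..n}]) (v (a m) * \prod_(i < n) e i ^+ m i)%:E
       < +oo)%E.

Section Conv.
Variables (R : realType) (K : fieldType) (v : real_valuation R K).

Lemma rval0 : v 0 = 0. Proof. exact/rval_eq0. Qed.

Lemma rval1 : v 1 = 1.
Proof.
have v1 : v 1 != 0 by apply/eqP => /rval_eq0/eqP; rewrite oner_eq0.
by apply: (mulfI v1); rewrite -rvalM !mulr1.
Qed.

Lemma rvalN a : v (- a) = v a.
Proof.
have vN1 : v (- 1) = 1.
  have : v (- 1) ^+ 2 = 1 ^+ 2 by rewrite expr1n expr2 -rvalM mulrNN mulr1 rval1.
  move/eqP; rewrite eqf_sqr => /orP[/eqP //|/eqP e].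
  by have := rval_ge0 v (- 1); rewrite e ler0N1.
by rewrite -mulN1r rvalM vN1 mul1r.
Qed.

Lemma rval_sum (I : eqType) (r : seq I) (P : pred I) (F : I -> K) :
  v (\sum_(i <- r | P i) F i) <= \sum_(i <- r | P i) v (F i).
Proof.
elim/big_rec2: _ => [|i x y _ le]; first by rewrite rval0.
by rewrite (le_trans (rval_leD _ _ _)) // lerD2l.
Qed.

Lemma rval_Mn a k : v (a *+ k) <= k%:R * v a.
Proof.
elim: k => [|k IH]; first by rewrite mulr0n rval0 mul0r.
by rewrite mulrS (le_trans (rval_leD _ _ _)) // -natr1 mulrDl mul1r addrC lerD2r.
Qed.

Definition rmon n (e : 'I_n -> R) (m : 'X_{1..n}) : R := \prod_(i < n) e i ^+ m i.

Lemma rmon_ge0 n (e : 'I_n -> R) m : (forall i, 0 <= e i) -> 0 <= rmon e m.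
Proof. by move=> e0; apply: prodr_ge0 => i _; rewrite exprn_ge0. Qed.

Lemma rmonD n (e : 'I_n -> R) m m' :
  rmon e (m + m')%MM = rmon e m * rmon e m'.
Proof.
by rewrite /rmon -big_split; apply/eq_bigr => i _; rewrite mnmDE exprD.
Qed.

Lemma rmon_le n (e e' : 'I_n -> R) m :
  (forall i, 0 <= e i <= e' i) -> rmon e m <= rmon e' m.
Proof.
move=> h; apply: ler_prod => i _; have /andP[h0 h1] := h i.
by rewrite exprn_ge0 //= lerXn2r // nnegrE (le_trans h0).
Qed.

Definition fps_norm n (e : 'I_n -> R) d (a : fps K n) : R :=
  \sum_(m <- mons n d) v (a m) * rmon e m.

Definition fps_bnd n (e : 'I_n -> R) (M : R) (a : fps K n) :=
  forall d, fps_norm e d a <= M.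

Lemma fps_norm_ge0 n (e : 'I_n -> R) d a :
  (forall i, 0 <= e i) -> 0 <= fps_norm e d a.
Proof.
by move=> e0; apply: sumr_ge0 => m _; rewrite mulr_ge0 ?rval_ge0 ?rmon_ge0.
Qed.

Lemma fps_convP n (a : fps K n) : fps_conv v a <->
  exists2 e : 'I_n -> R, (forall i, 0 < e i) & exists M, fps_bnd e M a.
Proof.
split=> -[e e0 h]; exists e => //; last first.
  case: h => M hM; apply: (@le_lt_trans _ _ M%:E); last by rewrite ltry.
  apply: ub_ereal_sup => _ [X [finX _] <-].
  rewrite fsbig_finite //= sumEFin lee_fin.
  set s := finmap.enum_fset (fset_set X).
  pose d := (\max_(m <- s) (mdeg m).+1)%N.
  apply: le_trans (hM d); apply: ler_sum_sub; rewrite ?mons_uniq ?finmap.fset_uniq //.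
    move=> m ms; rewrite mem_mons /d (big_rem m ms) /=; exact: leq_maxl.
  by move=> m; rewrite mulr_ge0 ?rval_ge0 ?rmon_ge0 // => i; apply/ltW.
have a0 m : 0 <= v (a m) * rmon e m.
  by rewrite mulr_ge0 ?rval_ge0 ?rmon_ge0 // => i; apply/ltW.
exists (fine (\esum_(m in [set: 'X_{1..n}]) (v (a m) * rmon e m)%:E)) => d.
rewrite -lee_fin fineK; last first.
  rewrite ge0_fin_numE //; apply: esum_ge0 => m _; exact: a0.
apply: esum_ge; exists [set` mons n d]%classic.
  by split=> //; exact: finite_seq.
by rewrite -fsbig_seq ?mons_uniq //= sumEFin.
Qed.


Lemma fps_bnd_le n (e e' : 'I_n -> R) M a :
  (forall i, 0 <= e i <= e' i) -> fps_bnd e' M a -> fps_bnd e M a.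
Proof.
move=> h hM d; apply: le_trans (hM d); apply: ler_sum => m _.
by rewrite ler_wpM2l ?rval_ge0 ?rmon_le.
Qed.

Lemma fps_bnd_norm n (e : 'I_n -> R) d (a : fps K n) d' : (forall i, 0 <= e i) ->
  (forall m, (d <= mdeg m)%N -> a m = 0) -> fps_norm e d' a <= fps_norm e d a.
Proof.
move=> e0 h; rewrite /fps_norm.
rewrite [leRHS](@big_mons_widen _ _ d (maxn d d')) ?leq_maxl //; last first.
  by move=> m /h ->; rewrite rval0 mul0r.
apply: ler_sum_sub; rewrite ?mons_uniq // => m.
  by rewrite !mem_mons leq_max orbC => ->.
by rewrite mulr_ge0 ?rval_ge0 ?rmon_ge0.
Qed.

Lemma fps_conv_fin n d (a : fps K n) :
  (forall m, (d <= mdeg m)%N -> a m = 0) -> fps_conv v a.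
Proof.
move=> h; apply/fps_convP; exists (fun=> 1) => [_|]; first exact: ltr01.
by exists (fps_norm (fun=> 1) d a) => d'; apply: fps_bnd_norm.
Qed.

Lemma fps_conv0 n : fps_conv v (0 : fps K n).
Proof. exact: (@fps_conv_fin _ 0). Qed.

Lemma fps_conv1 n : fps_conv v (1 : fps K n).
Proof.
apply: (@fps_conv_fin _ 1) => m; rewrite lt0n mdeg_eq0 /=.
by move=> /negPf ->.
Qed.

Lemma fps_convX n i : fps_conv v (fpsX K i : fps K n).
Proof.
apply: (@fps_conv_fin _ 2) => m lt_m /=; case: eqP lt_m => // ->.
by rewrite mdeg1.
Qed.

Lemma fps_normD n (e : 'I_n -> R) d (a b : fps K n) : (forall i, 0 <= e i) ->
  fps_norm e d (a + b) <= fps_norm e d a + fps_norm e d b.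
Proof.
move=> e0; rewrite -big_split; apply: ler_sum => m _ /=.
by rewrite -mulrDl ler_wpM2r ?rmon_ge0 // rval_leD.
Qed.

Lemma fps_normN n (e : 'I_n -> R) d a : fps_norm e d (- a) = fps_norm e d a.
Proof. by apply/eq_bigr => m _ /=; rewrite rvalN. Qed.

Lemma fps_normZ n (e : 'I_n -> R) d c a :
  fps_norm e d (c *: a) = v c * fps_norm e d a.
Proof. by rewrite mulr_sumr; apply/eq_bigr => m _; rewrite /= rvalM mulrA. Qed.

Lemma fps_normM n (e : 'I_n -> R) d (a b : fps K n) : (forall i, 0 <= e i) ->
  fps_norm e d (a * b) <= fps_norm e d a * fps_norm e d b.
Proof.
move=> e0; rewrite /fps_norm mulr_suml.
under [leRHS]eq_bigr do rewrite mulr_sumr.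
have F0 k l : 0 <= v (a k) * rmon e k * (v (b l) * rmon e l).
  by rewrite !mulr_ge0 ?rval_ge0 ?rmon_ge0.
apply: (@le_trans _ _ (\sum_(m <- mons n d) \sum_(k <- mons n d)
    \sum_(l <- mons n d | m == (k + l)%MM)
      v (a k) * rmon e k * (v (b l) * rmon e l))).
  rewrite big_seq [leRHS]big_seq; apply: ler_sum => m; rewrite mem_mons => lt_m.
  rewrite (fps_mulwE _ _ lt_m).
  rewrite (le_trans (ler_wpM2r (rmon_ge0 _ e0) (rval_sum _ _ _))) // mulr_suml.
  apply: ler_sum => k _.
  rewrite (le_trans (ler_wpM2r (rmon_ge0 _ e0) (rval_sum _ _ _))) // mulr_suml.
  by apply: ler_sum => l /eqP ->; rewrite rvalM rmonD mulrACA.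
rewrite exchange_big; apply: ler_sum => k _.
under eq_bigr do rewrite big_mkcond.
rewrite exchange_big; apply: ler_sum => l _ /=.
rewrite -big_mkcond; case: (boolP ((k + l)%MM \in mons n d)) => kl.
  rewrite -big_filter (perm_big [:: (k + l)%MM]) ?big_seq1 //.
  apply: uniq_perm; rewrite ?filter_uniq ?mons_uniq // => m.
  by rewrite mem_filter inE; case: eqP => // ->.
by rewrite big1_seq // => m /andP[/eqP -> mk]; rewrite mk in kl.
Qed.

Lemma fps_convB n (a b : fps K n) :
  fps_conv v a -> fps_conv v b -> fps_conv v (a - b).
Proof.
move=> /fps_convP[e e0 [M hM]] /fps_convP[e' e'0 [M' hM']]; apply/fps_convP.
exists (fun i => Num.min (e i) (e' i)) => [i|]; first by rewrite lt_min e0 e'0.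
have d0 i : 0 <= Num.min (e i) (e' i) by rewrite le_min !ltW.
exists (M + M') => d; rewrite (le_trans (fps_normD _ _ _ _)) // fps_normN.
by apply: lerD; [apply: (fps_bnd_le _ hM)|apply: (fps_bnd_le _ hM')] => i;
  rewrite d0 ge_min lexx ?orbT.
Qed.

Lemma fps_convZ n c (a : fps K n) : fps_conv v a -> fps_conv v (c *: a).
Proof.
move=> /fps_convP[e e0 [M hM]]; apply/fps_convP; exists e => //.
by exists (v c * M) => d; rewrite fps_normZ ler_wpM2l ?rval_ge0.
Qed.

Lemma fps_convM n (a b : fps K n) :
  fps_conv v a -> fps_conv v b -> fps_conv v (a * b).
Proof.
move=> /fps_convP[e e0 [M hM]] /fps_convP[e' e'0 [M' hM']]; apply/fps_convP.
exists (fun i => Num.min (e i) (e' i)) => [i|]; first by rewrite lt_min e0 e'0.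
have d0 i : 0 <= Num.min (e i) (e' i) by rewrite le_min !ltW.
exists (M * M') => d; rewrite (le_trans (fps_normM _ _ _ _)) //.
by apply: ler_pM; rewrite ?fps_norm_ge0 //;
  [apply: (fps_bnd_le _ hM)|apply: (fps_bnd_le _ hM')] => i;
  rewrite d0 ge_min lexx ?orbT.
Qed.

Lemma fps_conv_deriv n i (a : fps K n) :
  fps_conv v a -> fps_conv v (fps_deriv i a).
Proof.
move=> /fps_convP[e e0 [M hM]]; apply/fps_convP.
pose e' j := if j == i then e j / 2 else e j.
have e'0 j : 0 < e' j by rewrite /e'; case: ifP => _; rewrite ?divr_gt0.
exists e' => //; exists (M / e i) => d.
have e_ge0 j : 0 <= e j by apply/ltW.
have inj : injective (fun m : 'X_{1..n} => (m + U_(i))%MM) by apply: addIm.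
apply: (@le_trans _ _ (\sum_(m <- mons n d)
    v (a (m + U_(i))%MM) * rmon e (m + U_(i))%MM / e i)).
  apply: ler_sum => m _ /=.
  have -> : rmon e (m + U_(i))%MM = rmon e m * e i.
    rewrite rmonD; congr (_ * _); rewrite /rmon (bigD1 i) //= mnm1E eqxx expr1.
    by rewrite big1 ?mulr1 // => j ne; rewrite mnm1E eq_sym (negPf ne) expr0.
  rewrite mulrA mulfK ?gt_eqF //.
  have -> : rmon e' m = rmon e m / 2 ^+ m i.
    rewrite /rmon (bigD1 i) //= [in RHS](bigD1 i) //= /e' eqxx expr_div_n.
    rewrite mulrAC; congr (_ * _ / _); apply/eq_bigr => j /negPf ->; by [].
  rewrite (le_trans (ler_wpM2r _ (rval_Mn _ _))) //.
    by rewrite divr_ge0 ?rmon_ge0 ?exprn_ge0.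
  rewrite mulrAC mulrC ler_wpM2l ?rval_ge0 //.
  rewrite mulrCA ler_piMr ?rmon_ge0 // ler_pdivrMr ?exprn_gt0 // mul1r.
  by rewrite -natrX ler_nat ltn_expl.
rewrite -mulr_suml ler_wpM2r ?invr_ge0 //.
rewrite -(big_map (fun m => (m + U_(i))%MM) xpredT (fun m => v (a m) * rmon e m)).
apply: le_trans (hM d.+1); apply: ler_sum_sub.
- by rewrite (map_inj_uniq inj) mons_uniq.
- exact: mons_uniq.
- by move=> _ /mapP[m lt_m ->]; move: lt_m; rewrite !mem_mons mdegD mdeg1 addn1.
- by move=> m; rewrite mulr_ge0 ?rval_ge0 ?rmon_ge0.
Qed.

Lemma fps_norm_pow k n (e : 'I_n -> R) d (Phi : 'I_k -> fps K n)
    (r : 'I_k -> R) l : (forall i, 0 <= e i) ->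
    (forall i, fps_norm e d (Phi i) <= r i) ->
  fps_norm e d (fps_pow Phi l) <= rmon r l.
Proof.
move=> e0 hr; have r0 i : 0 <= r i by rewrite (le_trans _ (hr i)) ?fps_norm_ge0.
have h1 : fps_norm e d 1 <= 1.
  apply: (le_trans (fps_bnd_norm _ (d := 1) e0 _)).
    by move=> m; rewrite lt0n mdeg_eq0 /= => /negPf ->.
  rewrite /fps_norm (perm_big [:: 0%MM]) ?big_seq1 /= ?eqxx ?rval1 ?mul1r.
    by rewrite /rmon big1 // => i _; rewrite mnm0E expr0.
  apply: uniq_perm; rewrite ?mons_uniq // => m.
  by rewrite mem_mons inE ltnS leqn0 mdeg_eq0.
suff H : 0 <= rmon r l /\ fps_norm e d (fps_pow Phi l) <= rmon r l by case: H.
rewrite /fps_pow /rmon; elim/big_ind2: _ => //.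
  move=> x y x' y' [y0 hy] [y'0 hy']; split; first exact: mulr_ge0.
  by rewrite (le_trans (fps_normM _ _ _ _)) // ler_pM ?fps_norm_ge0.
move=> i _; split; first by rewrite exprn_ge0.
elim: (l i) => [|j IH]; first by rewrite !expr0.
rewrite !exprS (le_trans (fps_normM _ _ _ _)) // ler_pM ?fps_norm_ge0 //.
Qed.

Lemma fps_conv_shrink n (a : fps K n) (r : R) : a 0%MM = 0 -> fps_conv v a ->
    0 < r ->
  exists2 e : 'I_n -> R, (forall i, 0 < e i) & fps_bnd e r a.
Proof.
move=> a0 /fps_convP[e e0 [M hM]] r0.
have M0 : 0 <= M by rewrite (le_trans _ (hM 0)) ?fps_norm_ge0 // => i; apply/ltW.
pose t := Num.min 1 (r / (M + 1)).
have t0 : 0 < t by rewrite lt_min ltr01 divr_gt0 ?ltr_wpDl.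
have t1 : t <= 1 by rewrite ge_min lexx.
exists (fun i => t * e i) => [i|d]; first by rewrite mulr_gt0.
apply: (@le_trans _ _ (t * fps_norm e d a)).
  rewrite mulr_sumr; apply: ler_sum => m _.
  have [->|m0] := eqVneq m 0%MM; first by rewrite a0 rval0 !mul0r mulr0.
  have -> : rmon (fun i => t * e i) m = t ^+ mdeg m * rmon e m.
    rewrite mdegE -prodrXr -big_split; apply/eq_bigr => i _.
    by rewrite exprMn.
  rewrite mulrCA ler_wpM2r ?mulr_ge0 ?rval_ge0 ?rmon_ge0 //.
    by move=> i; apply/ltW.
  by rewrite -[leRHS]expr1 ler_wiXn2l ?(ltW t0) ?t1 // lt0n mdeg_eq0.
apply: (@le_trans _ _ (t * M)); first by rewrite ler_wpM2l // ltW.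
apply: (@le_trans _ _ (r / (M + 1) * M)).
  by rewrite ler_wpM2r // ge_min lexx orbT.
by rewrite mulrAC ler_pdivrMr ?ltr_wpDl // ler_pM2l // lerDl.
Qed.

Lemma fps_conv_subst k n (a : fps K k) (Phi : 'I_k -> fps K n) :
    (forall i, Phi i 0%MM = 0) -> fps_conv v a ->
    (forall i, fps_conv v (Phi i)) -> fps_conv v (fps_subst a Phi).
Proof.
move=> Phi0 /fps_convP[r r0 [M hM]] cPhi; apply/fps_convP.
have /choice[E hE] i : exists e : 'I_n -> R,
    (forall j, 0 < e j) /\ fps_bnd e (r i) (Phi i).
  by have [e] := fps_conv_shrink (Phi0 i) (cPhi i) (r0 i); exists e.
pose e j := \big[Num.min/1]_(i < k) E i j.
have e0 j : 0 < e j.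
  by apply: lt_bigmin => [|i _]; [exact: ltr01|exact: (hE i).1].
have e_ge0 j : 0 <= e j by apply/ltW.
exists e => //; exists M => d.
have hPhi i : fps_norm e d (Phi i) <= r i.
  apply: (fps_bnd_le _ (hE i).2) => j; rewrite e_ge0 /=.
  exact: bigmin_le_cond.
apply: le_trans (hM d).
apply: (@le_trans _ _ (\sum_(m <- mons n d) \sum_(l <- mons k d)
   v (a l) * (v (fps_pow Phi l m) * rmon e m))).
  rewrite /fps_norm big_seq [leRHS]big_seq; apply: ler_sum => m.
  rewrite mem_mons => lt_m; rewrite (fps_substE _ Phi0 lt_m) fps_coef_sum.
  rewrite (le_trans (ler_wpM2r (rmon_ge0 _ e_ge0) (rval_sum _ _ _))) //.
  by rewrite mulr_suml; apply: ler_sum => l _; rewrite fps_coefZ rvalM mulrA.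
rewrite exchange_big; apply: ler_sum => l _; rewrite -mulr_sumr.
by rewrite ler_wpM2l ?rval_ge0 // fps_norm_pow.
Qed.

End Conv.

Definition conv_pred (R : realType) (K : fieldType) (v : real_valuation R K)
  (n : nat) : {pred fps K n} := fun a => `[< fps_conv v a >].
Arguments conv_pred {R K} v n _.

(* [cps v n] is the ring K{x_1, ..., x_n} of convergent power series. *)
Record cps (R : realType) (K : fieldType) (v : real_valuation R K) (n : nat) :=
  Cps { cps_val :> fps K n; _ : cps_val \in conv_pred v n }.

Section CpsRing.
Variables (R : realType) (K : fieldType) (v : real_valuation R K) (n : nat).

Lemma conv_predP (a : fps K n) : reflect (fps_conv v a) (a \in conv_pred v n).
Proof. exact: asboolP. Qed.

Fact conv_subalg : subalg_closed (conv_pred v n).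
Proof.
split=> [|c a b /conv_predP ha /conv_predP hb|a b /conv_predP ha /conv_predP hb];
  apply/conv_predP; [exact: fps_conv1| |exact: fps_convM].
rewrite -[b]opprK; apply: fps_convB; first exact: fps_convZ.
by rewrite -sub0r; apply: fps_convB => //; exact: fps_conv0.
Qed.
HB.instance Definition _ := GRing.isSubalgClosed.Build K (fps K n)
  (conv_pred v n) conv_subalg.

HB.instance Definition _ := [isSub for @cps_val R K v n].
HB.instance Definition _ := [Choice of cps v n by <:].
HB.instance Definition _ := [SubChoice_isSubComNzRing of cps v n by <:].
HB.instance Definition _ := [SubZmodule_isSubLmodule of cps v n by <:].
HB.instance Definition _ :=
  [SubNzRing_SubLmodule_isSubLalgebra of cps v n by <:].
HB.instance Definition _ := [SubLalgebra_isSubAlgebra of cps v n by <:].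

Lemma cps_conv (a : cps v n) : fps_conv v a.
Proof. by apply/conv_predP; exact: valP. Qed.

Definition cpsX (i : 'I_n) : cps v n :=
  Cps (introT (conv_predP _) (fps_convX v i)).

Definition cps_deriv (i : 'I_n) (a : cps v n) : cps v n :=
  Cps (introT (conv_predP _) (fps_conv_deriv i (cps_conv a))).

End CpsRing.
Arguments cpsX {R K v n} i.

Section CpsSubst.
Variables (R : realType) (K : fieldType) (v : real_valuation R K).

(* The composite of convergent power series; by [cps_substE] the default value
   of [insubd] is not used when the [Phi i] have no constant term. *)
Definition cps_subst k n (a : cps v k) (Phi : 'I_k -> cps v n) : cps v n :=
  insubd 0 (fps_subst a Phi).

Lemma cps_substE k n (a : cps v k) (Phi : 'I_k -> cps v n) :
  (forall i, Phi i 0%MM = 0) -> cps_subst a Phi = fps_subst a Phi :> fps K n.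
Proof.
move=> Phi0; rewrite val_insubd; case: ifP => // /negP[].
apply/conv_predP; apply: fps_conv_subst => // [|i]; exact: cps_conv.
Qed.

Definition join (T : Type) n q (u : 'I_n -> T) (w : 'I_q -> T) : 'I_(n + q) -> T :=
  fun i => match split i with inl j => u j | inr j => w j end.

Definition incl_x n q (a : cps v n) : cps v (n + q) :=
  cps_subst a (fun i => cpsX (lshift q i)).
Definition incl_t n q (a : cps v q) : cps v (n + q) :=
  cps_subst a (fun j => cpsX (rshift n j)).
Definition at_t0 n q (G : cps v (n + q)) : cps v n :=
  cps_subst G (join cpsX (fun=> 0)).
Definition at_x0 n q (G : cps v (n + q)) : cps v q :=
  cps_subst G (join (fun=> 0) cpsX).

Lemma cpsX0 n (i : 'I_n) : (cpsX i : cps v n) 0%MM = 0.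
Proof. by rewrite /= eq_sym mnm1_eq0. Qed.

Lemma cps_subst_eq1 k n (Phi : 'I_k -> cps v n) :
  (forall i, Phi i 0%MM = 0) -> cps_subst 1 Phi = 1.
Proof. by move=> P0; apply/val_inj; rewrite /= cps_substE // fps_subst1. Qed.

Lemma cps_substM k n (Phi : 'I_k -> cps v n) a b :
    (forall i, Phi i 0%MM = 0) ->
  cps_subst (a * b) Phi = cps_subst a Phi * cps_subst b Phi.
Proof. by move=> P0; apply/val_inj; rewrite /= !cps_substE // fps_substM. Qed.

Lemma cps_subst_sum k n (Phi : 'I_k -> cps v n) (I : Type) (r : seq I) F :
    (forall i, Phi i 0%MM = 0) ->
  cps_subst (\sum_(i <- r) F i) Phi = \sum_(i <- r) cps_subst (F i) Phi.
Proof.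
move=> P0; elim/big_rec2: _ => [|i x y _ <-]; apply/val_inj => /=.
  by rewrite cps_substE //= fps_subst0.
by rewrite !cps_substE // fps_substD.
Qed.

Lemma at_x0_incl_t n q (a : cps v q) : at_x0 (incl_t n a) = a.
Proof.
have J0 i : (join (fun=> 0) cpsX i : cps v q) 0%MM = 0 :> K.
  by rewrite /join; case: split => j //; exact: cpsX0.
have R0 j : (cpsX (rshift n j) : cps v (n + q)) 0%MM = 0 by exact: cpsX0.
apply/val_inj; rewrite /= !cps_substE // fps_subst_comp //.
rewrite (_ : (fun i => _) = @fpsX K q); last first.
  apply/funext => j; rewrite fps_substX // /join.
  by case: split_ordP => i /eqP; rewrite ?eq_rlshift // eq_rshift => /eqP ->.
exact: fps_substXid.
Qed.

Definition fspan (A : comNzRingType) k (g : 'I_k -> A) (a : A) : Prop :=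
  exists h : 'I_k -> A, a = \sum_(i < k) h i * g i.

Definition ideal_prod (A : comNzRingType) (I J : A -> Prop) (a : A) : Prop :=
  exists k (b c : 'I_k -> A),
    [/\ forall i, I (b i), forall i, J (c i) & a = \sum_(i < k) b i * c i].

End CpsSubst.

Section ExtIdeal.
Variables (R : realType) (K : fieldType) (v : real_valuation R K) (n q : nat).
Variable J : idealr (cps v q).

(* The ideal [J K{x,t}] of K{x,t} generated by the ideal [J] of K{t}. *)
Definition ext_ideal : {pred cps v (n + q)} := fun G =>
  `[< exists k (h : 'I_k -> cps v (n + q)) (j : 'I_k -> cps v q),
        (forall i, j i \in J) /\ G = \sum_(i < k) h i * incl_t n (j i) >].

Fact ext_ideal_idealr : idealr_closed ext_ideal.
Proof.
split.
- apply/asboolP; exists 0, (fun=> 0), (fun=> 0).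
  by split=> [[]//|]; rewrite big_ord0.
- apply/asboolP => -[k [h [j [Jj e]]]].
  have J0 i : (join (fun=> 0) cpsX i : cps v q) 0%MM = 0 :> K.
    by rewrite /join; case: split => l //; exact: cpsX0.
  have := congr1 (@at_x0 _ _ v n q) e.
  rewrite /at_x0 cps_subst_eq1 // cps_subst_sum // => e1.
  have : 1 \in J.
    rewrite e1 rpred_sum // => i _; rewrite cps_substM //.
    by rewrite -[cps_subst (incl_t _ _) _]/(at_x0 _) at_x0_incl_t idealMr.
  by rewrite idealr1.
- move=> a F G /asboolP[k [h [j [Jj ->]]]] /asboolP[k' [h' [j' [Jj' ->]]]].
  apply/asboolP; exists (k + k')%N.
  exists (join (fun i => a * h i) h'), (join j j'); split=> [i|].
    by rewrite /join; case: split.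
  rewrite big_split_ord /= mulr_sumr; congr (_ + _); apply/eq_bigr => i _.
    by rewrite /join (unsplitK (inl i)) mulrA.
  by rewrite /join (unsplitK (inr i)).
Qed.
HB.instance Definition _ := isIdealr.Build (cps v (n + q)) ext_ideal
  ext_ideal_idealr.

End ExtIdeal.
Arguments ext_ideal {R K v} n {q} J _.

Definition zero_ideal (A : comNzRingType) : {pred A} := pred1 0.
Arguments zero_ideal A _ : clear implicits.

Fact zero_ideal_idealr (A : comNzRingType) : idealr_closed (zero_ideal A).
Proof.
split; rewrite ?inE ?oner_eq0 ?eqxx // => a x y; rewrite !inE.
by move=> /eqP-> /eqP->; rewrite mulr0 addr0.
Qed.
HB.instance Definition _ (A : comNzRingType) :=
  isIdealr.Build A (zero_ideal A) (zero_ideal_idealr A).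

Section QuotAlg.
Variables (K : comNzRingType) (A : comAlgType K) (I : idealr A).
Implicit Types (x y : {ideal_quot I}).

Definition quot_scale (c : K) x : {ideal_quot I} := \pi_{ideal_quot I} (c *: repr x).

Lemma pi_scale c (a : A) :
  \pi_{ideal_quot I} (c *: a) = quot_scale c (\pi_{ideal_quot I} a).
Proof.
rewrite /quot_scale; apply/eqP.
rewrite eqmodE /= /Quotient.equiv -scalerBr -mulr_algl idealMr //.
by rewrite Quotient.idealrBE reprK.
Qed.

Lemma quot_scaleA c d x : quot_scale c (quot_scale d x) = quot_scale (c * d) x.
Proof. by elim/quotW: x => a; rewrite -(pi_scale d) -!pi_scale scalerA. Qed.
Lemma quot_scale1 : left_id 1 quot_scale.
Proof. by elim/quotW=> a; rewrite -pi_scale scale1r. Qed.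
Lemma quot_scaleDr : right_distributive quot_scale +%R.
Proof.
move=> c; elim/quotW=> a; elim/quotW=> b.
by rewrite -rmorphD -!pi_scale -rmorphD scalerDr.
Qed.
Lemma quot_scaleDl x : {morph quot_scale^~ x : c d / c + d}.
Proof. by elim/quotW: x => a c d; rewrite -!pi_scale -rmorphD scalerDl. Qed.
HB.instance Definition _ := GRing.Zmodule_isLmodule.Build K {ideal_quot I}
  quot_scaleA quot_scale1 quot_scaleDr quot_scaleDl.

Lemma quot_scaleAl c x y : c *: (x * y) = (c *: x) * y.
Proof.
elim/quotW: x => a; elim/quotW: y => b; rewrite -rmorphM.
rewrite -[LHS]pi_scale scalerAl rmorphM; congr (_ * _); exact: pi_scale.
Qed.
HB.instance Definition _ :=
  GRing.Lmodule_isLalgebra.Build K {ideal_quot I} quot_scaleAl.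
Lemma quot_scaleAr c x y : c *: (x * y) = x * (c *: y).
Proof. by rewrite mulrC quot_scaleAl mulrC. Qed.
HB.instance Definition _ :=
  GRing.Lalgebra_isAlgebra.Build K {ideal_quot I} quot_scaleAr.
End QuotAlg.

(** * Unfoldings

  An analytic algebra is presented as [S = K{t}/J], with [J] a proper ideal of
  [K{t} = cps v q], and [S{x} = K{x,t}/J K{x,t}].  A variable of [K{x,t}] is
  [lshift q i] for [x_i] and [rshift n j] for [t_j].

  Operations on classes are computed on the representatives chosen by [repr].
  The results depend only on the classes: a proper ideal [J] consists of series
  without constant term, so setting [t = 0] sends [J K{x,t}] to 0, and
  substituting congruent series into congruent series gives congruent series. *)

Section Unfoldings.
Variables (R : realType) (K : fieldType) (v : real_valuation R K).

Local Notation "'Sx' n J" := {ideal_quot (ext_ideal n J)}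
  (at level 10, n at level 8, J at level 8).

Definition cps_max n : cps v n -> Prop := fspan cpsX.

Definition quot_max q (J : idealr (cps v q)) (s : {ideal_quot J}) : Prop :=
  exists2 a : cps v q, cps_max a & s = \pi_{ideal_quot J} a.

Definition local_from_cps p q (J : idealr (cps v q))
    (phi : {lrmorphism cps v p -> {ideal_quot J}}) : Prop :=
  forall a, cps_max a -> quot_max (phi a).

Definition local_quot q q' (J : idealr (cps v q)) (J' : idealr (cps v q'))
    (k : {lrmorphism {ideal_quot J} -> {ideal_quot J'}}) : Prop :=
  forall s, quot_max s -> quot_max (k s).

Definition unfolding n q (f : cps v n) (G : cps v (n + q)) : Prop :=
  at_t0 G = f.

Definition unfolding_over n q (J : idealr (cps v q)) (f : cps v n)
    (G : Sx n J) : Prop :=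
  at_t0 (repr G) = f.

(* The inclusion of [S] in [S{x}]. *)
Definition incl_S n q (J : idealr (cps v q)) (s : {ideal_quot J}) : Sx n J :=
  \pi_(Sx n J) (incl_t n (repr s)).

(* [G (Phi (x, t), t)]. *)
Definition reparam n q (J : idealr (cps v q)) (G : Sx n J)
    (Phi : 'I_n -> Sx n J) : Sx n J :=
  \pi_(Sx n J) (cps_subst (repr G)
    (join (fun i => repr (Phi i)) (fun j => cpsX (rshift n j)))).

(* [F (x, phi (t))], where [s_j] is replaced by [phi_j (t) = phi (s_j)]. *)
Definition base_change n p q (J : idealr (cps v q)) (F : cps v (n + p))
    (phi : {lrmorphism cps v p -> {ideal_quot J}}) : Sx n J :=
  \pi_(Sx n J) (cps_subst F
    (join (fun i => cpsX (lshift q i))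
          (fun j => incl_t n (repr (phi (cpsX j)))))).

(* The unfolding over [S'] obtained from the unfolding [G] over [S] by applying
   [k : S -> S'], that is by replacing [t_j] by [k (t_j)]. *)
Definition push_forward n q q' (J : idealr (cps v q)) (J' : idealr (cps v q'))
    (k : {lrmorphism {ideal_quot J} -> {ideal_quot J'}}) (G : Sx n J) :
    Sx n J' :=
  \pi_(Sx n J') (cps_subst (repr G)
    (join (fun i => cpsX (lshift q' i))
          (fun j => incl_t n (repr (k (\pi_{ideal_quot J} (cpsX j))))))).

Definition right_induced n p q (J : idealr (cps v q)) (F : cps v (n + p))
    (phi : {lrmorphism cps v p -> {ideal_quot J}}) (G : Sx n J) : Prop :=
  exists (Phi : 'I_n -> Sx n J) (alpha : {ideal_quot J}),
    [/\ forall i, at_t0 (repr (Phi i)) = cpsX i,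
        quot_max alpha
      & reparam G Phi = base_change F phi + incl_S n alpha].

(* Here [K{t}] is seen as [K{t}/0]. *)
Definition right_complete n p (f : cps v n) (F : cps v (n + p)) : Prop :=
  forall q (G : cps v (n + q)), unfolding f G ->
    let J0 := zero_ideal (cps v q) : idealr _ in
    exists2 phi : {lrmorphism cps v p -> {ideal_quot J0}},
      local_from_cps phi & right_induced F phi (\pi_(Sx n J0) G).

Definition lifting_property n p (f : cps v n) (F : cps v (n + p)) : Prop :=
  forall q (J : idealr (cps v q)) q' (J' : idealr (cps v q'))
      (G : Sx n J) (k : {lrmorphism {ideal_quot J} -> {ideal_quot J'}})
      (phi' : {lrmorphism cps v p -> {ideal_quot J'}}),
    unfolding_over f G ->
    local_quot k -> (forall s', exists s, k s = s') ->
    local_from_cps phi' -> right_induced F phi' (push_forward k G) ->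
    exists phi : {lrmorphism cps v p -> {ideal_quot J}},
      [/\ local_from_cps phi, forall a, k (phi a) = phi' a
        & right_induced F phi G].

Definition right_versal n p (f : cps v n) (F : cps v (n + p)) : Prop :=
  [/\ unfolding f F, right_complete f F & lifting_property f F].

(* The last condition says that [phi] and [phi'] induce the same cotangent map
   [m/m^2 -> m_S/m_S^2]. *)
Definition right_semiuniversal n p (f : cps v n) (F : cps v (n + p)) : Prop :=
  right_versal f F /\
  forall q (J : idealr (cps v q)) (G : Sx n J)
      (phi phi' : {lrmorphism cps v p -> {ideal_quot J}}),
    unfolding_over f G ->
    local_from_cps phi -> right_induced F phi G ->
    local_from_cps phi' -> right_induced F phi' G ->
    forall a, cps_max a ->
      ideal_prod (@quot_max q J) (@quot_max q J) (phi a - phi' a).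

(** * The quotient [m/<df/dx_1, ..., df/dx_n>] *)

Definition jacobian_ideal n (f : cps v n) : cps v n -> Prop :=
  fspan (fun i => cps_deriv i f).

(* The classes of the [g i], which lie in [m], generate [m/<df/dx_i>] over K. *)
Definition jac_generating n (f : cps v n) p (g : 'I_p -> cps v n) : Prop :=
  (forall i, cps_max (g i)) /\
  forall a, cps_max a -> exists c : 'I_p -> K,
    jacobian_ideal f (a - \sum_(i < p) c i *: g i).

Definition jac_basis n (f : cps v n) p (g : 'I_p -> cps v n) : Prop :=
  jac_generating f g /\
  forall c : 'I_p -> K, jacobian_ideal f (\sum_(i < p) c i *: g i) ->
    forall i, c i = 0.

Definition jac_finite_dim n (f : cps v n) : Prop :=
  exists d (h : 'I_d -> cps v n), jac_generating f h.

(* [f (x) + g_1 (x) s_1 + ... + g_p (x) s_p]. *)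
Definition linear_unfolding n (f : cps v n) p (g : 'I_p -> cps v n) :
    cps v (n + p) :=
  incl_x p f + \sum_(i < p) incl_x p (g i) * cpsX (rshift n i).

End Unfoldings.

(* Main.v *)
(* The equation [G (Phi (x, t), t) = F (x, phi (t)) + alpha (t)] is solved by
   correcting an approximate solution whose error [E] lies in [I K{x,t}], for a
   proper ideal [I] of [K{t}]: [I = <t>] gives completeness, and the kernel of
   [K{t} -> S'] gives the lifting property.  Writing [E = \sum_l e_l a_l] with
   [a_l] in [I], the correction is sought in the form [\sum_l a_l Psi_l].  As
   [F] is linear in [s], the [Psi_l] solve a fixed point equation involving only
   division by the partial derivatives of [f] modulo the span of the [g_i] and 1.
   This division is explicit and bounded, since some power of each [x_i] lies
   in the Jacobian ideal.  The equation is contracting for the order in [t], so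
   it has a formal solution, whatever the characteristic of [K], and it
   preserves a ball for the norms of small radius in [t], so the solution
   converges although [K] need not be complete.

   A local morphism [K{s} -> S] is determined by the images of the [s_j]
   because ideals of [K{t}] are closed (Krull), which follows from Grauert's
   division theorem.  Uniqueness on cotangent spaces is obtained by
   differentiating the equation at [t = 0] along the tangent vectors of [S]. *)
Require Import Defs.
From HB Require Import structures.
From mathcomp Require Import all_boot all_order all_algebra.
From mathcomp Require Import mpoly.
From mathcomp Require Import boolp classical_sets reals.
From mathcomp Require Import ring.

Set Implicit Arguments.
Unset Strict Implicit.
Unset Printing Implicit Defensive.

Import Order.TTheory GRing.Theory Num.Theory.
Local Open Scope ring_scope.
Local Open Scope quotient_scope.

(** * Weighted norms and fixed points *)

(** Instead of a Taylor expansion, Hadamard's first order form [G(Phi + y) = G(Phi) + \sum_k y_k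
    M_k(x, t, y)] is used, which involves no factorials; each [M_k] is [df/dx_k] plus a series [Q_k]
    that vanishes at [t = y = 0]. Since [F] is linear in [s], the remainders of the division by the
    [df/dx_k] are simply added to [phi] and [alpha]; [alpha] receives the multiples of 1, because
    the [g_i] generate only [m] modulo the Jacobian ideal. Writing one equation for the coefficient
    of each [a_l] keeps every correction inside [I], and the resulting identity is exact in
    [K{x,t}], hence valid over every quotient of [K{t}]. The obstacle in the estimates is that the
    bound for the division grows as the radius in [x] shrinks. The radius in [x] is therefore fixed
    before the radius in [t], and the division needs a bound that does not depend on the latter. *)

Section Bounds.
Variables (R : realType) (K : fieldType) (v : real_valuation R K) (n : nat).
Implicit Types (a b : fps K n) (e : 'I_n -> R) (m : 'X_{1..n}).

Lemma rmon0 e : rmon e 0%MM = 1.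
Proof. by rewrite /rmon big1 // => i _; rewrite mnm0E expr0. Qed.

Lemma rmon_gt0 e m : (forall i, 0 < e i) -> 0 < rmon e m.
Proof. by move=> e0; apply: prodr_gt0 => i _; rewrite exprn_gt0. Qed.

Lemma fps_bnd_seq e M a (s : seq 'X_{1..n}) : (forall i, 0 <= e i) ->
    fps_bnd v e M a -> uniq s ->
  \sum_(m <- s) v (a m) * rmon e m <= M.
Proof.
move=> e0 hM us; pose d := (\max_(m <- s) (mdeg m).+1)%N.
apply: le_trans (hM d); apply: ler_sum_sub; rewrite ?mons_uniq //.
  by move=> m ms; rewrite mem_mons /d (big_rem m ms) /=; exact: leq_maxl.
by move=> m; rewrite mulr_ge0 ?rval_ge0 ?rmon_ge0.
Qed.

Lemma fps_bnd_ge0 e M a : (forall i, 0 <= e i) -> fps_bnd v e M a -> 0 <= M.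
Proof. by move=> e0 /(_ 0) h; rewrite (le_trans _ h) ?fps_norm_ge0. Qed.

Lemma fps_bnd_leM e M M' a : M <= M' -> fps_bnd v e M a -> fps_bnd v e M' a.
Proof. by move=> le_M h d; apply: le_trans le_M. Qed.

Lemma fps_bnd0 e M : 0 <= M -> fps_bnd v e M (0 : fps K n).
Proof.
by move=> M0 d; rewrite /fps_norm big1 // => m _; rewrite rval0 mul0r.
Qed.

Lemma fps_bndD e M M' a b : (forall i, 0 <= e i) ->
  fps_bnd v e M a -> fps_bnd v e M' b -> fps_bnd v e (M + M') (a + b).
Proof.
by move=> e0 ha hb d; rewrite (le_trans (fps_normD _ _ _ _ _)) // lerD.
Qed.

Lemma fps_bndN e M a : fps_bnd v e M a -> fps_bnd v e M (- a).
Proof. by move=> ha d; rewrite fps_normN. Qed.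

Lemma fps_bndM e M M' a b : (forall i, 0 <= e i) ->
  fps_bnd v e M a -> fps_bnd v e M' b -> fps_bnd v e (M * M') (a * b).
Proof.
move=> e0 ha hb d; rewrite (le_trans (fps_normM _ _ _ _ _)) //.
by rewrite ler_pM ?fps_norm_ge0.
Qed.

Lemma fps_bnd_sum e (I : finType) (M : I -> R) (a : I -> fps K n) :
    (forall i, 0 <= e i) -> (forall i, fps_bnd v e (M i) (a i)) ->
  fps_bnd v e (\sum_i M i) (\sum_i a i).
Proof.
move=> e0 h; apply: (big_ind2 (fun M a => fps_bnd v e M a)) => //.
  exact: fps_bnd0.
by move=> *; apply: fps_bndD.
Qed.

Lemma fps_bnd_scale e e' M s a : 0 <= s ->
    (forall m, a m != 0 -> rmon e' m <= s * rmon e m) ->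
  fps_bnd v e M a -> fps_bnd v e' (s * M) a.
Proof.
move=> s0 h hM d; apply: le_trans (ler_wpM2l s0 (hM d)).
rewrite /fps_norm mulr_sumr; apply: ler_sum => m _.
have [->|am] := eqVneq (a m) 0; first by rewrite rval0 !mul0r mulr0.
by rewrite mulrCA ler_wpM2l ?rval_ge0 ?h.
Qed.

Lemma fps_bndX e i : (forall i, 0 <= e i) -> fps_bnd v e (e i) (fpsX K i).
Proof.
move=> e0 d; rewrite /fps_norm.
have [ltd|] := boolP (U_(i)%MM \in mons n d); last first.
  move=> nd; rewrite big1_seq // => m /andP[_ md] /=.
  by case: eqP md nd => [-> -> //|]; rewrite rval0 mul0r.
rewrite (bigD1_seq U_(i)%MM) ?mons_uniq //= eqxx rval1 mul1r.
rewrite big1 ?addr0 => [|m /negPf ->]; last by rewrite rval0 mul0r.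
rewrite /rmon (bigD1 i) //= mnm1E eqxx expr1 big1 ?mulr1 // => j /negPf ne.
by rewrite mnm1E eq_sym ne expr0.
Qed.

(** By submultiplicativity a monomial in the [Phi i] has norm at most the same monomial in their
    bounds [r i], so these bounds act as radii for [a]. Invariance of a ball needs the explicit
    constant. *)
Lemma fps_bnd_subst k (r : 'I_k -> R) e M (a : fps K k) (Phi : 'I_k -> fps K n) :
    (forall i, Phi i 0%MM = 0) -> (forall i, 0 <= e i) ->
    (forall i, fps_bnd v e (r i) (Phi i)) -> fps_bnd v r M a ->
  fps_bnd v e M (fps_subst a Phi).
Proof.
move=> Phi0 e0 hPhi hM d; apply: le_trans (hM d).
apply: (@le_trans _ _ (\sum_(m <- mons n d) \sum_(l <- mons k d)
   v (a l) * (v (fps_pow Phi l m) * rmon e m))).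
  rewrite /fps_norm big_seq [leRHS]big_seq; apply: ler_sum => m.
  rewrite mem_mons => lt_m; rewrite (fps_substE _ Phi0 lt_m) fps_coef_sum.
  rewrite (le_trans (ler_wpM2r (rmon_ge0 _ e0) (rval_sum _ _ _ _))) //.
  by rewrite mulr_suml; apply: ler_sum => l _; rewrite fps_coefZ rvalM mulrA.
rewrite exchange_big; apply: ler_sum => l _; rewrite -mulr_sumr.
by rewrite ler_wpM2l ?rval_ge0 //; apply: fps_norm_pow => // i; exact: hPhi.
Qed.

(** One radius for all variables and all members of the family reduces later choices of polyradii to
    the choice of single numbers. *)
Lemma fps_conv_common (I : finType) (a : I -> fps K n) :
    (forall i, fps_conv v (a i)) ->
  exists r M : R, [/\ 0 < r, 0 <= M & forall i, fps_bnd v (fun=> r) M (a i)].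
Proof.
move=> ca.
have /choice[E hE] i : exists eM : ('I_n -> R) * R,
    (forall j, 0 < eM.1 j) /\ fps_bnd v eM.1 eM.2 (a i).
  by have /fps_convP[e e0 [M hM]] := ca i; exists (e, M).
pose r := \big[Num.min/1]_(p : I * 'I_n) (E p.1).1 p.2.
have r0 : 0 < r by apply: lt_bigmin => // -[i j] _; exact: (hE i).1.
exists r, (\sum_i (E i).2); split=> [//||i].
  by apply: sumr_ge0 => i _; apply: (fps_bnd_ge0 _ (hE i).2) => j; apply/ltW/(hE i).1.
apply: (@fps_bnd_leM _ (E i).2).
  rewrite (bigD1 i) //= lerDl; apply: sumr_ge0 => j _.
  by apply: (fps_bnd_ge0 _ (hE j).2) => l; apply/ltW/(hE j).1.
apply: (fps_bnd_le _ (hE i).2) => j; rewrite (ltW r0) /=.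
by rewrite /r (bigminD1 (i, j)) //= ge_min lexx.
Qed.

End Bounds.

Section FixedPoint.
Variables (R : realType) (K : fieldType) (v : real_valuation R K) (n : nat).
Variables (gr : 'X_{1..n} -> nat).
Implicit Types (a b : fps K n).

(** The weight [gr] is left free: fixed points are taken for the total degree (inverses), for the
    rank of monomials (Grauert's division) and for the degree in [t] (the unfolding equation). *)
Definition fps_grd d a := forall m, (gr m < d)%N -> a m = 0.

Lemma fps_grdN d a : fps_grd d a -> fps_grd d (- a).
Proof. by move=> h m /h /= ->; rewrite oppr0. Qed.
Lemma fps_grdD d a b : fps_grd d a -> fps_grd d b -> fps_grd d (a + b).
Proof. by move=> ha hb m lt_m /=; rewrite ha ?hb ?addr0. Qed.
Lemma fps_grdB d a b : fps_grd d a -> fps_grd d b -> fps_grd d (a - b).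
Proof. by move=> ha hb; apply: fps_grdD => //; exact: fps_grdN. Qed.
Lemma fps_grd_sum d (I : Type) (r : seq I) (P : pred I) (F : I -> fps K n) :
  (forall i, P i -> fps_grd d (F i)) -> fps_grd d (\sum_(i <- r | P i) F i).
Proof.
by move=> h; apply: big_ind => //; exact: fps_grdD.
Qed.
Lemma fps_grdW d d' a : (d <= d')%N -> fps_grd d' a -> fps_grd d a.
Proof. by move=> le_d h m lt_m; apply: h; apply: leq_trans le_d. Qed.

(* No completeness of [K] is needed: the iterates are stationary at each
   coefficient, so the partial sums of the norm of the limit are partial sums
   of the norm of an iterate. *)
Lemma fps_fixed_point (I : Type) (T : (I -> fps K n) -> I -> fps K n)
    (e : 'I_n -> R) (rho : R) :
    0 <= rho ->
    (forall d Psi Psi', (forall i, fps_grd d (Psi i - Psi' i)) ->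
       forall i, fps_grd d.+1 (T Psi i - T Psi' i)) ->
    (forall Psi, (forall i, fps_bnd v e rho (Psi i)) ->
       forall i, fps_bnd v e rho (T Psi i)) ->
  exists Psi, (forall i, fps_bnd v e rho (Psi i)) /\ forall i, T Psi i = Psi i.
Proof.
move=> rho0 Tc Tb; pose S d := iter d T (fun=> 0).
have Sbnd d i : fps_bnd v e rho (S d i).
  by elim: d i => [|d IH] i; [exact: fps_bnd0|exact: Tb].
have Sst d i : fps_grd d (S d.+1 i - S d i).
  by elim: d i => [|d IH] i; [move=> m|exact: Tc].
have Sst' d k i : fps_grd d (S (d + k)%N i - S d i).
  elim: k => [|k IH]; first by rewrite addn0 subrr.
  rewrite addnS -[S _ i - _](subrKA (S (d + k)%N i)); apply: fps_grdD => //.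
  by apply: fps_grdW (Sst _ _); rewrite leq_addr.
(* The coefficient at [m] is read off an iterate from which on it no longer changes. *)
pose Psi i := Fps (fun m => S (gr m).+1 i m).
have PsiS d i : fps_grd d (Psi i - S d i).
  move=> m lt_m; rewrite /= -(subnKC lt_m); apply/eqP; rewrite subr_eq0 eq_sym.
  rewrite -subr_eq0; apply/eqP.
  exact: (Sst' (gr m).+1 (d - (gr m).+1)%N i).
exists Psi; split=> [i d|i].
  pose D := (\max_(m <- mons n d) (gr m).+1)%N.
  apply: le_trans (Sbnd D i d); rewrite le_eqVlt; apply/orP; left; apply/eqP.
  apply/eq_big_seq => m md; congr (v _ * _); apply/eqP; rewrite -subr_eq0.
  apply/eqP/(PsiS D).
  by rewrite /D (big_rem m md) /=; exact: leq_maxl.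
apply/fpsP => m; apply/eqP; rewrite -subr_eq0; apply/eqP.
rewrite -[LHS]/((T Psi i - Psi i) m) -(subrKA (S (gr m).+1 i)) -[S _ _ - Psi i]opprB.
by apply: (fps_grdB (Tc _ _ _ (PsiS (gr m)) i) (PsiS (gr m).+1 i)).
Qed.

End FixedPoint.

(** * Gradings, shifts and derivatives *)

Section Gradings.
Variables (K : fieldType) (n : nat).
Implicit Types (a b : fps K n) (m : 'X_{1..n}) (P : pred 'I_n).

(** Three weights are allowed because division by a monomial [w] shifts the weight: a quotient is
    measured by [gr (m + w)] while the product is measured by [gr m]. *)
Lemma fps_grdM (gr gr' gr'' : 'X_{1..n} -> nat) d d' d'' a b :
    (forall k l, (d <= gr k)%N -> (d' <= gr' l)%N -> (d'' <= gr'' (k + l)%MM)%N) ->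
  fps_grd gr d a -> fps_grd gr' d' b -> fps_grd gr'' d'' (a * b).
Proof.
move=> h ha hb m lt_m; rewrite (fps_mulwE _ _ (ltnSn _)).
apply: big1_seq => k _; apply: big1_seq => l /andP[/eqP e _].
have [/ha ->|le_k] := ltnP (gr k) d; first by rewrite mul0r.
have [/hb ->|le_l] := ltnP (gr' l) d'; first by rewrite mulr0.
by move: lt_m; rewrite e ltnNge h.
Qed.

Definition wdeg P (m : 'X_{1..n}) : nat := \sum_(i | P i) m i.

Lemma wdegD P m m' : wdeg P (m + m')%MM = (wdeg P m + wdeg P m')%N.
Proof. by rewrite /wdeg -big_split; apply/eq_bigr => i _; rewrite mnmDE. Qed.

Lemma wdeg0 P : wdeg P 0%MM = 0%N.
Proof. by rewrite /wdeg big1 // => i _; rewrite mnm0E. Qed.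

Lemma wdegT m : wdeg predT m = mdeg m.
Proof. by rewrite mdegE. Qed.

Lemma wdegU P i : wdeg P U_(i)%MM = P i.
Proof.
rewrite /wdeg big_mkcond (bigD1 i) //= mnm1E eqxx big1 ?addn0 => [|j /negPf ne].
  by case: (P i).
by rewrite mnm1E eq_sym ne if_same.
Qed.

Lemma wdeg_gt0P P m : reflect (exists2 i, P i & (0 < m i)%N) (0 < wdeg P m)%N.
Proof.
rewrite lt0n /wdeg sum_nat_eq0.
apply: (iffP idP) => [/forallPn[i]|[i Pi mi]].
  by rewrite negb_imply -lt0n => /andP[]; exists i.
by apply/forallPn; exists i; rewrite negb_imply Pi -lt0n.
Qed.

Lemma fps_wdegM P d d' a b :
  fps_grd (wdeg P) d a -> fps_grd (wdeg P) d' b -> fps_grd (wdeg P) (d + d') (a * b).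
Proof. by apply: fps_grdM => k l hk hl; rewrite wdegD leq_add. Qed.

Lemma fps_wdegMl P d a b : fps_grd (wdeg P) d b -> fps_grd (wdeg P) d (a * b).
Proof. by move=> hb; rewrite -[d]add0n; apply: fps_wdegM. Qed.

Lemma fps_wdegMr P d a b : fps_grd (wdeg P) d a -> fps_grd (wdeg P) d (a * b).
Proof. by rewrite mulrC; exact: fps_wdegMl. Qed.

Lemma fps_wdegX P d j a : fps_grd (wdeg P) d a -> fps_grd (wdeg P) (d * j) (a ^+ j).
Proof.
move=> ha; elim: j => [|j IH]; first by move=> m; rewrite muln0.
by rewrite exprS mulnS; apply: fps_wdegM.
Qed.

Lemma fps_wdeg_congM P d a a' b b' :
  fps_grd (wdeg P) d (a - a') -> fps_grd (wdeg P) d (b - b') ->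
  fps_grd (wdeg P) d (a * b - a' * b').
Proof.
move=> ha hb; have -> : a * b - a' * b' = (a - a') * b + a' * (b - b').
  by rewrite mulrBl mulrBr addrA subrK.
by apply: fps_grdD; [exact: fps_wdegMr|exact: fps_wdegMl].
Qed.

Lemma fps_subst_wdeg_cong k P d (a : fps K k) (Phi Psi : 'I_k -> fps K n) :
    (forall i, fps_grd (wdeg P) d (Phi i - Psi i)) ->
  fps_grd (wdeg P) d (fps_subst a Phi - fps_subst a Psi).
Proof.
move=> h m lt_m /=; rewrite -sumrB big1 // => l _; rewrite -mulrBr.
suff -> : fps_pow Phi l m - fps_pow Psi l m = 0 by rewrite mulr0.
suff H : fps_grd (wdeg P) d (fps_pow Phi l - fps_pow Psi l) by exact: H.
apply: (big_ind2 (fun x y => fps_grd (wdeg P) d (x - y))); rewrite ?subrr //.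
  by move=> *; exact: fps_wdeg_congM.
move=> i _; elim: (l i : nat) => [|j IH]; first by rewrite subrr.
by rewrite !exprS; exact: fps_wdeg_congM.
Qed.

End Gradings.

Lemma fps_subst_wdeg (K : fieldType) n k (P : pred 'I_k) (Q : pred 'I_n) d (a : fps K k)
    (Phi : 'I_k -> fps K n) :
    (forall i, P i -> fps_grd (wdeg Q) 1 (Phi i)) ->
  fps_grd (wdeg P) d a -> fps_grd (wdeg Q) d (fps_subst a Phi).
Proof.
move=> h ha m lt_m /=; rewrite big1 // => l _.
have [/ha ->|le_l] := ltnP (wdeg P l) d; first by rewrite mul0r.
suff H : fps_grd (wdeg Q) (wdeg P l) (fps_pow Phi l).
  by rewrite [X in _ * X]H ?mulr0 // (leq_trans lt_m).
rewrite /wdeg /fps_pow big_mkcond.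
apply: (big_ind2 (fun d x => fps_grd (wdeg Q) d x)) => //.
  by move=> *; exact: fps_wdegM.
move=> i _; case: ifP => // /h hi.
by have := fps_wdegX (j := l i) hi; rewrite mul1n.
Qed.

Lemma fps_mon_mul (K : fieldType) n (l m : 'X_{1..n}) (a : fps K n) :
  (fps_mon K l * a) m = if (l <= m)%MM then a (m - l)%MM else 0.
Proof.
have lm : (mdeg m < (mdeg m + mdeg l).+1)%N by rewrite ltnS leq_addr.
rewrite (fps_mulwE _ _ lm) (bigD1_seq l) ?mons_uniq ?mem_mons ?ltnS ?leq_addl //=.
rewrite [X in _ + X]big1 => [|k /negPf kl]; last first.
  by rewrite big1 // => j _ /=; rewrite kl mul0r.
rewrite addr0 eqxx; case: ifPn => [le|nle].
  rewrite -big_filter (perm_big [:: (m - l)%MM]) ?big_seq1 ?mul1r //.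
  apply: uniq_perm; rewrite ?filter_uniq ?mons_uniq // => k.
  rewrite mem_filter mem_mons inE; apply/andP/eqP => [[/eqP -> _]|->].
    by rewrite addmC addmK.
  by rewrite addmC submK // eqxx ltnS (leq_trans (mdegB _ _)) ?leq_addr.
rewrite big1 // => k /eqP e; case/negP: nle; rewrite e; exact: lem_addr.
Qed.

(** * Splitting a series along selected monomials *)

Section Shift.
Variables (R : realType) (K : fieldType) (v : real_valuation R K) (n : nat).
Variables (I : finType) (w : I -> 'X_{1..n}) (sel : 'X_{1..n} -> option I).
Implicit Types (a : fps K n).

(** [sel] assigns to a monomial at most one of the [w i], meant to divide it. The terms assigned to
    [w i] are collected and divided by [w i]; the unassigned ones form [fps_rest]. Single variables,
    leading monomials and the monomials of a box are all treated in this way. *)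
Definition fps_shift i a : fps K n :=
  Fps (fun m => if sel (m + w i)%MM == Some i then a (m + w i)%MM else 0).

Definition fps_rest a : fps K n := Fps (fun m => if sel m is None then a m else 0).

Lemma fps_shift_decomp a : (forall m i, sel m = Some i -> (w i <= m)%MM) ->
  a = fps_rest a + \sum_i fps_mon K (w i) * fps_shift i a.
Proof.
move=> selP; apply/fpsP => m; rewrite /= fps_coef_sum.
under eq_bigr => i _ do rewrite fps_mon_mul /=.
case e : (sel m) => [i|].
  rewrite (bigD1 i) //= (selP _ _ e) submK ?(selP _ _ e) // e eqxx add0r.
  rewrite big1 ?addr0 // => j ne; case: ifP => // le; rewrite submK // e.
  by case: eqP => // -[ij]; rewrite ij eqxx in ne.
rewrite big1 ?addr0 // => j _; case: ifP => // le.
by rewrite submK // e.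
Qed.

Lemma fps_shiftB i a b : fps_shift i (a - b) = fps_shift i a - fps_shift i b.
Proof. by apply/fpsP => m /=; case: ifP; rewrite ?subr0. Qed.

(** Distinct [m] give distinct [m + w i], so after multiplication by the weight of [w i] the norm of
    the quotient is at most a partial sum of the norm of [a]. *)
Lemma fps_shift_bnd e M i a : (forall i, 0 < e i) ->
  fps_bnd v e M a -> fps_bnd v e (M / rmon e (w i)) (fps_shift i a).
Proof.
move=> e0 hM d; have w0 := rmon_gt0 (w i) e0.
have e0' j : 0 <= e j by apply/ltW.
rewrite ler_pdivlMr // /fps_norm mulr_suml.
have inj : injective (fun m : 'X_{1..n} => (m + w i)%MM) by apply: addIm.
have us : uniq (map (fun m => (m + w i)%MM) (mons n d)).
  by rewrite (map_inj_uniq inj) mons_uniq.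
apply: le_trans (fps_bnd_seq e0' hM us); rewrite [leRHS]big_map; apply: ler_sum => m _ /=.
rewrite rmonD -mulrA; case: ifP => // _.
by rewrite rval0 mul0r !mulr_ge0 ?rval_ge0 ?rmon_ge0.
Qed.

Lemma fps_shift_conv i a : fps_conv v a -> fps_conv v (fps_shift i a).
Proof.
move=> /fps_convP[e e0 [M hM]]; apply/fps_convP; exists e => //.
by exists (M / rmon e (w i)); exact: fps_shift_bnd.
Qed.

Lemma fps_rest_bnd e M a : (forall i, 0 < e i) ->
  fps_bnd v e M a -> fps_bnd v e M (fps_rest a).
Proof.
move=> e0 hM d; apply: le_trans (hM d); apply: ler_sum => m _ /=.
case: (sel m) => // i.
by rewrite rval0 mul0r mulr_ge0 ?rval_ge0 ?rmon_ge0 // => j; exact/ltW.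
Qed.

Lemma fps_rest_conv a : fps_conv v a -> fps_conv v (fps_rest a).
Proof.
move=> /fps_convP[e e0 [M hM]]; apply/fps_convP; exists e => //.
by exists M; exact: fps_rest_bnd.
Qed.

End Shift.

(** * Product rule and chain rule *)

Section ChainRule.
Variables (K : fieldType).

Lemma fps_derivD n i (a b : fps K n) :
  fps_deriv i (a + b) = fps_deriv i a + fps_deriv i b.
Proof. by apply/fpsP => m /=; rewrite mulrnDl. Qed.

Lemma fps_derivB n i (a b : fps K n) :
  fps_deriv i (a - b) = fps_deriv i a - fps_deriv i b.
Proof. by apply/fpsP => m /=; rewrite mulrnBl. Qed.

Lemma fps_derivZ n i c (a : fps K n) : fps_deriv i (c *: a) = c *: fps_deriv i a.
Proof. by apply/fpsP => m /=; rewrite mulrnAr. Qed.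

Lemma fps_derivM n i (a b : fps K n) :
  fps_deriv i (a * b) = fps_deriv i a * b + a * fps_deriv i b.
Proof.
(* Truncation below degree [mdeg m + 2] keeps the degree [mdeg m + 1], which the derivative
   reads. *)
apply/fpsP => m; set d := (mdeg m).+2.
have lt_m : (mdeg (m + U_(i)) < d)%N by rewrite mdegD mdeg1 addn1.
have lt_m' : (mdeg m < d.-1)%N by [].
transitivity ((fps_trunc d a * fps_trunc d b)^`M(i))@_m.
  by rewrite mcoeff_deriv -(fps_mulE _ _ lt_m).
have agr (c : fps K n) k : (mdeg k < d.-1)%N ->
    ((fps_trunc d c)^`M(i))@_k = (fps_trunc d.-1 (fps_deriv i c))@_k.
  by move=> lt_k; rewrite mcoeff_deriv !mcoeff_trunc lt_k mdegD mdeg1 addn1 ltnS lt_k.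
have agr0 (c : fps K n) k : (mdeg k < d.-1)%N ->
    (fps_trunc d c)@_k = (fps_trunc d.-1 c)@_k.
  by move=> lt_k; rewrite !mcoeff_trunc lt_k (leq_trans lt_k) // leq_pred.
rewrite mderivM mcoeffD -[RHS]/(fps_mul _ _ m + fps_mul _ _ m) !(fps_mulE _ _ lt_m').
by congr (_ + _); apply: (@mcoeffM_agree K n d.-1) => // k lt_k;
  rewrite ?agr ?agr0.
Qed.

Lemma fps_deriv1 n i : fps_deriv i (1 : fps K n) = 0.
Proof.
apply/fpsP => m /=; rewrite -mdeg_eq0 mdegD mdeg1 addn1 /=.
by rewrite mul0rn.
Qed.

Lemma fps_derivX n i j : fps_deriv i (fpsX K j : fps K n) = (i == j)%:R.
Proof.
apply/fpsP => m; rewrite /=.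
have [<-|ne] := eqVneq i j.
  rewrite -[X in _ == X]add0m (inj_eq (@addIm _ _)) /=.
  by case: eqP => [->|]; rewrite ?mul0rn // mnm0E.
case: eqP => [/mnmP/(_ i)|_]; last by rewrite mul0rn.
by rewrite mnmDE !mnm1E eqxx eq_sym (negPf ne) addn1.
Qed.

Lemma fps_deriv_ord n i d (a : fps K n) : fps_ord d a -> fps_ord d.-1 (fps_deriv i a).
Proof.
case: d => [|d] h m lt_m //=; rewrite h ?mul0rn //.
by rewrite mdegD mdeg1 addn1.
Qed.

Lemma fps_subst_ord k n d (a : fps K k) (Phi : 'I_k -> fps K n) :
  (forall i, Phi i 0%MM = 0) -> fps_ord d a -> fps_ord d (fps_subst a Phi).
Proof.
move=> Phi0 ha m lt_m /=; rewrite big1 // => l _.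
have [/ha ->|le_l] := ltnP (mdeg l) d; first by rewrite mul0r.
by rewrite [X in _ * X](fps_pow_ord Phi0) ?mulr0 // (leq_trans lt_m).
Qed.

(** The property [C] is stable under products and linear combinations and holds for the variables,
    hence for polynomials. At a given [m], the series is replaced by its truncation below degree
    [mdeg m + 2], as differentiation loses one degree. *)
Lemma fps_chain k n (Phi : 'I_k -> fps K n) (i : 'I_n) (a : fps K k) :
    (forall j, Phi j 0%MM = 0) ->
  fps_deriv i (fps_subst a Phi) =
  \sum_j fps_subst (fps_deriv j a) Phi * fps_deriv i (Phi j).
Proof.
move=> Phi0; pose C a := fps_deriv i (fps_subst a Phi) =
  \sum_j fps_subst (fps_deriv j a) Phi * fps_deriv i (Phi j).
have C1 : C 1.
  rewrite /C fps_subst1 fps_deriv1 big1 // => j _.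
  by rewrite fps_deriv1 fps_subst0 mul0r.
have CM b c : C b -> C c -> C (b * c).
  move=> hb hc; rewrite /C fps_substM // fps_derivM hb hc mulr_suml mulr_sumr.
  rewrite -big_split; apply/eq_bigr => j _ /=.
  by rewrite fps_derivM fps_substD !fps_substM // mulrDl mulrAC mulrA.
have CX j : C (fpsX K j).
  rewrite /C fps_substX // (bigD1 j) //= fps_derivX eqxx fps_subst1 mul1r.
  rewrite big1 ?addr0 // => l /negPf ne.
  by rewrite fps_derivX ne fps_subst0 mul0r.
have CD b c : C b -> C c -> C (b + c).
  move=> hb hc; rewrite /C fps_substD fps_derivD hb hc -big_split.
  by apply/eq_bigr => j _; rewrite fps_derivD fps_substD mulrDl.
have CZ c b : C b -> C (c *: b).
  move=> hb; rewrite /C fps_substZ fps_derivZ hb scaler_sumr.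
  by apply/eq_bigr => j _; rewrite fps_derivZ fps_substZ scalerAl.
have Cmon l : C (fps_mon K l).
  rewrite -fps_powX /fps_pow; apply: big_ind => // j _.
  by elim: (l j : nat) => [|d IH] //; rewrite exprS; exact: CM.
apply/fpsP => m; set d := (mdeg m).+2.
pose p := \sum_(l <- mons k d) a l *: fps_mon K l.
have Cp : C p.
  apply: big_ind => // [|l _]; last exact: CZ.
  by have := CZ 0 1 C1; rewrite scale0r.
have ord : fps_ord d (a - p).
  move=> l lt_l /=; rewrite fps_coef_sum (bigD1_seq l) ?mons_uniq ?mem_mons //=.
  rewrite eqxx mulr1 big1 ?addr0 ?subrr // => j /negPf ne.
  by rewrite eq_sym ne mulr0.
have subB b c : fps_subst (b - c) Phi = fps_subst b Phi - fps_subst c Phi.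
  by rewrite fps_substD -scaleN1r fps_substZ scaleN1r.
apply/eqP; rewrite -subr_eq0; apply/eqP.
have := fps_deriv_ord i (fps_subst_ord Phi0 ord) (ltnSn _).
rewrite subB fps_derivB Cp /= => /eqP; rewrite subr_eq0 => /eqP ->.
rewrite -[LHS]/((\sum_j _ - \sum_j _ : fps K n) m) -sumrB fps_coef_sum big1 // => j _.
rewrite -mulrBl -subB -fps_derivB -[p - a]opprB.
have h := fps_subst_ord Phi0 (fps_deriv_ord j ord).
have hN : fps_ord d.-1 (fps_subst (fps_deriv j (- (a - p))) Phi).
  rewrite -scaleN1r fps_derivZ fps_substZ => l lt_l.
  by rewrite fps_coefZ h ?mulr0.
by have := fps_ordM (d' := 0) hN (b := fps_deriv i (Phi j)); rewrite addn0; exact.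
Qed.

End ChainRule.

(** * Convergent power series *)

Lemma join_lshift (T : Type) n q (u : 'I_n -> T) (w : 'I_q -> T) i :
  join u w (lshift q i) = u i.
Proof. by rewrite /join (unsplitK (inl i)). Qed.

Lemma join_rshift (T : Type) n q (u : 'I_n -> T) (w : 'I_q -> T) j :
  join u w (rshift n j) = w j.
Proof. by rewrite /join (unsplitK (inr j)). Qed.

Lemma join_ind (T : Type) (P : T -> Prop) n q (u : 'I_n -> T) (w : 'I_q -> T) :
  (forall i, P (u i)) -> (forall j, P (w j)) -> forall i, P (join u w i).
Proof. by move=> hu hw i; rewrite /join; case: split. Qed.

Lemma comp_join (T T' : Type) (h : T -> T') n q (u : 'I_n -> T) (w : 'I_q -> T) :
  (fun i => h (join u w i)) = join (fun i => h (u i)) (fun j => h (w j)).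
Proof. by apply/funext => i; rewrite /join; case: split. Qed.

Lemma join_eta (T : Type) n q (u : 'I_(n + q) -> T) :
  u = join (fun i => u (lshift q i)) (fun j => u (rshift n j)).
Proof.
by apply/funext => i; case: (split_ordP i) => j ->; rewrite ?join_lshift ?join_rshift.
Qed.

(** Selects the variables [t] of [K{x,t}]. Comparing indices makes the test insensitive to [lshift],
    which is convenient once further variables [y] are appended. *)
Definition isr n q : pred 'I_(n + q) := fun i => (n <= i)%N.
Arguments isr : clear implicits.

Lemma isr_l n q (i : 'I_n) : isr n q (lshift q i) = false.
Proof. by rewrite /isr /= leqNgt ltn_ord. Qed.

Lemma isr_r n q (j : 'I_q) : isr n q (rshift n j) = true.
Proof. by rewrite /isr /= leq_addr. Qed.

Section Series.
Variables (R : realType) (K : fieldType) (v : real_valuation R K).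

Lemma fps_substB k n (a b : fps K k) (Phi : 'I_k -> fps K n) :
  fps_subst (a - b) Phi = fps_subst a Phi - fps_subst b Phi.
Proof. by rewrite fps_substD -scaleN1r fps_substZ scaleN1r. Qed.

Lemma fps_coef0M n (a b : fps K n) : (a * b) 0%MM = a 0%MM * b 0%MM.
Proof.
rewrite (fps_mulwE _ _ (ltnSn _)) mdeg0.
have p1 : perm_eq (mons n 1) [:: 0%MM].
  apply: uniq_perm; rewrite ?mons_uniq // => m.
  by rewrite mem_mons inE ltnS leqn0 mdeg_eq0.
rewrite (perm_big _ p1) big_seq1 (perm_big _ p1) big_cons big_nil /= addm0 eqxx.
by rewrite addr0.
Qed.

Lemma fps_subst_coef0 k n (a : fps K k) (Phi : 'I_k -> fps K n) :
  (forall i, Phi i 0%MM = 0) -> fps_subst a Phi 0%MM = a 0%MM.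
Proof.
move=> Phi0; have := fps_subst_ord Phi0 (d := 1) (a := a - a 0%MM *: 1).
move=> /(_ _)/(_ 0%MM); rewrite mdeg0 fps_substB fps_substZ fps_subst1 /= eqxx mulr1.
move=> H; apply/eqP; rewrite -subr_eq0; apply/eqP/H => // m.
by rewrite ltnS leqn0 mdeg_eq0 => /eqP -> /=; rewrite eqxx mulr1 subrr.
Qed.

Lemma fps_subst_free k n (P : pred 'I_k) (a : fps K k) (Phi Psi : 'I_k -> fps K n) :
    (forall m, (0 < wdeg P m)%N -> a m = 0) ->
    (forall i, ~~ P i -> Phi i = Psi i) ->
  fps_subst a Phi = fps_subst a Psi.
Proof.
move=> ha e; apply/fpsP => m /=; apply/eq_bigr => l _.
have [/ha ->|] := ltnP 0 (wdeg P l); first by rewrite !mul0r.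
rewrite leqn0 /wdeg sum_nat_eq0 => /forallP P0; congr (_ * (_ : fps K n) m).
apply/eq_bigr => i _; case: (boolP (P i)) => [Pi|/e -> //].
by have := P0 i; rewrite Pi /= => /eqP ->; rewrite !expr0.
Qed.

Lemma cpsP n (a b : cps v n) : a = b :> fps K n -> a = b.
Proof. exact: val_inj. Qed.

Lemma cps_coef0M n (a b : cps v n) : (a * b) 0%MM = a 0%MM * b 0%MM.
Proof. exact: fps_coef0M. Qed.

Lemma cps_subst_coef0 k n (a : cps v k) (Phi : 'I_k -> cps v n) :
  (forall i, Phi i 0%MM = 0) -> cps_subst a Phi 0%MM = a 0%MM.
Proof. by move=> P0; rewrite cps_substE // fps_subst_coef0. Qed.

Lemma cps_substD k n (a b : cps v k) (Phi : 'I_k -> cps v n) :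
    (forall i, Phi i 0%MM = 0) ->
  cps_subst (a + b) Phi = cps_subst a Phi + cps_subst b Phi.
Proof. by move=> P0; apply: cpsP; rewrite /= !cps_substE // fps_substD. Qed.

Lemma cps_substB k n (a b : cps v k) (Phi : 'I_k -> cps v n) :
    (forall i, Phi i 0%MM = 0) ->
  cps_subst (a - b) Phi = cps_subst a Phi - cps_subst b Phi.
Proof. by move=> P0; apply: cpsP; rewrite /= !cps_substE //= fps_substB. Qed.

Lemma cps_substZ k n c (a : cps v k) (Phi : 'I_k -> cps v n) :
  (forall i, Phi i 0%MM = 0) -> cps_subst (c *: a) Phi = c *: cps_subst a Phi.
Proof. by move=> P0; apply: cpsP; rewrite /= !cps_substE //= fps_substZ. Qed.

Lemma cps_substX k n (i : 'I_k) (Phi : 'I_k -> cps v n) :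
  (forall i, Phi i 0%MM = 0) -> cps_subst (cpsX i) Phi = Phi i.
Proof. by move=> P0; apply: cpsP; rewrite /= !cps_substE //= fps_substX. Qed.

Lemma cps_substXid n (a : cps v n) : cps_subst a cpsX = a.
Proof.
apply: cpsP; rewrite cps_substE ?fps_substXid // => i; exact: cpsX0.
Qed.

Lemma cps_subst_comp k n r (a : cps v k) (Phi : 'I_k -> cps v n)
    (Psi : 'I_n -> cps v r) :
    (forall i, Phi i 0%MM = 0) -> (forall i, Psi i 0%MM = 0) ->
  cps_subst (cps_subst a Phi) Psi = cps_subst a (fun i => cps_subst (Phi i) Psi).
Proof.
move=> Phi0 Psi0; apply: cpsP; rewrite !cps_substE //; last first.
  by move=> i; rewrite cps_subst_coef0.
rewrite fps_subst_comp //; congr fps_subst.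
by apply/funext => i; rewrite cps_substE.
Qed.

Lemma fps_bnd1 n (e : 'I_n -> R) : (forall i, 0 <= e i) -> fps_bnd v e 1 (1 : fps K n).
Proof.
move=> e0 d; apply: (le_trans (fps_bnd_norm v (d := 1) d e0 _)).
  by move=> m; rewrite lt0n mdeg_eq0 /= => /negPf ->.
rewrite /fps_norm (perm_big [:: 0%MM]) ?big_seq1 /= ?eqxx ?rval1 ?mul1r.
  by rewrite rmon0.
apply: uniq_perm; rewrite ?mons_uniq // => m.
by rewrite mem_mons inE ltnS leqn0 mdeg_eq0.
Qed.

(* With [a = c (1 - u)], the inverse of [1 - u] is the fixed point of
   [b |-> 1 + u b]. *)
Lemma cps_unit n (a : cps v n) : a 0%MM != 0 -> exists b, a * b = 1.
Proof.
move=> a0; pose u : cps v n := 1 - (a 0%MM)^-1 *: a.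
have u0 : u 0%MM = 0 by rewrite /= eqxx mulVf ?subrr.
have hpos : 0 < 2^-1 :> R by rewrite invr_gt0 ltr0Sn.
have [e e0 hu] := fps_conv_shrink u0 (cps_conv u) hpos.
have e0' i : 0 <= e i by apply/ltW.
pose T (b : unit -> fps K n) (i : unit) : fps K n := 1 + (u : fps K n) * b i.
have hT d Psi Psi' : (forall i, fps_grd mdeg d (Psi i - Psi' i)) ->
    forall i, fps_grd mdeg d.+1 (T Psi i - T Psi' i).
  move=> h i; rewrite /T opprD addrACA subrr add0r -mulrBr.
  apply: (@fps_grdM _ _ mdeg mdeg _ 1 d); last exact: h.
    by move=> k l hk hl; rewrite mdegD -add1n leq_add.
  by move=> m; rewrite ltnS leqn0 mdeg_eq0 => /eqP ->.
have hB Psi : (forall i, fps_bnd v e 2 (Psi i)) -> forall i, fps_bnd v e 2 (T Psi i).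
  move=> h i; have -> : 2 = 1 + 2^-1 * 2 :> R by rewrite mulVf ?pnatr_eq0.
  by apply: fps_bndD => //; [exact: fps_bnd1|exact: fps_bndM].
have [Psi [bPsi fPsi]] := fps_fixed_point (ler0n R 2) hT hB.
have cPsi : fps_conv v (Psi tt) by apply/fps_convP; exists e => //; exists 2.
pose b : cps v n := Cps (introT (conv_predP _ _) cPsi).
exists ((a 0%MM)^-1 *: b); rewrite -scalerAr scalerAl.
have -> : (a 0%MM)^-1 *: a = 1 - u by rewrite /u subKr.
apply/eqP; rewrite mulrBl mul1r subr_eq; apply/eqP/cpsP.
by rewrite /= -[LHS]fPsi.
Qed.

(** With this selection a series splits into a part free of the variables [P i] and multiples of
    single variables [P i]. *)
Definition pick_var n q (P : 'I_q -> 'I_n) (m : 'X_{1..n}) : option 'I_q :=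
  [pick i | (0 < m (P i))%N].

Lemma pick_var_le n q (P : 'I_q -> 'I_n) m i :
  pick_var P m = Some i -> (U_(P i) <= m)%MM.
Proof. by rewrite /pick_var; case: pickP => // j mj [<-]; rewrite lep1mP -lt0n. Qed.

Definition cps_shift n q (P : 'I_q -> 'I_n) (i : 'I_q) (a : cps v n) : cps v n :=
  Cps (introT (conv_predP _ _)
    (fps_shift_conv (fun i => U_(P i)%MM) (pick_var P) i (cps_conv a))).

Definition cps_rest n q (P : 'I_q -> 'I_n) (a : cps v n) : cps v n :=
  Cps (introT (conv_predP _ _) (fps_rest_conv (pick_var P) (cps_conv a))).

Lemma cps_shift_decomp n q (P : 'I_q -> 'I_n) (a : cps v n) :
  a = cps_rest P a + \sum_i cpsX (P i) * cps_shift P i a.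
Proof.
apply: cpsP; rewrite /= [LHS](fps_shift_decomp _ (@pick_var_le _ _ P)).
congr (_ + _); rewrite [RHS](big_morph (@cps_val R K v n) (id1 := 0) (op1 := +%R)) //.
Qed.

Lemma cps_maxP n (a : cps v n) : cps_max a <-> a 0%MM = 0.
Proof.
split=> [[h ->]|a0].
  rewrite (big_morph (fun a : cps v n => a 0%MM) (id1 := 0) (op1 := +%R)) //.
  by rewrite big1 // => i _; rewrite cps_coef0M cpsX0 mulr0.
exists (fun i => cps_shift id i a).
rewrite {1}(cps_shift_decomp id a) [cps_rest _ _](_ : _ = 0) ?add0r.
  by apply/eq_bigr => i _; rewrite mulrC.
apply: cpsP; apply/fpsP => m /=; rewrite /pick_var; case: pickP => // m0.
rewrite (_ : m = 0%MM) //; apply/mnmP => i; rewrite mnm0E.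
by have := m0 i; case: (m i).
Qed.

Lemma cps_ord2_max2 n (a : cps v n) : fps_ord 2 a ->
  ideal_prod (@cps_max R K v n) (@cps_max R K v n) a.
Proof.
move=> a2; exists n, (fun i => cpsX i), (fun i => cps_shift id i a); split.
- by move=> i; apply/cps_maxP/cpsX0.
- move=> i; apply/cps_maxP => /=; case: ifP => // _.
  by rewrite a2 // mdegD mdeg0 mdeg1.
rewrite {1}(cps_shift_decomp id a) [cps_rest _ _](_ : _ = 0) ?add0r //.
apply: cpsP; apply/fpsP => m /=; rewrite /pick_var; case: pickP => // m0.
rewrite a2 // (_ : m = 0%MM) ?mdeg0 //; apply/mnmP => i; rewrite mnm0E.
by have := m0 i; case: (m i).
Qed.

Lemma wdeg_isr_gt0 n k (m : 'X_{1..n + k}) :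
  reflect (exists i, (0 < m (rshift n i))%N) (0 < wdeg (isr n k) m)%N.
Proof.
apply: (iffP (wdeg_gt0P _ _)) => [[i]|[i mi]]; last by exists (rshift n i); rewrite ?isr_r.
by case: (split_ordP i) => j ->; rewrite ?isr_l // => _; exists j.
Qed.

(** Taylor's formula of order one in Hadamard's form, valid in every characteristic. The increments
    are taken as new variables [y], and [a (Phi + y)] is split along them; one convergent [M i] then
    serves all increments, and at [y = 0] the chain rule identifies it with the [i]-th partial
    derivative at [Phi]. *)
Lemma cps_hadamard k n (a : cps v k) (Phi : 'I_k -> cps v n) :
    (forall i, Phi i 0%MM = 0) ->
  exists M : 'I_k -> cps v (n + k),
    (forall y : 'I_k -> cps v n, (forall i, y i 0%MM = 0) ->
       cps_subst a (fun i => Phi i + y i) =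
       cps_subst a Phi + \sum_i y i * cps_subst (M i) (join cpsX y)) /\
    (forall i, fps_grd (wdeg (isr n k)) 1
       (M i - cps_subst (cps_subst (cps_deriv i a) Phi) (fun j => cpsX (lshift k j)))).
Proof.
move=> Phi0; pose XL (j : 'I_n) : cps v (n + k) := cpsX (lshift k j).
pose XR (j : 'I_k) : cps v (n + k) := cpsX (rshift n j).
have XL0 j : XL j 0%MM = 0 by exact: cpsX0.
have XR0 j : XR j 0%MM = 0 by exact: cpsX0.
pose Th i := cps_subst (Phi i) XL + XR i.
have PhiX0 i : cps_subst (Phi i) XL 0%MM = 0 by rewrite cps_subst_coef0.
have Th0 i : Th i 0%MM = 0 by rewrite /= PhiX0 [X in _ + X]XR0 addr0.
pose A := cps_subst a Th.
pose P := fun i : 'I_k => rshift n i.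
exists (fun i => cps_shift P i A); split=> [y y0|i].
  have J0 (z : 'I_k -> cps v n) : (forall i, z i 0%MM = 0) ->
      forall i, (join cpsX z i : cps v n) 0%MM = 0.
    by move=> z0; apply: (join_ind (P := fun a : cps v n => a 0%MM = 0)) => // i; exact: cpsX0.
  have AE (z : 'I_k -> cps v n) : (forall i, z i 0%MM = 0) ->
      cps_subst A (join cpsX z) = cps_subst a (fun i => Phi i + z i).
    move=> z0; rewrite cps_subst_comp //; last exact: J0.
    congr cps_subst; apply/funext => i; rewrite cps_substD; last exact: J0.
    rewrite cps_subst_comp //; last exact: J0.
    rewrite cps_substX ?join_rshift; last exact: J0.
    congr (_ + _); rewrite -[RHS]cps_substXid; congr cps_subst; apply/funext => j.
    by rewrite cps_substX ?join_lshift //; exact: J0.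
  have AD (z : 'I_k -> cps v n) : (forall i, z i 0%MM = 0) ->
      cps_subst A (join cpsX z) = cps_subst (cps_rest P A) (join cpsX z) +
        \sum_i z i * cps_subst (cps_shift P i A) (join cpsX z).
    move=> z0; rewrite {1}(cps_shift_decomp P A) cps_substD; last exact: J0.
    congr (_ + _); rewrite cps_subst_sum; last exact: J0.
    apply/eq_bigr => i _; rewrite cps_substM; last exact: J0.
    by rewrite cps_substX ?join_rshift //; exact: J0.
  have z0 (i : 'I_k) : (0 : cps v n) 0%MM = 0 by [].
  rewrite -AE // AD //; congr (_ + _).
  (* The rest contains no variable [y], so the increments in it may be replaced by 0. *)
  transitivity (cps_subst (cps_rest P A) (join cpsX (fun=> 0))).
    apply: cpsP; rewrite !cps_substE; try exact: J0.
    apply: (@fps_subst_free _ _ (isr n k)) => [m|i].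
      move=> /wdeg_isr_gt0[i mi] /=; rewrite /pick_var; case: pickP => // /(_ i).
      by rewrite mi.
    by case: (split_ordP i) => j ->; rewrite ?isr_r // !join_lshift.
  transitivity (cps_subst A (join cpsX (fun=> 0))).
    by rewrite AD // big1 ?addr0 // => i _; rewrite mul0r.
  rewrite AE //; congr cps_subst; apply/funext => i; by rewrite addr0.
have dXL j : fps_deriv (rshift n i) (XL j) = 0.
  by rewrite /= fps_derivX eq_rlshift.
have dTh j : fps_deriv (rshift n i) (Th j) = (j == i)%:R.
  rewrite fps_derivD /= fps_derivX eq_rshift eq_sym cps_substE // fps_chain //.
  by rewrite big1 ?add0r // => l _; rewrite dXL mulr0.
have dA : fps_deriv (rshift n i) A = fps_subst (fps_deriv i a) Th.
  rewrite /A cps_substE // fps_chain // (bigD1 i) //= dTh eqxx mulr1.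
  by rewrite big1 ?addr0 // => j /negPf ne; rewrite dTh ne mulr0.
have cong : fps_grd (wdeg (isr n k)) 1
    (fps_deriv (rshift n i) A - cps_val (cps_subst (cps_subst (cps_deriv i a) Phi) XL)).
  rewrite dA cps_subst_comp // cps_substE //.
  apply: fps_subst_wdeg_cong => j.
  rewrite -[X in fps_grd _ _ X]/(cps_val (Th j - cps_subst (Phi j) XL)).
  rewrite /Th addrAC subrr add0r => m /=.
  case: eqP => // ->; rewrite wdegU isr_r //.
(* For [m] free of [y], the coefficient of [M i] at [m] is that of [A] at [m] times [y_i], and the
   derivative of [A] in [y_i] has the same coefficient, with factor 1. *)
move=> m lt_m; rewrite -[RHS](cong m lt_m) /=.
have -> : pick_var P (m + U_(P i))%MM = Some i.
  rewrite /pick_var; case: pickP => [j|/(_ i)]; last by rewrite mnmDE mnm1E eqxx addn1.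
  have [->//|ne] := eqVneq j i.
  rewrite mnmDE mnm1E /P eq_rshift eq_sym (negPf ne) addn0 => mj.
  by move: lt_m; rewrite ltnS leqn0 -[_ == _]negbK -lt0n; case/negP; apply/wdeg_isr_gt0; exists j.
rewrite eqxx; congr (_ - _).
suff -> : m (rshift n i) = 0%N by rewrite mulr1n.
apply/eqP; rewrite -leqn0 leqNgt; apply/negP => mi; move: lt_m; rewrite ltnS leqn0 -[_ == _]negbK -lt0n.
by case/negP; apply/wdeg_isr_gt0; exists i.
Qed.

Lemma cps_subst_cong k n (a : cps v k) (Phi Psi : 'I_k -> cps v n) :
    (forall i, Phi i 0%MM = 0) -> (forall i, Psi i 0%MM = 0) ->
  exists h : 'I_k -> cps v n,
    cps_subst a Phi - cps_subst a Psi = \sum_i h i * (Phi i - Psi i).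
Proof.
move=> Phi0 Psi0; have [M [hM _]] := cps_hadamard a Psi0.
pose y i := Phi i - Psi i.
have y0 i : y i 0%MM = 0 by rewrite /= Phi0 Psi0 subrr.
exists (fun i => cps_subst (M i) (join cpsX y)).
have := hM y y0; rewrite (_ : (fun i => Psi i + y i) = Phi); last first.
  by apply/funext => i; rewrite /y addrC subrK.
move=> ->; rewrite addrC addKr; apply/eq_bigr => i _; by rewrite mulrC.
Qed.

End Series.

(** * Closedness of ideals *)

(** Dickson's lemma, by induction on the number [k] of coordinates compared. Let [s] work for [k]
    coordinates and let [B] bound their next coordinate on [s]: monomials with next coordinate at
    least [B] are covered by [s], and each of the finitely many smaller values is a slice to which
    the induction hypothesis applies. *)
Lemma dickson n (P : 'X_{1..n} -> Prop) :
  exists s : seq 'X_{1..n}, (forall m, m \in s -> P m) /\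
    forall m, P m -> exists2 w, w \in s & (w <= m)%MM.
Proof.
suff H k : exists s : seq 'X_{1..n}, (forall m, m \in s -> P m) /\
    forall m, P m -> exists2 w, w \in s & forall i : 'I_n, (i < k)%N -> (w i <= m i)%N.
  have [s [sP hs]] := H n; exists s; split=> // m /hs[w ws le_w]; exists w => //.
  by apply/mnm_lepP => i; exact: le_w.
elim: k P => [|k IH] P.
  have [[m0 Pm0]|nP] := pselect (exists m, P m).
    by exists [:: m0]; split=> [m|m _]; [rewrite inE => /eqP ->|exists m0; rewrite ?inE].
  by exists [::]; split=> // m Pm; case: nP; exists m.
have [s [sP hs]] := IH P.
have [lt_k|le_k] := ltnP k n; last first.
  exists s; split=> // m /hs[w ws le_w]; exists w => // i _.
  by apply: le_w; exact: leq_trans (ltn_ord i) le_k.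
pose o := Ordinal lt_k.
have /choice[t ht] b := IH (fun m => P m /\ m o = b).
pose B := \sum_(w <- s) w o.
exists (s ++ flatten [seq t b | b <- iota 0 B]); split=> [m|m Pm].
  rewrite mem_cat => /orP[/sP //|/flatten_mapP[b _ mb]].
  by have [] := (ht b).1 _ mb.
have [le_B|lt_B] := leqP B (m o).
  have [w ws le_w] := hs _ Pm; exists w; first by rewrite mem_cat ws.
  move=> i; rewrite ltnS leq_eqVlt => /orP[/eqP ik|]; last exact: le_w.
  have -> : i = o by apply/val_inj.
  by apply: leq_trans le_B; rewrite /B (big_rem w ws) leq_addr.
have [w ws le_w] := (ht (m o)).2 m (conj Pm erefl); exists w.
  rewrite mem_cat; apply/orP; right; apply/flatten_mapP; exists (m o) => //.
  by rewrite mem_iota add0n.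
move=> i; rewrite ltnS leq_eqVlt => /orP[/eqP ik|]; last exact: le_w.
have -> : i = o by apply/val_inj.
by have [_ ->] := (ht (m o)).1 _ ws.
Qed.

Fixpoint nth_prime (k : nat) : nat :=
  s2val (prime_above (if k is k'.+1 then nth_prime k' else 0%N)).

Lemma nth_prime_prime k : prime (nth_prime k).
Proof. by case: k => [|k] /=; case: prime_above. Qed.

Lemma nth_prime_lt k l : (k < l)%N -> (nth_prime k < nth_prime l)%N.
Proof.
elim: l => // l IH; rewrite ltnS leq_eqVlt => /orP[/eqP ->|/IH lt_k].
  by rewrite [nth_prime l.+1]/=; case: prime_above.
by apply: ltn_trans lt_k _; rewrite [nth_prime l.+1]/=; case: prime_above.
Qed.

Lemma nth_prime_inj : injective nth_prime.
Proof.
move=> k l; have [/nth_prime_lt|/nth_prime_lt|//] := ltngtP k l => h e.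
  by rewrite e ltnn in h.
by rewrite e ltnn in h.
Qed.

(* Ordering the monomials by the integers [\prod_i p_i ^ m_i], with [p_i]
   distinct primes, is a monomial order for which [m] is weighed, at the radii
   [p_i ^- t], by a power of its rank. *)
Section MonomialRank.
Variable n : nat.
Implicit Types m : 'X_{1..n}.

Definition mrank m : nat := (\prod_(i < n) nth_prime i ^ m i)%N.

Lemma mrankD m m' : mrank (m + m')%MM = (mrank m * mrank m')%N.
Proof.
by rewrite /mrank -big_split; apply/eq_bigr => i _; rewrite mnmDE expnD.
Qed.

Lemma mrank_gt0 m : (0 < mrank m)%N.
Proof. by apply: prodn_gt0 => i; rewrite expn_gt0 prime_gt0 ?nth_prime_prime. Qed.

Lemma logn_mrank m (i : 'I_n) : logn (nth_prime i) (mrank m) = m i.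
Proof.
have pr j := nth_prime_prime j.
have p0 j k : (0 < nth_prime j ^ k)%N by rewrite expn_gt0 prime_gt0.
rewrite /mrank (bigD1 i) //= lognM ?p0 //; last by apply: prodn_cond_gt0 => j _.
rewrite pfactorK // logn_coprime ?addn0 //.
apply: (big_ind (fun x => coprime (nth_prime i) x)) => [|x y hx hy|j ne].
- by rewrite coprimen1.
- by rewrite coprimeMr hx.
apply: coprimeXr; rewrite prime_coprime // dvdn_prime2 //.
by apply: contra ne => /eqP/nth_prime_inj e; apply/eqP/val_inj.
Qed.

Lemma mrank_inj : injective mrank.
Proof. by move=> m m' e; apply/mnmP => i; rewrite -!logn_mrank e. Qed.

Lemma mrank_ge m : (2 ^ mdeg m <= mrank m)%N.
Proof.
rewrite mdegE expn_sum; apply: leq_prod => i _.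
by case: (m i) => // k; rewrite leq_exp2r // prime_gt1 ?nth_prime_prime.
Qed.

Lemma mrank_gt m : (mdeg m < mrank m)%N.
Proof. by apply: leq_trans (mrank_ge m); exact: ltn_expl. Qed.

Definition mradius (R : realType) (t : nat) : 'I_n -> R :=
  fun i => (nth_prime i)%:R ^- t.

Lemma mradius_gt0 (R : realType) t i : 0 < mradius R t i.
Proof. by rewrite invr_gt0 exprn_gt0 // ltr0n prime_gt0 ?nth_prime_prime. Qed.

Lemma rmon_mradius (R : realType) t m : rmon (mradius R t) m = (mrank m)%:R ^- t.
Proof.
rewrite /rmon /mrank natr_prod -prodrXl -prodfV; apply/eq_bigr => i _.
by rewrite natrX exprVn -!exprM mulnC.
Qed.

End MonomialRank.

Lemma lead_exists (K : fieldType) n (b : fps K n) : b <> 0 ->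
  exists2 m, b m != 0 & forall m', b m' != 0 -> (mrank m <= mrank m')%N.
Proof.
move=> b0; have ex : exists r, `[< exists2 m, b m != 0 & mrank m = r >].
  apply: contra_notP b0 => nex; apply/fpsP => m; apply/eqP/negP => /negP bm.
  by apply: nex; exists (mrank m); apply/asboolP; exists m.
case: (ex_minnP ex) => r /asboolP[m bm <-] hmin; exists m => // m' bm'.
by apply: hmin; apply/asboolP; exists m'.
Qed.

(** Bernoulli's inequality [(1 + 1/N)^s >= s/N] without denominators. It shows that terms of rank
    above [N] become negligible against rank [N] as the exponent of the radii grows. *)
Lemma bernoulli_nat (N s : nat) : (s * N ^ s <= N * N.+1 ^ s)%N.
Proof.
elim: s => [|s IH]; first by rewrite mul0n.
rewrite !expnS; apply: (@leq_trans (N * (s * N ^ s) + N * N ^ s)%N).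
  by rewrite mulSn mulnCA addnC.
rewrite [leqRHS]mulnCA mulSn addnC; apply: leq_add; last by rewrite leq_mul2l IH orbT.
by apply: leq_mul => //; case: s {IH} => // s; rewrite leq_exp2r.
Qed.

(** * Grauert's division and Krull's intersection theorem *)

Section KrullClosed.
Variables (R : realType) (K : fieldType) (v : real_valuation R K) (n : nat).

Lemma exp2N_le (r : R) : 0 < r -> exists t : nat, 2%:R ^- t <= r.
Proof.
move=> r0; exists (Num.bound r^-1).
rewrite -[leRHS]invrK lef_pV2 ?posrE ?invr_gt0 ?exprn_gt0 ?ltr0n //.
apply: le_trans (ltW (archi_boundP _)) _; first by rewrite invr_ge0 ltW.
by rewrite -natrX ler_nat ltnW // ltn_expl.
Qed.

(* Grauert's division with remainder: for small enough radii the leading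
   monomials dominate the rests of the divisors in norm. *)
Lemma cps_division (I : finType) (w : I -> 'X_{1..n}) (G : I -> cps v n)
    (sel : 'X_{1..n} -> option I) (a : cps v n) :
    (forall m i, sel m = Some i -> (w i <= m)%MM) ->
    (forall i, G i (w i) = 1) ->
    (forall i m, G i m != 0 -> m != w i -> (mrank (w i) < mrank m)%N) ->
  exists (q : I -> cps v n) (r : cps v n),
    a = \sum_i q i * G i + r /\ forall m, sel m <> None -> r m = 0.
Proof.
move=> selP Gw Glt; pose H i : fps K n := (G i : fps K n) - fps_mon K (w i).
have Hgrd i : fps_grd (@mrank n) (mrank (w i)).+1 (H i).
  move=> m lt_m; rewrite /=; have [->|ne] := eqVneq m (w i).
    by rewrite Gw subrr.
  rewrite subr0; apply/eqP; apply: contraTT lt_m => /Glt/(_ ne).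
  by rewrite -leqNgt.
have cmon i : fps_conv v (fps_mon K (w i)).
  apply: (@fps_conv_fin _ _ _ _ (mdeg (w i)).+1) => m /=.
  by case: eqP => // ->; rewrite ltnn.
have cH i : fps_conv v (H i) := fps_convB (cps_conv (G i)) (cmon i).
pose fam (o : option I) : fps K n := if o is Some i then H i else a.
have cfam o : fps_conv v (fam o) by case: o => [i|]; [exact: cH|exact: cps_conv].
have [r0 [M [r0_gt0 M0 bM]]] := fps_conv_common cfam.
have [t0 ht0] := exp2N_le r0_gt0.
pose r := #|I|.+1.
pose D := (\sum_i mrank (w i))%N.
(* Passing from [t0] to [t0 + s] multiplies the norm of [H i] by at most [(N + 1)^-s], where [N] is
   the rank of [w i], which [D] bounds. By Bernoulli this [s] makes the norm at most the weight of
   [w i] divided by [2 r]. *)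
pose s := Num.bound (M * (2 * r%:R) * D%:R ^+ t0.+1).
pose e := @mradius n R (t0 + s).
have e0 i : 0 < e i by exact: mradius_gt0.
have e0' i : 0 <= e i by exact/ltW.
have et0 i : 0 <= @mradius n R t0 i <= r0.
  rewrite (ltW (mradius_gt0 _ _ _)) (le_trans _ ht0) //.
  rewrite lef_pV2 ?posrE ?exprn_gt0 ?ltr0n ?prime_gt0 ?nth_prime_prime //.
  by rewrite lerXn2r ?nnegrE ?ler0n // ler_nat prime_gt1 ?nth_prime_prime.
have le_e i : 0 <= e i <= @mradius n R t0 i.
  rewrite ltW //= lef_pV2 ?posrE ?exprn_gt0 ?ltr0n ?prime_gt0 ?nth_prime_prime //.
  by rewrite ler_weXn2l ?leq_addr // ler1n prime_gt0 ?nth_prime_prime.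
have ba : fps_bnd v e M a.
  exact: fps_bnd_le le_e (fps_bnd_le et0 (bM None)).
have bH i : fps_bnd v e (rmon e (w i) / (2 * r%:R)) (H i).
  have N0 := mrank_gt0 (w i); set N := mrank (w i) in N0.
  have := fps_bnd_le et0 (bM (Some i)) => /= bHi.
  have bs : fps_bnd v e (N.+1%:R ^- s * M) (H i).
    apply: fps_bnd_scale bHi => [|m Hm]; first by rewrite invr_ge0 exprn_ge0.
    rewrite !rmon_mradius exprD invfM mulrC ler_wpM2r ?invr_ge0 ?exprn_ge0 //.
    rewrite lef_pV2 ?posrE ?exprn_gt0 ?ltr0n ?mrank_gt0 //.
    rewrite lerXn2r ?nnegrE ?ler0n // ler_nat ltnNge.
    by apply: contra Hm => le_m; rewrite (Hgrd i).
  apply: fps_bnd_leM bs; rewrite rmon_mradius -/N.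
  rewrite ler_pdivlMr ?mulr_gt0 ?ltr0n // -mulrA mulrC ler_pdivrMr ?exprn_gt0 ?ltr0n //.
  rewrite ler_pdivlMl ?exprn_gt0 ?ltr0n //.
  rewrite -(ler_pM2l (_ : 0 < N%:R)) ?ltr0n //.
  have hb : s%:R * N%:R ^+ s <= N%:R * N.+1%:R ^+ s :> R.
    by rewrite -!natrX -!natrM ler_nat bernoulli_nat.
  apply: le_trans hb; rewrite exprD [leLHS](_ : _ = (M * (2 * r%:R) * N%:R ^+ t0.+1) * N%:R ^+ s); last first.
    rewrite exprS; ring.
  rewrite ler_wpM2r ?exprn_ge0 //.
  apply: le_trans (ltW (archi_boundP _)); last by rewrite !mulr_ge0 ?exprn_ge0.
  rewrite ler_wpM2l ?mulr_ge0 // lerXn2r ?nnegrE ?ler0n // ler_nat.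
  by rewrite /D (bigD1 i) //= leq_addr.
(* If [b] is a fixed point, then [a = b + \sum_i shift_i b * H i]; splitting [b] itself by [sel]
   turns each [H i] into [G i] and leaves the rest of [b] as remainder. *)
pose T (b : unit -> fps K n) (_ : unit) : fps K n :=
  (a : fps K n) - \sum_i fps_shift w sel i (b tt) * H i.
have hT d Psi Psi' : (forall i, fps_grd (@mrank n) d (Psi i - Psi' i)) ->
    forall i, fps_grd (@mrank n) d.+1 (T Psi i - T Psi' i).
  move=> h u; rewrite /T opprD addrACA subrr add0r -opprD -sumrB.
  apply/fps_grdN/fps_grd_sum => i _; rewrite -mulrBl -fps_shiftB.
  apply: (@fps_grdM _ _ (fun m => mrank (m + w i)%MM) (@mrank n) (@mrank n) d (mrank (w i)).+1) => //.
    move=> k l; rewrite !mrankD => hk hl.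
    apply: leq_trans (leq_mul (leqnn _) hl); rewrite mulnS -addn1 addnC.
    by rewrite leq_add ?mrank_gt0.
  by move=> m lt_m /=; case: ifP => // _; exact: (h tt).
have hB Psi : (forall i, fps_bnd v e (2 * M) (Psi i)) ->
    forall i, fps_bnd v e (2 * M) (T Psi i).
  move=> h u; rewrite /T.
  have bsum : fps_bnd v e (\sum_(i : I) (M / r%:R)) (\sum_i fps_shift w sel i (Psi tt) * H i).
    apply: fps_bnd_sum => // i.
    have := fps_bndM e0' (fps_shift_bnd w sel i e0 (h tt)) (bH i).
    apply: fps_bnd_leM; rewrite mulrA divfK ?gt_eqF ?rmon_gt0 //.
    by rewrite -mulf_div divff ?mul1r ?pnatr_eq0.
  apply: fps_bnd_leM (fps_bndD e0' ba (fps_bndN bsum)).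
  have -> : 2 * M = M + M by ring.
  rewrite sumr_const lerD2l -(mulr_natl (M / r%:R)) mulrCA ler_piMr // ler_pdivrMr ?ltr0n //.
  by rewrite mul1r ler_nat leqnSn.
have [Psi [bPsi fPsi]] := fps_fixed_point (mulr_ge0 (ler0n R 2) M0) hT hB.
have cPsi : fps_conv v (Psi tt) by apply/fps_convP; exists e => //; exists (2 * M).
exists (fun i => Cps (introT (conv_predP _ _) (fps_shift_conv w sel i cPsi))).
exists (Cps (introT (conv_predP _ _) (fps_rest_conv sel cPsi))); split; last first.
  by move=> m /=; case: (sel m).
have ea : (a : fps K n) = Psi tt + \sum_i fps_shift w sel i (Psi tt) * H i.
  by rewrite -{1}[Psi tt]fPsi subrK.
apply: cpsP; rewrite [LHS]ea {1}(fps_shift_decomp (Psi tt) selP) -addrA addrC.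
rewrite -[RHS]/(cps_val (\sum_i _) + fps_rest sel (Psi tt)).
congr (_ + _); rewrite (big_morph (@cps_val R K v n) (id1 := 0) (op1 := +%R)) //.
rewrite -big_split; apply/eq_bigr => i _ /=.
by rewrite /H mulrBr [X in X + _]mulrC addrC subrK.
Qed.

(** Divide [a] by finitely many elements of [J] whose leading monomials divide all leading monomials
    of [J]. A nonzero remainder would share its leading monomial with an element of [J]
    approximating it closely, yet no monomial of the remainder is divisible by one of the [w i]. *)
Lemma krull_intersection (J : idealr (cps v n)) (a : cps v n) :
  (forall N, exists2 b, b \in J & fps_ord N (a - b)) -> a \in J.
Proof.
move=> ha.
pose lead (b : cps v n) m :=
  b m != 0 /\ forall m', b m' != 0 -> (mrank m <= mrank m')%N.
have [s [sP hs]] := dickson (fun m => exists2 b, b \in J & lead b m).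
pose w (i : 'I_(size s)) := tnth (in_tuple s) i.
have /choice[G hG] (i : 'I_(size s)) : exists b : cps v n, [/\ b \in J, b (w i) = 1 &
    forall m, b m != 0 -> m != w i -> (mrank (w i) < mrank m)%N].
  have [b Jb [b0 bmin]] := sP _ (mem_tnth i (in_tuple s)).
  exists ((b (w i))^-1 *: b); split; first by rewrite -mulr_algl idealMr.
    by rewrite -[LHS]/((b (w i))^-1 * b (w i)) mulVf.
  move=> m; rewrite /= mulf_eq0 negb_or => /andP[_ /bmin]; rewrite leq_eqVlt.
  by case/orP => // /eqP/mrank_inj <-; rewrite eqxx.
pose sel m : option 'I_(size s) := [pick i | (w i <= m)%MM].
have selP m i : sel m = Some i -> (w i <= m)%MM.
  by rewrite /sel; case: pickP => // j le [<-].
have [] := @cps_division 'I_(size s) w G sel a selP.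
- by move=> i; have [] := hG i.
- by move=> i; have [] := hG i.
move=> q [r [ea hr]].
have JqG : \sum_i q i * G i \in J.
  by apply: rpred_sum => i _; have [JG _ _] := hG i; rewrite idealMr.
suff r0 : r = 0 by rewrite ea r0 addr0.
apply/eqP/negPn/negP => r0.
have [|m rm rmin] := @lead_exists _ _ (r : fps K n).
  by move=> e; case/eqP: r0; exact: (@cpsP _ _ _ _ r 0).
(* Precision [mrank m] suffices: monomials of at least this degree have rank larger than that of
   [m]. *)
have [b Jb ab] := ha (mrank m).
pose c := b - \sum_i q i * G i.
have Jc : c \in J by rewrite rpredB.
have rc : fps_ord (mrank m) (r - c).
  by rewrite (_ : r - c = a - b) // /c ea opprB addrA; congr (_ - _); rewrite addrC.
have lc : lead c m.
  split; first by have := rc m (mrank_gt m); move=> /eqP; rewrite /= subr_eq0 => /eqP <-.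
  move=> m' cm'; have [lt|le] := ltnP (mdeg m') (mrank m).
    by apply: rmin; have := rc m' lt; move=> /eqP; rewrite /= subr_eq0 => /eqP ->.
  exact: leq_trans le (ltnW (mrank_gt _)).
have [w' ws le_w] := hs m (ex_intro2 _ _ c Jc lc).
have lt_i : (index w' s < size s)%N by rewrite index_mem.
case/eqP: rm; apply: hr; rewrite /sel; case: pickP => // /(_ (Ordinal lt_i)).
by rewrite /w (tnth_nth w') /= nth_index // le_w.
Qed.

End KrullClosed.

(** * Division by the Jacobian ideal *)

Section FSpan.
Variables (A : comNzRingType) (k : nat) (g : 'I_k -> A).

Lemma fspan0 : fspan g 0.
Proof. by exists (fun=> 0); rewrite big1 // => i _; rewrite mul0r. Qed.

Lemma fspanD a b : fspan g a -> fspan g b -> fspan g (a + b).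
Proof.
move=> [h ->] [h' ->]; exists (fun i => h i + h' i).
by rewrite -big_split; apply/eq_bigr => i _; rewrite mulrDl.
Qed.

Lemma fspanMl c a : fspan g a -> fspan g (c * a).
Proof.
move=> [h ->]; exists (fun i => c * h i).
by rewrite mulr_sumr; apply/eq_bigr => i _; rewrite mulrA.
Qed.

Lemma fspan_sum (I : Type) (r : seq I) (F : I -> A) :
  (forall i, fspan g (F i)) -> fspan g (\sum_(i <- r) F i).
Proof. by move=> h; apply: big_ind => //; [exact: fspan0|exact: fspanD]. Qed.

End FSpan.

Section Jacobian.
Variables (R : realType) (K : fieldType) (v : real_valuation R K).
Variables (n p : nat) (f : cps v n) (g : 'I_p -> cps v n).
Hypothesis fg : jac_generating f g.

Local Notation jac := (jacobian_ideal f).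

(* The [p + 1] classes of [x_i, ..., x_i ^ (p + 1)] are linearly dependent in a
   space generated by [p] elements, and a relation is a power of [x_i] times a
   unit. *)
Lemma jac_powerX (i : 'I_n) : jac (cpsX i ^+ p.+1).
Proof.
pose x : cps v n := cpsX i.
have xm (r : 'I_p.+1) : cps_max (x ^+ r.+1).
  by apply/cps_maxP; rewrite exprS cps_coef0M cpsX0 mul0r.
have /choice[c hc] r := fg.2 _ (xm r).
pose C : 'M[K]_(p.+1, p) := \matrix_(r, j) c r j.
have kC : kermx C != 0.
  rewrite kermx_eq0 /row_free; apply/negP => /eqP e.
  by have := rank_leq_col C; rewrite e ltnn.
have /rowV0Pn[u /sub_kermxP uC u0] := kC.
have Ju : jac (\sum_(r < p.+1) u 0 r *: x ^+ r.+1).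
  have Ju' : jac (\sum_r u 0 r *: (x ^+ r.+1 - \sum_j c r j *: g j)).
    by apply: fspan_sum => r; rewrite -mulr_algl; apply: fspanMl; exact: hc.
  suff <- : \sum_r u 0 r *: (x ^+ r.+1 - \sum_j c r j *: g j) =
            \sum_(r < p.+1) u 0 r *: x ^+ r.+1 by [].
  under eq_bigr do rewrite scalerBr scaler_sumr.
  rewrite sumrB exchange_big [X in _ - X]big1 ?subr0 // => j _.
  under eq_bigr do rewrite scalerA.
  rewrite -scaler_suml; have /matrixP/(_ 0 j) := uC; rewrite !mxE => e.
  have -> : \sum_r u 0 r * c r j = 0.
    by rewrite -[RHS]e; apply: eq_bigr => r _; rewrite mxE.
  by rewrite scale0r.
have /rV0Pn[r1 ur1] := u0.
case: (@arg_minnP _ r1 (fun r => u 0 r != 0) (fun r => r : nat) ur1) => r0 ur0 rmin.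
pose y := \sum_(r < p.+1) u 0 r *: x ^+ (r - r0).
have xy : \sum_(r < p.+1) u 0 r *: x ^+ r.+1 = x ^+ r0.+1 * y.
  rewrite mulr_sumr; apply/eq_bigr => r _; rewrite -scalerAr -exprD.
  have [->|ur] := eqVneq (u 0 r) 0; first by rewrite !scale0r.
  by rewrite addSn subnKC // rmin.
have y0 : y 0%MM != 0.
  rewrite /y (big_morph (fun a : cps v n => a 0%MM) (id1 := 0) (op1 := +%R)) //.
  rewrite (bigD1 r0) //= subnn expr0 /= eqxx mulr1 big1 ?addr0 // => r ne.
  have [->|ur] := eqVneq (u 0 r) 0; first by rewrite mul0r.
  have : (0 < r - r0)%N by rewrite subn_gt0 ltn_neqAle rmin // andbT eq_sym.
  case: (r - r0)%N => // k _.
  by rewrite exprS [X in _ * X](cps_coef0M (cpsX i)) cpsX0 mul0r mulr0.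
have [b yb] := cps_unit y0.
have -> : x ^+ p.+1 = x ^+ (p - r0) * b * (x ^+ r0.+1 * y).
  rewrite mulrACA [b * y]mulrC yb mulr1 -exprD addnS subnK //.
  by rewrite -ltnS.
by apply: fspanMl; rewrite -xy.
Qed.

Definition cps_mon (w : 'X_{1..n}) : cps v n := \prod_i cpsX i ^+ w i.

Lemma cps_mon0 w : w != 0%MM -> cps_mon w 0%MM = 0.
Proof.
move=> w0; have [i wi] : exists i, w i != 0%N.
  apply/existsP; apply: contra_neqT w0 => /existsPn h; apply/mnmP => i.
  by apply/eqP; rewrite mnm0E -[_ == _]negbK h.
rewrite /cps_mon (bigD1 i) //; case: (w i) wi => // k _.
by rewrite cps_coef0M exprS cps_coef0M cpsX0 !mul0r.
Qed.

(** The first clause is essential: in the division, the cofactor of a power [x_i ^ (p + 1)] may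
    still involve [x], so only a zero remainder there leaves coefficients in [K{t}]. *)
Lemma jac_mon (w : 'X_{1..n}) : exists kc : K * ('I_p -> K),
  ((exists i, (p < w i)%N) -> kc = (0, fun=> 0)) /\
  jac (cps_mon w - kc.1%:A - \sum_j kc.2 j *: g j).
Proof.
have [[i wi]|nbig] := pselect (exists i, (p < w i)%N).
  exists (0, fun=> 0); split=> //=.
  rewrite scale0r subr0 big1 ?subr0 => [|j _]; last by rewrite scale0r.
  rewrite /cps_mon (bigD1 i) //= -(subnK wi) exprD mulrAC.
  by apply: fspanMl; exact: jac_powerX.
have [w0|w0] := eqVneq w 0%MM.
  exists (1, fun=> 0); split=> [/nbig []|/=].
  rewrite w0 /cps_mon big1 => [|i _]; last by rewrite mnm0E expr0.
  rewrite scale1r subrr sub0r big1 ?oppr0 => [|j _]; last by rewrite scale0r.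
  exact: fspan0.
have /cps_maxP/(fg.2)[c hc] := cps_mon0 w0.
by exists (0, c); split=> [/nbig []|/=]; rewrite scale0r subr0.
Qed.

Lemma cps_val_mon (w : 'X_{1..n}) : cps_val (cps_mon w) = fps_mon K w.
Proof.
rewrite -fps_powX /cps_mon /fps_pow.
rewrite (big_morph (@cps_val R K v n) (id1 := 1) (op1 := *%R)) //.
apply/eq_bigr => i _; elim: (w i : nat) => [|k IH] //.
by rewrite !exprS -IH.
Qed.

Variable q : nat.

Definition xpart (m : 'X_{1..n + q}) : 'X_{1..n} := [multinom m (lshift q i) | i < n].
Definition xemb (w : 'X_{1..n}) : 'X_{1..n + q} :=
  [multinom join (fun i => w i) (fun=> 0%N) i | i < n + q].

Lemma xpartE m i : xpart m i = m (lshift q i).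
Proof. by rewrite mnmE. Qed.
Lemma xemb_l w i : xemb w (lshift q i) = w i.
Proof. by rewrite mnmE join_lshift. Qed.
Lemma xemb_r w j : xemb w (rshift n j) = 0%N.
Proof. by rewrite mnmE join_rshift. Qed.

Lemma xemb_le w m : (w <= xpart m)%MM -> (xemb w <= m)%MM.
Proof.
move=> /mnm_lepP le_w; apply/mnm_lepP => i; case: (split_ordP i) => j ->.
  by rewrite xemb_l -xpartE.
by rewrite xemb_r.
Qed.

(** The weight of a monomial in [x] does not involve the radius [s] in [t]; hence the bound for the
    division is uniform in [s]. *)
Lemma rmon_xemb (r s : R) w :
  rmon (join (fun=> r) (fun=> s) : 'I_(n + q) -> R) (xemb w) = rmon (fun=> r) w.
Proof.
rewrite /rmon big_split_ord /= [X in _ * X]big1 ?mulr1 => [|j _].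
  by apply: eq_bigr => i _; rewrite join_lshift xemb_l.
by rewrite xemb_r expr0.
Qed.

Lemma XL0 i : (cpsX (lshift q i) : cps v (n + q)) 0%MM = 0.
Proof. exact: cpsX0. Qed.

Lemma XR0 j : (cpsX (rshift n j) : cps v (n + q)) 0%MM = 0.
Proof. exact: cpsX0. Qed.

Lemma incl_x_mon w : incl_x q (cps_mon w) = fps_mon K (xemb w) :> fps K (n + q).
Proof.
rewrite /incl_x cps_substE; last exact: XL0.
rewrite cps_val_mon -fps_powX -[RHS]fps_powX /fps_pow big_split_ord /=.
rewrite [X in _ = _ * X]big1 ?mulr1 => [|j _]; last by rewrite xemb_r expr0.
have Phi0 i : fpsX K (lshift q i) 0%MM = 0 by exact: (cpsX0 v).
rewrite (big_morph (fun a => fps_subst a (fun i => fpsX K (lshift q i)))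
  (id1 := 1) (op1 := *%R)); [|by move=> a b; rewrite fps_substM|exact: fps_subst1].
apply: eq_bigr => i _; rewrite xemb_l; elim: (w i : nat) => [|k IH].
  by rewrite !expr0 fps_subst1.
by rewrite !exprS fps_substM // IH fps_substX.
Qed.

Lemma incl_tE (a : cps v (n + q)) :
  (forall m, (0 < wdeg (predC (isr n q)) m)%N -> a m = 0) -> incl_t n (at_x0 a) = a.
Proof.
move=> ha; have J0 i : (join (fun=> 0) cpsX i : cps v q) 0%MM = 0.
  by apply: (join_ind (P := fun a : cps v q => a 0%MM = 0)) => // j; exact: cpsX0.
rewrite /incl_t /at_x0 cps_subst_comp //; last exact: XR0.
rewrite -[RHS]cps_substXid; apply: cpsP.
have XX0 i : (cpsX i : cps v (n + q)) 0%MM = 0 by exact: cpsX0.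
have S0 i : cps_subst (join (fun=> 0) cpsX i : cps v q)
    (fun j => cpsX (rshift n j) : cps v (n + q)) 0%MM = 0.
  by rewrite cps_subst_coef0 //; exact: XR0.
rewrite !cps_substE //; apply: fps_subst_free ha _ => i /negPn.
case: (split_ordP i) => j ->; rewrite ?isr_l // => _.
by rewrite join_rshift cps_substX //; exact: XR0.
Qed.

(* Every monomial [m] is divisible by some [x_i ^ (p + 1)], or its [x]-part is
   one of finitely many monomials. *)
Definition box := ('I_n + 'X_{1..n < (n * p).+1})%type.

Definition box_mon (b : box) : 'X_{1..n} :=
  match b with inl i => (U_(i) *+ p.+1)%MM | inr w => w end.

Definition box_sel (m : 'X_{1..n + q}) : option box :=
  if [pick i | (p < xpart m i)%N] is Some i then Some (inl i)
  else omap inr (insub (xpart m)).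

Lemma box_sel_le m b : box_sel m = Some b -> (xemb (box_mon b) <= m)%MM.
Proof.
move=> e; apply: xemb_le; move: e; rewrite /box_sel; case: pickP => [i pi [<-]|_] /=.
  apply/mnm_lepP => j; rewrite mulmnE mnm1E.
  by case: eqP => [<-|]; rewrite ?mul1n ?mul0n.
by case: insubP => //= w _ ew [<-] /=; rewrite ew lepm_refl.
Qed.

Lemma box_sel_some m : box_sel m <> None.
Proof.
rewrite /box_sel; case: pickP => // nbig; case: insubP => // /negP[].
rewrite ltnS mdegE -[X in (_ <= X * _)%N]card_ord -sum_nat_const.
by apply: leq_sum => i _; rewrite leqNgt nbig.
Qed.

Lemma box_sel_inr m w : box_sel m = Some (inr w) -> xpart m = w.
Proof. by rewrite /box_sel; case: pickP => //= _; case: insubP => //= w' _ ew [<-]. Qed.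

Definition box_shift b : fps K (n + q) -> fps K (n + q) :=
  fps_shift (fun b => xemb (box_mon b)) box_sel b.

Lemma box_shift_decomp a : a = \sum_b fps_mon K (xemb (box_mon b)) * box_shift b a.
Proof.
rewrite [LHS](fps_shift_decomp a box_sel_le) [fps_rest _ _](_ : _ = 0) ?add0r //.
by apply/fpsP => m /=; case e : (box_sel m) => //; case: (box_sel_some e).
Qed.

(** A monomial is assigned to [w] only if its [x]-part equals [w], so the cofactor is a series in
    [t] alone. *)
Lemma box_shift_inr (w : 'X_{1..n < (n * p).+1}) (a : fps K (n + q)) m :
  (0 < wdeg (predC (isr n q)) m)%N -> box_shift (inr w) a m = 0.
Proof.
move=> /wdeg_gt0P[i]; case: (split_ordP i) => j ->; rewrite /= ?isr_r // => _ mj.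
case: eqP => // /box_sel_inr/mnmP/(_ j).
by rewrite xpartE mnmDE xemb_l => /eqP; rewrite -[X in _ == X]add0n eqn_add2r -leqn0 leqNgt mj.
Qed.

Definition cps_box_shift b (a : cps v (n + q)) : cps v (n + q) :=
  Cps (introT (conv_predP _ _)
    (fps_shift_conv (fun b => xemb (box_mon b)) box_sel b (cps_conv a))).

Lemma incl_xD a b : incl_x q (a + b : cps v n) = incl_x q a + incl_x q b.
Proof. by rewrite /incl_x cps_substD //; exact: XL0. Qed.
Lemma incl_xM a b : incl_x q (a * b : cps v n) = incl_x q a * incl_x q b.
Proof. by rewrite /incl_x cps_substM //; exact: XL0. Qed.
Lemma incl_xZ c a : incl_x q (c *: a : cps v n) = c *: incl_x q a.
Proof. by rewrite /incl_x cps_substZ //; exact: XL0. Qed.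
Lemma incl_x1 : incl_x q (1 : cps v n) = 1.
Proof. by rewrite /incl_x cps_subst_eq1 //; exact: XL0. Qed.
Lemma incl_x_sum (I : Type) (r : seq I) (F : I -> cps v n) :
  incl_x q (\sum_(i <- r) F i) = \sum_(i <- r) incl_x q (F i).
Proof. by rewrite /incl_x cps_subst_sum //; exact: XL0. Qed.
Lemma incl_tD a b : incl_t n (a + b : cps v q) = incl_t n a + incl_t n b.
Proof. by rewrite /incl_t cps_substD //; exact: XR0. Qed.
Lemma incl_tB a b : incl_t n (a - b : cps v q) = incl_t n a - incl_t n b.
Proof. by rewrite /incl_t cps_substB //; exact: XR0. Qed.
Lemma incl_tM a b : incl_t n (a * b : cps v q) = incl_t n a * incl_t n b.
Proof. by rewrite /incl_t cps_substM //; exact: XR0. Qed.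
Lemma incl_tZ c a : incl_t n (c *: a : cps v q) = c *: incl_t n a.
Proof. by rewrite /incl_t cps_substZ //; exact: XR0. Qed.
Lemma incl_t_sum (I : Type) (r : seq I) (F : I -> cps v q) :
  incl_t n (\sum_(i <- r) F i) = \sum_(i <- r) incl_t n (F i).
Proof. by rewrite /incl_t cps_subst_sum //; exact: XR0. Qed.
Lemma incl_t_coef0 (a : cps v q) : incl_t n a 0%MM = a 0%MM.
Proof. by rewrite /incl_t cps_subst_coef0 //; exact: XR0. Qed.

(** The quotients are given by operators on formal series, since they are applied to iterates before
    convergence of the limit is known. The bound [C] is chosen after the radius [r] in [x] and
    before the radius [s] in [t], which can then be shrunk freely. *)
Lemma jac_division : exists L : 'I_n -> fps K (n + q) -> fps K (n + q),
  [/\ forall k d a b, fps_grd (wdeg (isr n q)) d (a - b) ->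
        fps_grd (wdeg (isr n q)) d (L k a - L k b),
      exists2 r0 : R, 0 < r0 & forall r, 0 < r <= r0 ->
        exists2 C, 0 <= C & forall s M a k, 0 < s ->
          fps_bnd v (join (fun=> r) (fun=> s)) M a ->
          fps_bnd v (join (fun=> r) (fun=> s)) (C * M) (L k a)
    & forall a : cps v (n + q),
        exists (h : 'I_n -> cps v (n + q)) (delta : 'I_p -> cps v q) (beta : cps v q),
        (forall k, h k = L k a :> fps K (n + q)) /\
        a = \sum_k incl_x q (cps_deriv k f) * h k
          + \sum_j incl_x q (g j) * incl_t n (delta j) + incl_t n beta].
Proof.
have /choice[kc hkc] (b : box) := jac_mon (box_mon b).
have /choice[H hH] (b : box) : exists h : 'I_n -> cps v n,
    cps_mon (box_mon b) - (kc b).1%:A - \sum_j (kc b).2 j *: g j =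
    \sum_k h k * cps_deriv k f by exact: (hkc b).2.
exists (fun k a => \sum_b (incl_x q (H b k) : fps K _) * box_shift b a); split.
- move=> k d a b hab; rewrite -sumrB; apply: fps_grd_sum => w _.
  rewrite -mulrBr -fps_shiftB; apply: fps_wdegMl => m lt_m /=.
  case: ifP => // _; apply: hab; rewrite wdegD.
  rewrite [X in (_ + X)%N](_ : _ = 0%N) ?addn0 //; apply/eqP.
  rewrite -leqn0 leqNgt; apply/negP => /wdeg_isr_gt0[j].
  by rewrite xemb_r.
- have [r0 [M [r0_gt0 M0 bM]]] :=
    fps_conv_common (fun bk : box * 'I_n => cps_conv (H bk.1 bk.2)).
  exists r0 => // r /andP[r_gt0 le_r].
  exists (\sum_(b : box) M / rmon (fun=> r) (box_mon b)).
    by apply: sumr_ge0 => b _; rewrite divr_ge0 // rmon_ge0 // => _; exact: ltW.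
  move=> s N a k s0 ba; set e := join _ _.
  have e0 i : 0 < e i by apply: (join_ind (P := fun x : R => 0 < x)).
  have e0' i : 0 <= e i by exact: ltW.
  rewrite mulr_suml; apply: fps_bnd_sum => // b.
  rewrite -mulrA [_^-1 * _]mulrC; apply: fps_bndM => //.
    rewrite /incl_x cps_substE; last exact: XL0.
    apply: (@fps_bnd_subst _ _ _ _ _ (fun=> r)) => //; first exact: XL0.
      move=> i; have := fps_bndX v (lshift q i) e0'.
      by rewrite /e join_lshift.
    by apply: fps_bnd_le (bM (b, k)) => _; rewrite le_r ltW.
  have := fps_shift_bnd (fun b => xemb (box_mon b)) box_sel b e0 ba.
  by rewrite rmon_xemb.
move=> a.
exists (fun k => \sum_b incl_x q (H b k) * cps_box_shift b a).
exists (fun j => \sum_b (kc b).2 j *: at_x0 (cps_box_shift b a)).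
exists (\sum_b (kc b).1 *: at_x0 (cps_box_shift b a)); split=> [k|].
  by rewrite (big_morph (@cps_val R K v (n + q)) (id1 := 0) (op1 := +%R)).
(* On the pieces [x_i ^ (p + 1)] the cofactor may contain [x], but the coefficients [kc] vanish; on
   the other pieces the cofactor lies in [K{t}]. Either way the remainder has coefficients in
   [K{t}]. *)
have small b : ((kc b).1 = 0 /\ (forall j, (kc b).2 j = 0)) \/
    incl_t n (at_x0 (cps_box_shift b a)) = cps_box_shift b a.
  case: b => [i|w]; last by right; apply: incl_tE => m; exact: box_shift_inr.
  left; rewrite (hkc (inl i)).1 //; exists i.
  by rewrite mulmnE mnm1E eqxx mul1n.
have dec : a = \sum_b incl_x q (cps_mon (box_mon b)) * cps_box_shift b a.
  apply: cpsP; rewrite [LHS]box_shift_decomp.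
  rewrite (big_morph (@cps_val R K v (n + q)) (id1 := 0) (op1 := +%R)) //.
  by apply: eq_bigr => b _; rewrite -incl_x_mon.
rewrite incl_t_sum.
under [X in _ + X + _]eq_bigr => j _ do rewrite incl_t_sum mulr_sumr.
under [X in X + _ + _]eq_bigr => k _ do rewrite mulr_sumr.
rewrite [X in X + _ + _]exchange_big [X in _ + X + _]exchange_big -!big_split.
rewrite {1}dec; apply: eq_bigr => b _ /=.
have -> : cps_mon (box_mon b) = \sum_k H b k * cps_deriv k f +
    \sum_j (kc b).2 j *: g j + (kc b).1%:A.
  by rewrite -hH subrK subrK.
rewrite !incl_xD !incl_x_sum !mulrDl incl_xZ incl_x1; congr (_ + _ + _).
- rewrite mulr_suml; apply: eq_bigr => k _.
  by rewrite incl_xM -mulrA mulrCA.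
- rewrite mulr_suml; apply: eq_bigr => j _.
  rewrite incl_xZ incl_tZ -scalerAl -scalerAr.
  by case: (small b) => [[_ ->]|-> //]; rewrite !scale0r.
rewrite incl_tZ -scalerAl mul1r.
by case: (small b) => [[-> _]|-> //]; rewrite !scale0r.
Qed.
End Jacobian.

(** * Solving the unfolding equation *)

Section Solve.
Variables (R : realType) (K : fieldType) (v : real_valuation R K).

Lemma rmon_contract n (P : pred 'I_n) (c : R) (e e' : 'I_n -> R) m :
    (forall i, e' i = if P i then c * e i else e i) ->
  rmon e' m = c ^+ wdeg P m * rmon e m.
Proof.
move=> he; rewrite /rmon /wdeg -prodrXr [X in _ = X * _]big_mkcond -big_split.
by apply: eq_bigr => i _ /=; rewrite he; case: ifP => _; rewrite ?exprMn ?mul1r.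
Qed.

(** Every monomial of [a] contains a selected variable, so shrinking these radii by [c] gains at
    least one factor [c]. *)
Lemma fps_bnd_contract n (P : pred 'I_n) (c : R) (e e' : 'I_n -> R) M (a : fps K n) :
    0 <= c <= 1 -> (forall i, 0 <= e i) ->
    (forall i, e' i = if P i then c * e i else e i) ->
  fps_grd (wdeg P) 1 a -> fps_bnd v e M a -> fps_bnd v e' (c * M) a.
Proof.
move=> /andP[c0 c1] e0 he ha; apply: fps_bnd_scale => // m am.
rewrite (rmon_contract _ he) ler_wpM2r ?rmon_ge0 //.
have w0 : (0 < wdeg P m)%N.
  by rewrite lt0n; apply: contra am => /eqP w0; rewrite ha ?w0.
by rewrite -[leRHS]expr1 ler_wiXn2l.
Qed.

Lemma fps_grd_incl_t n q (a : cps v q) :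
  a 0%MM = 0 -> fps_grd (wdeg (isr n q)) 1 (incl_t n a).
Proof.
move=> a0; rewrite /incl_t cps_substE; last exact: XR0.
apply: (@fps_subst_wdeg _ _ _ predT) => [j _ m /=|m].
  by case: eqP => // ->; rewrite wdegU isr_r.
by rewrite wdegT ltnS leqn0 mdeg_eq0 => /eqP ->.
Qed.

Lemma fps_grd1_coef0 n (P : pred 'I_n) (a : fps K n) :
  fps_grd (wdeg P) 1 a -> a 0%MM = 0.
Proof. by apply; rewrite wdeg0. Qed.

Variables (n p q : nat) (f : cps v n) (g : 'I_p -> cps v n).
Hypothesis fg : jac_generating f g.

Let N := (n + q)%N.

(* The indices of [t] and [y] in series in [((x, t), y)]. *)
Let ty : pred 'I_(N + N) := fun i => (n <= i)%N.

(* With [y_k = \sum_l a_l Psi_{l,k}], the unknowns [Psi] are a fixed point of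
   [Psi_l |-> - L (e_l + \sum_k Psi_{l,k} Q_k (x, t, y))].  As the [a_l] vanish
   at [t = 0] and the [Q_k] at [t = y = 0], this map is contracting in [t], and
   it preserves a ball once the radius in [t] is small. *)
Lemma solve_fixed_point r (a : 'I_r -> cps v q) (E : 'I_r -> cps v N)
    (Q : 'I_n -> cps v (N + N)) (L : 'I_n -> fps K N -> fps K N) :
    (forall k d a b, fps_grd (wdeg (isr n q)) d (a - b) ->
       fps_grd (wdeg (isr n q)) d (L k a - L k b)) ->
    (exists2 r0 : R, 0 < r0 & forall r, 0 < r <= r0 ->
        exists2 C, 0 <= C & forall s M a k, 0 < s ->
          fps_bnd v (join (fun=> r) (fun=> s)) M a ->
          fps_bnd v (join (fun=> r) (fun=> s)) (C * M) (L k a)) ->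
    (forall l, a l 0%MM = 0) ->
    (forall k, fps_grd (wdeg ty) 1 (Q k)) ->
  exists Psi : 'I_r -> 'I_n -> cps v N, forall l k,
    Psi l k = - L k (E l + \sum_k' Psi l k' *
       cps_subst (Q k') (join cpsX (join (fun k => \sum_l incl_t n (a l) * Psi l k) (fun=> 0))))
    :> fps K N.
Proof.
move=> Lgrd [rL rL0 Lbnd] a0 Qgrd.
pose A l : fps K N := incl_t n (a l).
have Agrd l : fps_grd (wdeg (isr n q)) 1 (A l) by exact: fps_grd_incl_t.
have [r1 [M1 [r1_gt0 M1_ge0 bE]]] := fps_conv_common (fun l => cps_conv (E l)).
have [r2 [M2 [r2_gt0 M2_ge0 bA]]] := fps_conv_common (fun l => cps_conv (incl_t n (a l))).
have [r3 [M3 [r3_gt0 M3_ge0 bQ]]] := fps_conv_common (fun k => cps_conv (Q k)).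
(* The radius in [x] is fixed here once and for all; the constant [C] depends on it, but not on the
   radius in [t]. *)
pose x : R := Num.min rL (Num.min r1 (Num.min r2 r3)).
have x0 : 0 < x by rewrite !lt_min rL0 r1_gt0 r2_gt0.
have xL : 0 < x <= rL by rewrite x0 ge_min lexx.
have x1 : x <= r1 by rewrite !ge_min lexx orbT.
have x2 : x <= r2 by rewrite !ge_min lexx !orbT.
have x3 : x <= r3 by rewrite !ge_min lexx !orbT.
have [C C0 {}Lbnd] := Lbnd x xL.
(* The ball leaves room for [E], of norm at most [M1], and for the sum of the [Psi Q], which will be
   at most 1. *)
pose rho := C * (M1 + 1).
have rho0 : 0 <= rho by rewrite mulr_ge0 // addr_ge0.
pose kap := 1 + r%:R * M2 * rho / x.
have kap1 : 1 <= kap.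
  rewrite lerDl. apply: divr_ge0; last exact: ltW.
  by apply: mulr_ge0 => //; apply: mulr_ge0 => //; exact: ler0n.
have kap0 : 0 < kap by apply: lt_le_trans kap1.
(* At radii [x] in [x] and [c * x] in [t] and [y], each [Q k] has norm at most [c * M3]; this [c]
   makes the sum of the [Psi Q] at most 1. *)
pose c := (1 + n%:R * rho * M3)^-1.
have nr0 : 0 <= n%:R * rho * M3 by apply: mulr_ge0 => //; apply: mulr_ge0.
have c_pos : 0 < 1 + n%:R * rho * M3 by apply: ltr_pwDl.
have c0 : 0 < c by rewrite invr_gt0.
have c1 : c <= 1 by rewrite invf_le1 // lerDl.
(* Division by [kap] gives [r * (s * M2 * rho) <= c * x], so the increments [y] stay within the
   radius allowed for [Q]; as [kap >= 1], so does [t]. *)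
pose s := c / kap.
have s0 : 0 < s by rewrite divr_gt0.
have s1 : s <= 1 by rewrite ler_pdivrMr // mul1r (le_trans c1).
pose e : 'I_N -> R := join (fun=> x) (fun=> s * x).
have e0 i : 0 < e i.
  by apply: (join_ind (P := fun x : R => 0 < x)) => // j; rewrite mulr_gt0.
have e0' i : 0 <= e i by exact: ltW.
have ele i : 0 <= e i <= x.
  rewrite e0'; apply: (join_ind (P := fun y : R => y <= x)) => //= j.
  by rewrite ler_piMl // ltW.
have bE' l : fps_bnd v e M1 (E l).
  by apply: fps_bnd_le (bE l) => i; have /andP[-> h] := ele i; exact: le_trans x1.
have bA' l : fps_bnd v e (s * M2) (A l).
  apply: (@fps_bnd_contract _ (isr n q) _ (fun=> x)) => //.
  - by rewrite (ltW s0).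
  - by move=> _; exact: ltW.
  - by move=> i; rewrite /e; case: (split_ordP i) => j ->;
      rewrite ?isr_l ?isr_r ?join_lshift ?join_rshift.
  - by apply: fps_bnd_le (bA l) => _; rewrite ltW.
pose e2 : 'I_(N + N) -> R := fun i => if ty i then c * x else x.
have e20 i : 0 <= e2 i by rewrite /e2; case: ifP => _; rewrite ?mulr_ge0 ?ltW.
have bQ' k : fps_bnd v e2 (c * M3) (Q k).
  apply: (@fps_bnd_contract _ ty _ (fun=> x)) => //; first by rewrite ltW.
    by move=> _; exact: ltW.
  by apply: fps_bnd_le (bQ k) => _; rewrite ltW.
pose Y (Psi : 'I_r * 'I_n -> fps K N) : 'I_N -> fps K N :=
  join (fun k => \sum_l A l * Psi (l, k)) (fun=> 0).
pose J Psi : 'I_(N + N) -> fps K N := join (fun i => fpsX K i) (Y Psi).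
have Ygrd Psi i : fps_grd (wdeg (isr n q)) 1 (Y Psi i).
  apply: (join_ind (P := fun a : fps K N => fps_grd (wdeg (isr n q)) 1 a)) => [k|j] //.
  by apply: fps_grd_sum => l _; exact: fps_wdegMr.
have J0 Psi i : J Psi i 0%MM = 0.
  apply: (join_ind (P := fun a : fps K N => a 0%MM = 0)) => [j|j].
    exact: (cpsX0 v).
  exact: fps_grd1_coef0 (Ygrd _ _).
pose S Psi k := fps_subst (Q k) (J Psi).
have Sgrd Psi k : fps_grd (wdeg (isr n q)) 1 (S Psi k).
  apply: fps_subst_wdeg (Qgrd k) => i.
  rewrite /J; case: (split_ordP i) => {}i ->; rewrite ?join_lshift ?join_rshift; last first.
    by move=> _; exact: Ygrd.
  move=> hi m /=; case: eqP => // ->; rewrite wdegU.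
  by rewrite -[ty _]/(isr n q i) in hi; rewrite hi.
pose T Psi (lk : 'I_r * 'I_n) : fps K N :=
  - L lk.2 ((E lk.1 : fps K N) + \sum_k' Psi (lk.1, k') * S Psi k').
have hT d Psi Psi' : (forall i, fps_grd (wdeg (isr n q)) d (Psi i - Psi' i)) ->
    forall i, fps_grd (wdeg (isr n q)) d.+1 (T Psi i - T Psi' i).
  move=> h [l k]; rewrite /T /= -opprD; apply: fps_grdN; apply: Lgrd.
  rewrite opprD addrACA subrr add0r -sumrB; apply: fps_grd_sum => k' _.
  have hY i : fps_grd (wdeg (isr n q)) d.+1 (Y Psi i - Y Psi' i).
    rewrite /Y; case: (split_ordP i) => j ->; rewrite ?join_lshift ?join_rshift ?subrr //.
    rewrite -sumrB; apply: fps_grd_sum => l' _; rewrite -mulrBr -add1n.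
    exact: fps_wdegM.
  have hS : fps_grd (wdeg (isr n q)) d.+1 (S Psi k' - S Psi' k').
    apply: fps_subst_wdeg_cong => i; rewrite /J.
    by case: (split_ordP i) => j ->; rewrite ?join_lshift ?join_rshift ?subrr.
  (* Each summand gains one order in [t]: [S] vanishes at [t = 0], and [y] depends on [Psi] only
     through multiples of the [a_l]. *)
  have -> : Psi (l, k') * S Psi k' - Psi' (l, k') * S Psi' k' =
      (Psi (l, k') - Psi' (l, k')) * S Psi k' + Psi' (l, k') * (S Psi k' - S Psi' k').
    by rewrite mulrBl mulrBr addrA subrK.
  apply: fps_grdD; last exact: fps_wdegMl.
  by rewrite -addn1; apply: fps_wdegM.
have hB Psi : (forall i, fps_bnd v e rho (Psi i)) ->
    forall i, fps_bnd v e rho (T Psi i).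
  move=> h [l k]; apply: fps_bndN; rewrite /=.
  have bY i : fps_bnd v e (c * x) (Y Psi i).
    rewrite /Y; case: (split_ordP i) => j ->; rewrite ?join_lshift ?join_rshift; last first.
      by apply: fps_bnd0; rewrite mulr_ge0 ?ltW.
    have bS : fps_bnd v e (\sum_(l < r) s * M2 * rho) (\sum_l A l * Psi (l, j)).
      by apply: fps_bnd_sum => // l'; exact: fps_bndM.
    apply: fps_bnd_leM bS; rewrite sumr_const card_ord -mulr_natl.
    rewrite /s -(ler_pM2r kap0) -[leLHS]/(_ * _).
    have -> : r%:R * (c / kap * M2 * rho) * kap = c * (r%:R * M2 * rho).
      by field; rewrite gt_eqF.
    rewrite -[leRHS]mulrA ler_wpM2l ?(ltW c0) //.
    have -> : x * kap = x + r%:R * M2 * rho by rewrite /kap; field; rewrite gt_eqF.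
    by rewrite lerDr ltW.
  have bS k' : fps_bnd v e (c * M3) (S Psi k').
    apply: (fps_bnd_subst (J0 Psi) e0' _ (bQ' k')) => i.
    rewrite /J /e2; case: (split_ordP i) => {}i ->; rewrite ?join_lshift ?join_rshift; last first.
      by rewrite /ty /= (leq_trans _ (leq_addr _ _)) ?leq_addr.
    apply: (fps_bnd_leM _ (fps_bndX v i e0')).
    rewrite /e; case: (split_ordP i) => j ->; rewrite ?join_lshift ?join_rshift.
      by rewrite [ty _](isr_l q j).
    rewrite [ty _](isr_r n j) ler_wpM2r ?(ltW x0) // /s ler_pdivrMr //.
    by rewrite ler_peMr // ltW.
  have bsum : fps_bnd v e (\sum_(k' < n) rho * (c * M3)) (\sum_k' Psi (l, k') * S Psi k').
    by apply: fps_bnd_sum => // k'; exact: fps_bndM.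
  apply: (@fps_bnd_leM _ _ _ _ _ (C * (M1 + \sum_(k' < n) rho * (c * M3)))).
    rewrite /rho ler_wpM2l // lerD2l -/rho sumr_const card_ord -mulr_natl.
    have -> : n%:R * (rho * (c * M3)) = (n%:R * rho * M3) * c by ring.
    by rewrite /c ler_pdivrMr // mul1r lerDr.
  apply: Lbnd; first by rewrite mulr_gt0.
  by apply: fps_bndD.
have [Psi [bPsi fPsi]] := fps_fixed_point rho0 hT hB.
have cPsi i : fps_conv v (Psi i) by apply/fps_convP; exists e => //; exists rho.
exists (fun l k => Cps (introT (conv_predP _ _) (cPsi (l, k)))) => l k.
rewrite /= -{1}[Psi (l, k)]fPsi /T /=; congr (- L k (_ + _)).
rewrite (big_morph (@cps_val R K v N) (id1 := 0) (op1 := +%R)) //.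
apply: eq_bigr => k' _ /=; congr (_ * _).
rewrite cps_substE; last first.
  apply: (join_ind (P := fun a : cps v N => a 0%MM = 0)) => i; first exact: cpsX0.
  apply: (join_ind (P := fun a : cps v N => a 0%MM = 0)) => // j.
  rewrite (big_morph (fun a : cps v N => a 0%MM) (id1 := 0) (op1 := +%R)) //.
  by rewrite big1 // => l' _; rewrite cps_coef0M incl_t_coef0 a0 mul0r.
congr fps_subst; apply/funext => i; rewrite /J /Y.
case: (split_ordP i) => {}i ->; rewrite ?join_lshift ?join_rshift //.
case: (split_ordP i) => {}i ->; rewrite ?join_lshift ?join_rshift //.
by rewrite (big_morph (@cps_val R K v N) (id1 := 0) (op1 := +%R)).
Qed.


Lemma wdeg_leq k (P P' : pred 'I_k) m :
  (forall i, P i -> P' i) -> (wdeg P m <= wdeg P' m)%N.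
Proof.
move=> h; rewrite /wdeg big_mkcond [leqRHS]big_mkcond; apply: leq_sum => i _.
by case: ifP => // /h ->.
Qed.

Lemma at_t0_coef0 (a : cps v N) : at_t0 a 0%MM = a 0%MM.
Proof.
rewrite /at_t0 cps_subst_coef0 //.
by apply: (join_ind (P := fun a : cps v n => a 0%MM = 0)) => // i; exact: cpsX0.
Qed.

Lemma join_X0_coef0 (i : 'I_(n + q)) : (join cpsX (fun=> 0) i : cps v n) 0%MM = 0.
Proof.
move: i; apply: (join_ind (P := fun a : cps v n => a 0%MM = 0)) => // i.
exact: cpsX0.
Qed.

Lemma incl_x_at_t0 (a : cps v N) :
  incl_x q (at_t0 a) = cps_subst a (join (fun i => cpsX (lshift q i)) (fun=> 0)).
Proof.
rewrite /incl_x /at_t0 cps_subst_comp; [|exact: join_X0_coef0|exact: XL0].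
congr cps_subst; apply/funext => i.
case: (split_ordP i) => j ->; rewrite ?join_lshift ?join_rshift.
  by rewrite cps_substX //; exact: XL0.
by apply: cpsP; rewrite cps_substE; [exact: fps_subst0|exact: XL0].
Qed.

Lemma grd_at_t0 (a : cps v N) :
  fps_grd (wdeg (isr n q)) 1 (a - incl_x q (at_t0 a)).
Proof.
have J0 i : (join (fun i => cpsX (lshift q i)) (fun=> 0) i : cps v N) 0%MM = 0.
  by move: i; apply: (join_ind (P := fun a : cps v N => a 0%MM = 0)) => // i; exact: XL0.
rewrite incl_x_at_t0 -{1}[a]cps_substXid -[X in fps_grd _ _ X]/(cps_val _ - cps_val _).
rewrite !cps_substE //; last by move=> i; exact: cpsX0.
apply: fps_subst_wdeg_cong => i; case: (split_ordP i) => j ->.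
  by rewrite join_lshift subrr.
rewrite join_rshift subr0 => m /=; case: eqP => // ->.
by rewrite wdegU isr_r.
Qed.

Lemma at_t0_deriv k (a : cps v N) :
  at_t0 (cps_deriv (lshift q k) a) = cps_deriv k (at_t0 a).
Proof.
apply: cpsP; rewrite /at_t0 /= !cps_substE; try exact: join_X0_coef0.
rewrite fps_chain; last exact: join_X0_coef0.
rewrite (bigD1 (lshift q k)) //= join_lshift fps_derivX eqxx mulr1 big1 ?addr0 // => i ne.
case: (split_ordP i) ne => j ->; rewrite ?join_lshift ?join_rshift.
  by rewrite (inj_eq (@lshift_inj _ _)) eq_sym fps_derivX => /negPf ->; rewrite mulr0.
by move=> _; rewrite (_ : fps_deriv k _ = 0) ?mulr0 //; apply/fpsP => m /=; rewrite mul0rn.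
Qed.

Lemma idealr_coef0 (I : idealr (cps v q)) a : a \in I -> a 0%MM = 0.
Proof.
move=> Ia; apply/eqP/negPn/negP => /cps_unit[b ab].
by have := idealr1 I; rewrite -ab mulrC idealMr.
Qed.

(** This is [F (x, phi (t))] for the linear unfolding, formed from series rather than classes. *)
Definition lin_unf (phi : 'I_p -> cps v q) : cps v N :=
  incl_x q f + \sum_j incl_x q (g j) * incl_t n (phi j).

(** A solution modulo [I] becomes an exact one in [K{x,t}] while nothing changes modulo [I].
    Exactness makes the result usable over every quotient of [K{t}], and the congruences preserve a
    prescribed solution over a smaller base. *)
Lemma solve_exactly (I : idealr (cps v q)) (G : cps v N) (Phi0 : 'I_n -> cps v N)
    (phi0 : 'I_p -> cps v q) (alpha0 : cps v q) :
    at_t0 G = f -> (forall i, at_t0 (Phi0 i) = cpsX i) ->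
    cps_subst G (join Phi0 (fun j => cpsX (rshift n j)))
      - (lin_unf phi0 + incl_t n alpha0) \in ext_ideal n I ->
  exists (Phi : 'I_n -> cps v N) (phi : 'I_p -> cps v q) (alpha : cps v q),
    [/\ forall i, Phi i - Phi0 i \in ext_ideal n I,
        forall j, phi j - phi0 j \in I, alpha - alpha0 \in I
      & cps_subst G (join Phi (fun j => cpsX (rshift n j))) =
        lin_unf phi + incl_t n alpha].
Proof.
move=> Gf Phi0X /asboolP[r [E [a [Ia eE]]]].
have a0 l : a l 0%MM = 0 by exact: idealr_coef0 (Ia l).
pose Th : 'I_N -> cps v N := join Phi0 (fun j => cpsX (rshift n j)).
have Phi00 i : Phi0 i 0%MM = 0 by rewrite -at_t0_coef0 Phi0X cpsX0.
have Th0 i : Th i 0%MM = 0.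
  by move: i; apply: (join_ind (P := fun a : cps v N => a 0%MM = 0)) => // j; exact: XR0.
have [M [hM dM]] := cps_hadamard G Th0.
pose XN (j : 'I_N) : cps v (N + N) := cpsX (lshift N j).
have XN0 j : XN j 0%MM = 0 by exact: cpsX0.
pose df k := incl_x q (cps_deriv k f).
(* At [y = 0] the coefficient [M] is the [k]-th partial derivative of [G] along [Phi0], which at
   [t = 0] is [df/dx_k]; so [Q k] vanishes at [t = y = 0]. *)
pose Q k : cps v (N + N) := M (lshift q k) - cps_subst (df k) XN.
have Qgrd k : fps_grd (wdeg ty) 1 (Q k).
  pose D := cps_subst (cps_deriv (lshift q k) G) Th.
  have -> : Q k = (M (lshift q k) - cps_subst D XN) + cps_subst (D - df k) XN.
    by rewrite cps_substB // addrA subrK.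
  rewrite -[X in fps_grd _ _ X]/(cps_val _ + cps_val _).
  apply: fps_grdD.
    move=> m lt_m; apply: dM; apply: leq_ltn_trans lt_m; apply: wdeg_leq => i.
    by rewrite /isr /ty; apply: leq_trans; exact: leq_addr.
  rewrite cps_substE //; apply: (@fps_subst_wdeg _ _ _ (isr n q)) => [i it|].
    by move=> m /=; case: eqP => // ->; rewrite wdegU -[ty _]/(isr n q i) it.
  rewrite /df -Gf -at_t0_deriv /D incl_x_at_t0 -[X in fps_grd _ _ X]/(cps_val _ - cps_val _).
  rewrite !cps_substE //; last first.
    by apply: (join_ind (P := fun a : cps v N => a 0%MM = 0)) => // i; exact: XL0.
  apply: fps_subst_wdeg_cong => i; rewrite /Th.
  case: (split_ordP i) => j ->; rewrite ?join_lshift ?join_rshift.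
    have := grd_at_t0 (Phi0 j); rewrite Phi0X /incl_x cps_substX //; exact: XL0.
  rewrite subr0 => m /=; case: eqP => // ->; by rewrite wdegU isr_r.
have [L [Lgrd Lbnd Ldiv]] := jac_division fg q.
have [Psi hPsi] := solve_fixed_point E Lgrd Lbnd a0 Qgrd.
pose psi k := \sum_l incl_t n (a l) * Psi l k.
pose y : 'I_N -> cps v N := join psi (fun=> 0).
have psi0 k : psi k 0%MM = 0.
  rewrite /psi (big_morph (fun a : cps v N => a 0%MM) (id1 := 0) (op1 := +%R)) //.
  by rewrite big1 // => l' _; rewrite cps_coef0M incl_t_coef0 a0 mul0r.
have y0 i : y i 0%MM = 0.
  by move: i; apply: (join_ind (P := fun a : cps v N => a 0%MM = 0)).
pose V l := E l + \sum_k Psi l k * cps_subst (Q k) (join cpsX y).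
have VE l : cps_val (V l) = (E l : fps K N) +
    \sum_k Psi l k * cps_subst (Q k) (join cpsX y).
  rewrite /V -[LHS]/(cps_val (E l) + cps_val (\sum_k _)).
  by rewrite (big_morph (@cps_val R K v N) (id1 := 0) (op1 := +%R)).
(* The fixed point equation makes [- Psi l k] the quotient of [V l] by [df k], so
   [V l + \sum_k df k * Psi l k] is a pure remainder, of the shape absorbed by [phi] and [alpha]. *)
have /choice[delta /choice[beta hV]] l : exists delta, exists beta,
    V l = - (\sum_k df k * Psi l k)
       + \sum_j incl_x q (g j) * incl_t n (delta j) + incl_t n beta.
  have [h [delta [beta [hL eV]]]] := Ldiv (V l); exists delta, beta.
  rewrite eV -sumrN; congr (_ + _ + _); apply: eq_bigr => k _.
  rewrite -mulrN; congr (_ * _); apply: cpsP; rewrite hL.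
  apply/eqP; rewrite eq_sym -[X in X == _]/(- (cps_val (Psi l k))) hPsi opprK.
  by rewrite VE.
exists (fun i => Phi0 i + psi i), (fun j => phi0 j + \sum_l a l * delta l j),
  (alpha0 + \sum_l a l * beta l); split.
- move=> i; rewrite addrC addKr; apply/asboolP; exists r, (fun l => Psi l i), a.
  by split=> //; apply: eq_bigr => l _; rewrite mulrC.
- by move=> j; rewrite addrC addKr; apply: rpred_sum => l _; rewrite mulrC idealMr.
- by rewrite addrC addKr; apply: rpred_sum => l _; rewrite mulrC idealMr.
have -> : join (fun i => Phi0 i + psi i) (fun j => cpsX (rshift n j)) =
    (fun i => Th i + y i).
  apply/funext => i; rewrite /Th /y.
  by case: (split_ordP i) => j ->; rewrite ?join_lshift ?join_rshift ?addr0.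
rewrite hM // big_split_ord /= [X in _ + (_ + X)]big1 ?addr0 => [|j _]; last first.
  by rewrite /y join_rshift mul0r.
have XY0 i : (join cpsX y i : cps v N) 0%MM = 0.
  by move: i; apply: (join_ind (P := fun a : cps v N => a 0%MM = 0)) => // i; exact: cpsX0.
have eM k : cps_subst (M (lshift q k)) (join cpsX y) = cps_subst (Q k) (join cpsX y) + df k.
  rewrite -[M _](subrK (cps_subst (df k) XN)) -/(Q k) cps_substD //; congr (_ + _).
  rewrite cps_subst_comp // -[RHS]cps_substXid; congr cps_subst.
  by apply/funext => j; rewrite cps_substX // join_lshift.
have eG : cps_subst G Th = lin_unf phi0 + incl_t n alpha0 + \sum_i E i * incl_t n (a i).
  by apply/eqP; rewrite addrC -subr_eq; apply/eqP; exact: eE.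
rewrite eG.
have -> : \sum_(i < n) y (lshift q i) * cps_subst (M (lshift q i)) (join cpsX y) =
    \sum_l incl_t n (a l) * (V l - E l + \sum_k df k * Psi l k).
  under eq_bigr => i _ do rewrite /y join_lshift eM /psi mulr_suml.
  rewrite exchange_big; apply: eq_bigr => l _.
  rewrite /V [E l + _]addrC addrK -big_split mulr_sumr; apply: eq_bigr => k _ /=.
  by rewrite -/y; ring.
have -> : lin_unf (fun j => phi0 j + \sum_l a l * delta l j) =
    lin_unf phi0 + \sum_j incl_x q (g j) * \sum_l incl_t n (a l * delta l j).
  rewrite /lin_unf -addrA -big_split; congr (_ + _); apply: eq_bigr => j _ /=.
  by rewrite incl_tD mulrDr incl_t_sum.
rewrite incl_tD incl_t_sum.
have -> : \sum_l incl_t n (a l) * (V l - E l + \sum_k df k * Psi l k) =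
    \sum_j incl_x q (g j) * (\sum_l incl_t n (a l * delta l j)) +
    \sum_l incl_t n (a l * beta l) - \sum_l E l * incl_t n (a l).
  have -> : \sum_j incl_x q (g j) * (\sum_l incl_t n (a l * delta l j)) =
      \sum_l incl_t n (a l) * \sum_j incl_x q (g j) * incl_t n (delta l j).
    under eq_bigr => j _ do rewrite mulr_sumr.
    rewrite exchange_big; apply: eq_bigr => l _; rewrite mulr_sumr.
    by apply: eq_bigr => j _; rewrite incl_tM mulrCA.
  rewrite -big_split -sumrB; apply: eq_bigr => l _ /=.
  by rewrite hV incl_tM; ring.
ring.
Qed.

End Solve.

(** * Quotients and local morphisms *)

Section Ideals.
Variables (R : realType) (K : fieldType) (v : real_valuation R K).

Lemma cps_subst_0 k n (a : cps v k) :
  a 0%MM = 0 -> cps_subst a (fun=> 0) = 0 :> cps v n.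
Proof.
move=> /cps_maxP[h ->]; rewrite cps_subst_sum // big1 // => i _.
by rewrite cps_substM // cps_substX // mulr0.
Qed.

Lemma cps_subst_zero k n (Phi : 'I_k -> cps v n) :
  (forall i, Phi i 0%MM = 0) -> cps_subst 0 Phi = 0.
Proof. by move=> P0; apply: cpsP; rewrite cps_substE //= fps_subst0. Qed.

Lemma subst_cong_ideal k n (I : idealr (cps v n)) (a : cps v k)
    (Phi Psi : 'I_k -> cps v n) :
    (forall i, Phi i 0%MM = 0) -> (forall i, Psi i 0%MM = 0) ->
    (forall i, Phi i - Psi i \in I) ->
  cps_subst a Phi - cps_subst a Psi \in I.
Proof.
move=> Phi0 Psi0 h; have [c ->] := cps_subst_cong a Phi0 Psi0.
by apply: rpred_sum => i _; exact: idealMr.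
Qed.

Lemma pi_eqP n (I : idealr (cps v n)) (a b : cps v n) :
  \pi_{ideal_quot I} a = \pi_{ideal_quot I} b <-> a - b \in I.
Proof. by rewrite Quotient.idealrBE; split=> [->|/eqP]. Qed.

Lemma repr_pi_sub n (I : idealr (cps v n)) (a : cps v n) :
  repr (\pi_{ideal_quot I} a) - a \in I.
Proof. by apply/pi_eqP; rewrite reprK. Qed.

Lemma idealr_opp n (I : idealr (cps v n)) (a b : cps v n) :
  (a - b \in I) = (b - a \in I).
Proof. by rewrite -opprB rpredN. Qed.

Lemma idealr_trans n (I : idealr (cps v n)) (a b c : cps v n) :
  a - b \in I -> b - c \in I -> a - c \in I.
Proof. by move=> h h'; rewrite -(subrKA b) rpredD. Qed.

Lemma quot_maxP q (J : idealr (cps v q)) (a : cps v q) :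
  quot_max (\pi_{ideal_quot J} a) <-> a 0%MM = 0.
Proof.
split=> [[b /cps_maxP b0 /pi_eqP/idealr_coef0]|a0].
  by rewrite /= b0 subr0.
by exists a => //; apply/cps_maxP.
Qed.

Lemma quot_max_repr q (J : idealr (cps v q)) (s : {ideal_quot J}) :
  quot_max s <-> repr s 0%MM = 0.
Proof. by rewrite -{1}[s]reprK; exact: quot_maxP. Qed.

Definition max_ideal q : {pred cps v q} := fun a => a 0%MM == 0.

Fact max_ideal_closed q : idealr_closed (@max_ideal q).
Proof.
split.
- by rewrite unfold_in /=.
- by rewrite unfold_in /= eqxx oner_eq0.
move=> a b c; rewrite !unfold_in => /eqP b0 /eqP c0.
by rewrite -[_ 0%MM]/((a * b) 0%MM + c 0%MM) cps_coef0M b0 c0 mulr0 addr0.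
Qed.
HB.instance Definition _ q := isIdealr.Build (cps v q) (@max_ideal q) (@max_ideal_closed q).

(* The condition on [kap] is bundled with it so that the ideal structure below is
   inferred for every [kap]. *)
Definition preim_ideal q q' (J' : idealr (cps v q'))
    (kap : {k : 'I_q -> cps v q' | forall j, k j 0%MM = 0}) : {pred cps v q} :=
  fun a => cps_subst a (sval kap) \in J'.

Fact preim_ideal_closed q q' (J' : idealr (cps v q')) kap :
  idealr_closed (@preim_ideal q q' J' kap).
Proof.
case: kap => k k0; split.
- rewrite -[_ \in _]/(cps_subst 0 k \in J').
  by rewrite cps_subst_zero ?rpred0.
- rewrite -[_ \in _]/(cps_subst 1 k \in J').
  by rewrite cps_subst_eq1 // idealr1.
move=> a b c hb hc; rewrite -[_ \in _]/(cps_subst (a * b + c) k \in J').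
by rewrite cps_substD // cps_substM // rpredD // idealMr.
Qed.
HB.instance Definition _ q q' (J' : idealr (cps v q')) kap :=
  isIdealr.Build (cps v q) (@preim_ideal q q' J' kap) (@preim_ideal_closed q q' J' kap).

Section SubstMorphism.
Variables (p q : nat) (J : idealr (cps v q)).

Lemma pi_quotZ c (a : cps v q) :
  \pi_{ideal_quot J} (c *: a) = c *: \pi_{ideal_quot J} a.
Proof. exact: pi_scale. Qed.

Definition subst_quot (phi : {k : 'I_p -> cps v q | forall j, k j 0%MM = 0})
  (a : cps v p) : {ideal_quot J} := \pi_{ideal_quot J} (cps_subst a (sval phi)).

Fact subst_quot_zmod phi : zmod_morphism (subst_quot phi).
Proof.
move=> a b; case: phi => k k0; rewrite /subst_quot /= cps_substB //.
by rewrite rmorphB.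
Qed.
Fact subst_quot_monoid phi : monoid_morphism (subst_quot phi).
Proof.
case: phi => k k0; split=> [|a b]; rewrite /subst_quot /=.
  by rewrite cps_subst_eq1 // rmorph1.
by rewrite cps_substM // rmorphM.
Qed.
Fact subst_quot_scalable phi : scalable (subst_quot phi).
Proof.
by case: phi => k k0 c a; rewrite /subst_quot /= cps_substZ // pi_quotZ.
Qed.
HB.instance Definition _ phi :=
  GRing.isZmodMorphism.Build (cps v p) {ideal_quot J} (subst_quot phi) (subst_quot_zmod phi).
HB.instance Definition _ phi :=
  GRing.isMonoidMorphism.Build (cps v p) {ideal_quot J} (subst_quot phi) (subst_quot_monoid phi).
HB.instance Definition _ phi :=
  GRing.isScalable.Build K (cps v p) {ideal_quot J} *:%R (subst_quot phi) (subst_quot_scalable phi).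

Lemma subst_morphism (phi : 'I_p -> cps v q) : (forall j, phi j 0%MM = 0) ->
  exists2 h : {lrmorphism cps v p -> {ideal_quot J}}, local_from_cps h &
    forall a, h a = \pi_{ideal_quot J} (cps_subst a phi).
Proof.
move=> phi0; exists (subst_quot (exist _ phi phi0)) => // a /cps_maxP a0.
by apply/quot_maxP; rewrite cps_subst_coef0.
Qed.

(* The difference [h a - a (kap)] lies in every power of the maximal ideal,
   by induction on the exponent, because [h] and [kap] agree on the variables. *)
Lemma local_morphism_subst (h : cps v p -> {ideal_quot J}) (kap : 'I_p -> cps v q) :
    {morph h : a b / a + b} -> {morph h : a b / a * b} ->
    (forall c, h (c *: 1) = c *: 1) ->
    (forall j, kap j 0%MM = 0) ->
    (forall j, h (cpsX j) = \pi_{ideal_quot J} (kap j)) ->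
  forall a, h a = \pi_{ideal_quot J} (cps_subst a kap).
Proof.
move=> hD hM h1 k0 hX.
have hsum I (r : seq I) (F : I -> cps v p) :
    h (\sum_(i <- r) F i) = \sum_(i <- r) h (F i).
  apply: (big_morph h) => //.
  by rewrite -(scale0r 1) h1 scale0r.
have step N a : exists2 b, fps_ord N (b : cps v q) &
    h a - \pi_{ideal_quot J} (cps_subst a kap) = \pi_{ideal_quot J} b.
  elim: N a => [|N IH] a.
    exists (repr (h a) - cps_subst a kap) => //.
    by rewrite rmorphB /= reprK.
  have /cps_maxP[c ac] : (a - a 0%MM *: 1) 0%MM = 0 by rewrite /= eqxx mulr1 subrr.
  have /choice[b hb] i : exists b, fps_ord N (b : cps v q) /\
      h (c i) - \pi_{ideal_quot J} (cps_subst (c i) kap) = \pi_{ideal_quot J} b.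
    by have [b ? ?] := IH (c i); exists b.
  exists (\sum_i b i * kap i).
    move=> m lt_m; rewrite (big_morph (fun a : cps v q => a m) (id1 := 0) (op1 := +%R)) //.
    rewrite big1 // => i _.
    apply: (@fps_ordM _ _ N 1 (b i) (kap i) (hb i).1 _ m); rewrite ?addn1 // => m'.
    by rewrite ltnS leqn0 mdeg_eq0 => /eqP ->.
  have -> : a = a 0%MM *: 1 + \sum_i c i * cpsX i by rewrite -ac addrC subrK.
  rewrite hD h1 hsum cps_substD // cps_substZ // cps_subst_eq1 // cps_subst_sum //.
  rewrite rmorphD /= pi_quotZ rmorph1 opprD addrACA subrr add0r !rmorph_sum /= -sumrB.
  apply: eq_bigr => i _; rewrite hM hX cps_substM // cps_substX // !rmorphM /=.
  by rewrite -mulrBl (hb i).2.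
move=> a; rewrite -[h a]reprK; apply/pi_eqP; apply: krull_intersection => N.
have [b bN hb] := step N a.
exists (repr (h a) - cps_subst a kap - b); last by rewrite subKr.
apply/pi_eqP; rewrite rmorphB /= reprK hb //.
Qed.

Lemma lrmorphism_subst (h : {lrmorphism cps v p -> {ideal_quot J}}) :
    local_from_cps h ->
  (forall j, repr (h (cpsX j)) 0%MM = 0) /\
  forall a, h a = \pi_{ideal_quot J} (cps_subst a (fun j => repr (h (cpsX j)))).
Proof.
move=> hloc; have k0 j : repr (h (cpsX j)) 0%MM = 0.
  by apply/quot_max_repr/hloc/cps_maxP/cpsX0.
split=> //; apply: local_morphism_subst => //.
- exact: rmorphD.
- exact: rmorphM.
- by move=> c; rewrite linearZ rmorph1.
- by move=> j; rewrite reprK.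
Qed.

End SubstMorphism.

Lemma local_quot_subst q q' (J : idealr (cps v q)) (J' : idealr (cps v q'))
    (k : {lrmorphism {ideal_quot J} -> {ideal_quot J'}}) (kap : 'I_q -> cps v q') :
    kap = (fun j => repr (k (\pi_{ideal_quot J} (cpsX j)))) ->
    local_quot k ->
  (forall j, kap j 0%MM = 0) /\
  forall a, k (\pi_{ideal_quot J} a) = \pi_{ideal_quot J'} (cps_subst a kap).
Proof.
move=> -> kloc; have k0 j : repr (k (\pi_{ideal_quot J} (cpsX j))) 0%MM = 0.
  by apply/quot_max_repr/kloc/quot_maxP/cpsX0.
split=> //; apply: (local_morphism_subst (h := fun a => k (\pi_{ideal_quot J} a))) => //.
- by move=> a b; rewrite !rmorphD.
- by move=> a b; rewrite !rmorphM.
- by move=> c; rewrite pi_quotZ linearZ /= !rmorph1.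
- by move=> j; rewrite reprK.
Qed.

End Ideals.

(** * Ideals extended to [K{x,t}] and substitutions in blocks of variables *)

Section ExtIdeals.
Variables (R : realType) (K : fieldType) (v : real_valuation R K) (n : nat).

Lemma join_coef0 k m r (u : 'I_k -> cps v r) (w : 'I_m -> cps v r) :
  (forall i, u i 0%MM = 0) -> (forall j, w j 0%MM = 0) ->
  forall i, join u w i 0%MM = 0.
Proof. by move=> hu hw; apply: (join_ind (P := fun a : cps v r => a 0%MM = 0)). Qed.

Lemma incl_t_cpsX q (j : 'I_q) : incl_t n (cpsX j) = cpsX (rshift n j) :> cps v (n + q).
Proof. by rewrite /incl_t cps_substX //; exact: XR0. Qed.

Lemma incl_x_cpsX q (i : 'I_n) : incl_x q (cpsX i) = cpsX (lshift q i) :> cps v (n + q).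
Proof. by rewrite /incl_x cps_substX //; exact: XL0. Qed.

Lemma subst_incl_x q r (a : cps v n) (u : 'I_n -> cps v r) (w : 'I_q -> cps v r) :
    (forall i, u i 0%MM = 0) -> (forall j, w j 0%MM = 0) ->
  cps_subst (incl_x q a) (join u w) = cps_subst a u.
Proof.
move=> u0 w0; have j0 := join_coef0 u0 w0.
rewrite /incl_x cps_subst_comp //; last exact: XL0.
by congr cps_subst; apply/funext => i; rewrite cps_substX // join_lshift.
Qed.

Lemma subst_incl_t q r (a : cps v q) (u : 'I_n -> cps v r) (w : 'I_q -> cps v r) :
    (forall i, u i 0%MM = 0) -> (forall j, w j 0%MM = 0) ->
  cps_subst (incl_t n a) (join u w) = cps_subst a w.
Proof.
move=> u0 w0; have j0 := join_coef0 u0 w0.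
rewrite /incl_t cps_subst_comp //; last exact: XR0.
by congr cps_subst; apply/funext => i; rewrite cps_substX // join_rshift.
Qed.

Lemma subst_join_comp k q r (a : cps v (n + q)) (u : 'I_n -> cps v k)
    (w : 'I_q -> cps v k) (Psi : 'I_k -> cps v r) :
    (forall i, u i 0%MM = 0) -> (forall j, w j 0%MM = 0) ->
    (forall i, Psi i 0%MM = 0) ->
  cps_subst (cps_subst a (join u w)) Psi =
  cps_subst a (join (fun i => cps_subst (u i) Psi) (fun j => cps_subst (w j) Psi)).
Proof.
move=> u0 w0 P0; rewrite cps_subst_comp //; last exact: join_coef0.
by rewrite (comp_join (fun a => cps_subst a Psi)).
Qed.

Lemma at_t0_incl_x q (a : cps v n) : at_t0 (incl_x q a) = a.
Proof.
rewrite /at_t0 subst_incl_x ?cps_substXid // => i; exact: cpsX0.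
Qed.

Lemma at_t0_incl_t q (a : cps v q) : a 0%MM = 0 -> at_t0 (incl_t n a) = 0.
Proof.
move=> a0; rewrite /at_t0 subst_incl_t ?cps_subst_0 // => i; exact: cpsX0.
Qed.

Section OneIdeal.
Variables (q : nat) (J : idealr (cps v q)).
Local Notation I := (ext_ideal n J).

Lemma ext_ideal_incl_t a : a \in J -> incl_t n a \in I.
Proof.
move=> Ja; apply/asboolP; exists 1, (fun=> 1), (fun=> a).
by split=> //; rewrite big_ord1 mul1r.
Qed.

Lemma ext_ideal_at_t0 a : a \in I -> at_t0 a = 0.
Proof.
move=> /asboolP[k [h [j [Jj ->]]]]; rewrite /at_t0 cps_subst_sum; last exact: join_X0_coef0.
rewrite big1 // => i _; rewrite cps_substM; last exact: join_X0_coef0.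
rewrite -[X in _ * X]/(at_t0 _) at_t0_incl_t ?mulr0 //; exact: idealr_coef0 (Jj i).
Qed.

Lemma ext_ideal_eq_at_t0 a b : a - b \in I -> at_t0 a = at_t0 b.
Proof.
move=> /ext_ideal_at_t0; rewrite /at_t0 cps_substB; last exact: join_X0_coef0.
by move/eqP; rewrite subr_eq0 => /eqP.
Qed.

Lemma at_t0_repr_pi a : at_t0 (repr (\pi_{ideal_quot I} a)) = at_t0 a.
Proof. exact: ext_ideal_eq_at_t0 (repr_pi_sub _ _). Qed.

Lemma incl_t_cong a b : a - b \in J -> incl_t n a - incl_t n b \in I.
Proof. by move=> h; rewrite -incl_tB ext_ideal_incl_t. Qed.

Lemma at_t0_X_coef0 (Phi : 'I_n -> cps v (n + q)) :
  (forall i, at_t0 (Phi i) = cpsX i) -> forall i, Phi i 0%MM = 0.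
Proof. by move=> h i; rewrite -at_t0_coef0 h cpsX0. Qed.

End OneIdeal.

Lemma ext_ideal_subst q q' (J : idealr (cps v q)) (J' : idealr (cps v q'))
    (kap : 'I_q -> cps v q') (Phi : 'I_n -> cps v (n + q')) H :
    (forall i, Phi i 0%MM = 0) -> (forall j, kap j 0%MM = 0) ->
    (forall a, a \in J -> cps_subst a kap \in J') ->
    H \in ext_ideal n J ->
  cps_subst H (join Phi (fun j => incl_t n (kap j))) \in ext_ideal n J'.
Proof.
move=> Phi0 kap0 hJ /asboolP[k [h [j [Jj ->]]]].
have ik0 i : incl_t n (kap i) 0%MM = 0 by rewrite incl_t_coef0.
have j0 := join_coef0 Phi0 ik0.
rewrite cps_subst_sum //; apply: rpred_sum => i _; rewrite cps_substM //.
apply: idealMr; rewrite subst_incl_t //.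
have -> : cps_subst (j i) (fun j => incl_t n (kap j)) = incl_t n (cps_subst (j i) kap).
  by rewrite [RHS]/incl_t cps_subst_comp //; exact: XR0.
by apply: ext_ideal_incl_t; exact: hJ.
Qed.

Lemma ext_ideal_subst_x q (J : idealr (cps v q)) (Phi : 'I_n -> cps v (n + q)) H :
    (forall i, Phi i 0%MM = 0) -> H \in ext_ideal n J ->
  cps_subst H (join Phi (fun j => cpsX (rshift n j))) \in ext_ideal n J.
Proof.
move=> Phi0 hH; have := @ext_ideal_subst q q J J cpsX Phi H Phi0.
under eq_fun do rewrite incl_t_cpsX.
by apply => // [j|a Ja]; [exact: cpsX0|rewrite cps_substXid].
Qed.

End ExtIdeals.

(** * Versality *)

Section Unfolding.
Variables (R : realType) (K : fieldType) (v : real_valuation R K).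
Variables (n p : nat) (f : cps v n) (g : 'I_p -> cps v n).

Local Notation F := (linear_unfolding f g).
Local Notation XR n q := (fun j : 'I_q => cpsX (rshift n j)).
Local Notation XL n q := (fun i : 'I_n => cpsX (lshift q i)).

Lemma subst_linear_unfolding r (u : 'I_n -> cps v r) (w : 'I_p -> cps v r) :
    (forall i, u i 0%MM = 0) -> (forall j, w j 0%MM = 0) ->
  cps_subst F (join u w) = cps_subst f u + \sum_j cps_subst (g j) u * w j.
Proof.
move=> u0 w0; have j0 := join_coef0 u0 w0.
rewrite /linear_unfolding cps_substD // subst_incl_x // cps_subst_sum //.
congr (_ + _); apply: eq_bigr => j _.
by rewrite cps_substM // subst_incl_x // cps_substX // join_rshift.
Qed.

Lemma unfolding_linear : unfolding f F.
Proof.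
rewrite /unfolding /at_t0 subst_linear_unfolding //; last by move=> i; exact: cpsX0.
by rewrite cps_substXid big1 ?addr0 // => j _; rewrite mulr0.
Qed.

Lemma lin_unf_subst q r (phi : 'I_p -> cps v q) (u : 'I_n -> cps v r)
    (w : 'I_q -> cps v r) :
    (forall i, u i 0%MM = 0) -> (forall j, w j 0%MM = 0) ->
  cps_subst (lin_unf f g phi) (join u w) =
  cps_subst f u + \sum_j cps_subst (g j) u * cps_subst (phi j) w.
Proof.
move=> u0 w0; have j0 := join_coef0 u0 w0.
rewrite /lin_unf cps_substD // subst_incl_x // cps_subst_sum //.
congr (_ + _); apply: eq_bigr => j _.
by rewrite cps_substM // subst_incl_x // subst_incl_t.
Qed.

Lemma lin_unf_cong q (J : idealr (cps v q)) (phi phi' : 'I_p -> cps v q) :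
  (forall j, phi j - phi' j \in J) ->
  lin_unf f g phi - lin_unf f g phi' \in ext_ideal n J.
Proof.
move=> h; rewrite /lin_unf opprD addrACA subrr add0r -sumrB.
by apply: rpred_sum => j _; rewrite -mulrBr; apply: idealMr; exact: incl_t_cong.
Qed.

Lemma subst_x_cong q (J : idealr (cps v q)) (G G' : cps v (n + q))
    (Phi Phi' : 'I_n -> cps v (n + q)) :
    (forall i, Phi i 0%MM = 0) -> (forall i, Phi' i 0%MM = 0) ->
    G - G' \in ext_ideal n J -> (forall i, Phi i - Phi' i \in ext_ideal n J) ->
  cps_subst G (join Phi (XR n q)) - cps_subst G' (join Phi' (XR n q)) \in ext_ideal n J.
Proof.
move=> P0 P0' hG hP; have XR0 j : (XR n q j : cps v (n + q)) 0%MM = 0 by exact: cpsX0.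
have j0 := join_coef0 P0 XR0; have j0' := join_coef0 P0' XR0.
apply: (@idealr_trans _ _ _ _ _ _ (cps_subst G' (join Phi (XR n q)))).
  by rewrite -cps_substB //; exact: ext_ideal_subst_x.
apply: subst_cong_ideal => // i.
by case: (split_ordP i) => j ->; rewrite ?join_lshift ?join_rshift // subrr rpred0.
Qed.

Lemma base_change_linear q (J : idealr (cps v q))
    (phi : {lrmorphism cps v p -> {ideal_quot J}}) (ph : 'I_p -> cps v q) :
    (forall j, ph j 0%MM = 0) ->
    (forall j, phi (cpsX j) = \pi_{ideal_quot J} (ph j)) ->
  base_change F phi = \pi_{ideal_quot (ext_ideal n J)} (lin_unf f g ph).
Proof.
move=> ph0 hph; have r0 j : repr (phi (cpsX j)) 0%MM = 0.
  by apply/quot_max_repr; rewrite hph; exact/quot_maxP.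
rewrite /base_change subst_linear_unfolding; [|exact: XL0|]; last first.
  by move=> j; rewrite incl_t_coef0.
apply/pi_eqP; apply: (lin_unf_cong (phi := fun j => repr (phi (cpsX j)))) => j.
by rewrite hph; exact: repr_pi_sub.
Qed.

(** Changing representatives moves both sides only by elements of [J K{x,t}], so any series
    representing the data may be used. Versality and uniqueness are then argued in [K{x,t}]. *)
Lemma right_inducedP q (J : idealr (cps v q))
    (phi : {lrmorphism cps v p -> {ideal_quot J}}) (ph : 'I_p -> cps v q)
    (G : cps v (n + q)) :
    (forall j, ph j 0%MM = 0) ->
    (forall j, phi (cpsX j) = \pi_{ideal_quot J} (ph j)) ->
  right_induced F phi (\pi_{ideal_quot (ext_ideal n J)} G) <->
  exists (Phi : 'I_n -> cps v (n + q)) (alpha : cps v q),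
    [/\ forall i, at_t0 (Phi i) = cpsX i, alpha 0%MM = 0 &
      cps_subst G (join Phi (XR n q)) - (lin_unf f g ph + incl_t n alpha)
        \in ext_ideal n J].
Proof.
move=> ph0 hph; have bc := base_change_linear ph0 hph.
have hG := repr_pi_sub (ext_ideal n J) G.
split=> [[Phi [alpha [hPhi halpha]]]|[Phi [alpha [hPhi a0 e]]]].
  rewrite /reparam /incl_S bc -rmorphD => /pi_eqP e.
  exists (fun i => repr (Phi i)), (repr alpha); split=> //; first exact/quot_max_repr.
  apply: idealr_trans e; rewrite idealr_opp.
  have P0 := at_t0_X_coef0 hPhi.
  by apply: subst_x_cong => // i; rewrite subrr rpred0.
exists (fun i => \pi_{ideal_quot (ext_ideal n J)} (Phi i)), (\pi_{ideal_quot J} alpha).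
have hPhi' i : at_t0 (repr (\pi_{ideal_quot (ext_ideal n J)} (Phi i))) = cpsX i.
  by rewrite at_t0_repr_pi.
split=> //; first exact/quot_maxP.
rewrite /reparam /incl_S bc -rmorphD; apply/pi_eqP.
apply: (@idealr_trans _ _ _ _ _ _ (cps_subst G (join Phi (XR n q)))).
  apply: subst_x_cong => //; [exact: at_t0_X_coef0 hPhi'|exact: at_t0_X_coef0 hPhi|].
  by move=> i; exact: repr_pi_sub.
apply: idealr_trans e _; rewrite opprD addrACA subrr add0r.
by apply: incl_t_cong; rewrite idealr_opp; exact: repr_pi_sub.
Qed.

Lemma max_ideal_ext q (a : cps v (n + q)) :
  fps_grd (wdeg (isr n q)) 1 a -> a \in ext_ideal n (@max_ideal R K v q).
Proof.
move=> ha; pose P : 'I_q -> 'I_(n + q) := fun j => rshift n j.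
apply/asboolP; exists q, (fun j => cps_shift P j a), (fun j => cpsX j); split.
  by move=> j; apply/eqP/cpsX0.
rewrite {1}(cps_shift_decomp P a) [cps_rest P a](_ : _ = 0) ?add0r.
  by apply: eq_bigr => j _; rewrite mulrC incl_t_cpsX.
apply: cpsP; apply/fpsP => m /=; rewrite /pick_var; case: pickP => // h.
apply: ha; rewrite ltnNge; apply/negP => /wdeg_isr_gt0[j].
by rewrite [(0 < _)%N]h.
Qed.

Section Versal.
Hypothesis fg : jac_generating f g.

(** The start is the identity with [phi = 0] and [alpha = 0]: its error [G - f] vanishes at [t = 0],
    so it lies in the ideal generated by [t]. *)
Lemma right_complete_linear : right_complete f F.
Proof.
move=> q G hG J0.
have XR0 j : (XR n q j : cps v (n + q)) 0%MM = 0 by exact: cpsX0.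
have GX : cps_subst G (join (XL n q) (XR n q)) = G.
  by rewrite -[RHS]cps_substXid -(join_eta cpsX).
have z0 (j : 'I_p) : (0 : cps v q) 0%MM = 0 by [].
have [] := @solve_exactly _ _ _ _ _ _ f g fg (@max_ideal R K v q) G
  (XL n q) (fun=> 0) 0 hG.
- by move=> i; rewrite -incl_x_cpsX at_t0_incl_x.
- rewrite GX /lin_unf big1 ?addr0; last first.
    by move=> j _; rewrite /incl_t cps_subst_zero ?mulr0.
  rewrite /incl_t cps_subst_zero // addr0 -hG; apply: max_ideal_ext.
  exact: grd_at_t0.
move=> Phi [phi [alpha [hPhi hphi halpha e]]].
have phi0 j : phi j 0%MM = 0.
  by have := idealr_coef0 (hphi j); rewrite subr0.
have alpha0 : alpha 0%MM = 0 by have := idealr_coef0 halpha; rewrite subr0.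
have [h hloc hE] := subst_morphism J0 phi0; exists h => //.
apply/(right_inducedP (ph := phi)) => //.
  by move=> j; rewrite hE cps_substX.
exists Phi, alpha; split=> // [i|]; last by rewrite e subrr rpred0.
by rewrite (ext_ideal_eq_at_t0 (hPhi i)) -incl_x_cpsX at_t0_incl_x.
Qed.

(** Surjectivity of [k] provides series [T] in [t] that lift the variables of [S']. Substituting [T]
    into the solution over [S'] gives a solution over [K{t}] modulo the preimage [I] of [J']; the
    exact correction changes it only by elements of [I], so [k] still maps the new morphism to
    [phi']. *)
Lemma lifting_linear : lifting_property f F.
Proof.
move=> q J q' J' G k phi' hG kloc ksurj phi'loc.
pose kap j := repr (k (\pi_{ideal_quot J} (cpsX j))).
have [kap0 kE] := local_quot_subst (erefl kap) kloc.
pose ph' j := repr (phi' (cpsX j)).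
have [ph'0 phi'E] := lrmorphism_subst phi'loc.
have /choice[T hT] (j : 'I_q') : exists b : cps v q,
    cps_subst b kap - cpsX j \in J'.
  have [s ks] := ksurj (\pi_{ideal_quot J'} (cpsX j)); exists (repr s).
  by apply/pi_eqP; rewrite -kE reprK.
have T0 j : T j 0%MM = 0.
  have := idealr_coef0 (hT j).
  by rewrite -[_ 0%MM]/(cps_subst (T j) kap 0%MM - cpsX j 0%MM) cpsX0 subr0 cps_subst_coef0.
have TK b : cps_subst (cps_subst b T) kap - b \in J'.
  rewrite cps_subst_comp // -{2}[b]cps_substXid; apply: subst_cong_ideal => // j.
    by rewrite cps_subst_coef0.
  exact: cpsX0.
pose I := @preim_ideal R K v q q' J' (exist _ kap kap0).
have IE a : (a \in I) = (cps_subst a kap \in J') by [].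
pose Gh := repr G.
have ikap0 j : incl_t n (kap j) 0%MM = 0 by rewrite incl_t_coef0.
have iT0 j : incl_t n (T j) 0%MM = 0 by rewrite incl_t_coef0.
rewrite /push_forward -/kap.
have ph'E j : phi' (cpsX j) = \pi_{ideal_quot J'} (ph' j) by rewrite reprK.
move=> /(right_inducedP _ ph'0 ph'E)[Phi' [alpha' [hPhi' alpha'0 e]]].
have Phi'0 := at_t0_X_coef0 hPhi'.
have XR0 m r j : (XR m r j : cps v (m + r)) 0%MM = 0 by exact: cpsX0.
have XLz m r j : (XL m r j : cps v (m + r)) 0%MM = 0 by exact: cpsX0.
have jT0 := join_coef0 (XLz n q) iT0.
pose Phi0 i := cps_subst (Phi' i) (join (XL n q) (fun j => incl_t n (T j))).
pose phi0 j := cps_subst (ph' j) T.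
pose alpha0 := cps_subst alpha' T.
have Phi00 i : Phi0 i 0%MM = 0 by rewrite /Phi0 cps_subst_coef0.
have Phi0X i : at_t0 (Phi0 i) = cpsX i.
  rewrite -[RHS]hPhi' /at_t0 /Phi0 subst_join_comp //; last exact: join_X0_coef0.
  congr cps_subst; congr join; apply/funext => j.
    by rewrite cps_substX ?join_lshift //; exact: join_X0_coef0.
  by rewrite -[LHS]/(at_t0 _) at_t0_incl_t.
have incl_t_comp (b : cps v q') : cps_subst b (fun j => incl_t n (T j)) = incl_t n (cps_subst b T).
  by rewrite [RHS]/incl_t cps_subst_comp //; exact: XR0.
have {}e : cps_subst Gh (join Phi' (fun j => incl_t n (kap j))) -
    (lin_unf f g ph' + incl_t n alpha') \in ext_ideal n J'.
  suff <- : cps_subst (cps_subst Gh (join (XL n q') (fun j => incl_t n (kap j))))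
      (join Phi' (XR n q')) = cps_subst Gh (join Phi' (fun j => incl_t n (kap j))).
    exact: e.
  have j0 := join_coef0 Phi'0 (XR0 n q').
  rewrite (subst_join_comp Gh (XLz n q') ikap0 j0).
  congr cps_subst; congr join; apply/funext => j.
    by rewrite (cps_substX _ j0) join_lshift.
  by rewrite (subst_incl_t _ Phi'0 (XR0 n q')).
have E0 : cps_subst Gh (join Phi0 (XR n q)) -
    (lin_unf f g phi0 + incl_t n alpha0) \in ext_ideal n I.
  have TI a : a \in J' -> cps_subst a T \in I.
    by move=> Ja; rewrite IE -[cps_subst _ _](subrK a) rpredD.
  have := ext_ideal_subst (XLz n q) T0 TI e.
  rewrite cps_substB // cps_substD // subst_join_comp // lin_unf_subst // subst_incl_t //.
  rewrite incl_t_comp -/alpha0.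
  have -> : cps_subst f (XL n q) + \sum_j cps_subst (g j) (XL n q) *
      cps_subst (ph' j) (fun j => incl_t n (T j)) = lin_unf f g phi0.
    by congr (_ + _); apply: eq_bigr => j _; rewrite incl_t_comp.
  apply: idealr_trans.
  have kT0 j : cps_subst (incl_t n (kap j)) (join (XL n q) (fun j => incl_t n (T j))) 0%MM = 0.
    by rewrite cps_subst_coef0.
  (* The transported equation contains [kap (T)] in place of [t]. Both have the same image under
     [kap] modulo [J'], so they agree modulo [I]. *)
  apply: subst_cong_ideal => [||i]; try exact: join_coef0.
  case: (split_ordP i) => j ->; rewrite ?join_lshift ?join_rshift ?subrr ?rpred0 //.
  rewrite subst_incl_t // incl_t_comp -incl_t_cpsX; apply: incl_t_cong.
  by rewrite IE cps_substB // cps_substX // idealr_opp TK.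
have [Phi [phi [alpha [hPhi hphi halpha sol]]]] := solve_exactly fg hG Phi0X E0.
have phi0_0 j : phi0 j 0%MM = 0 by rewrite /phi0 cps_subst_coef0 // ph'0.
have phi_0 j : phi j 0%MM = 0.
  by have := idealr_coef0 (hphi j); rewrite /= phi0_0 subr0.
have alpha_0 : alpha 0%MM = 0.
  by have := idealr_coef0 halpha; rewrite /= cps_subst_coef0 // alpha'0 subr0.
have [h hloc hE] := subst_morphism J phi_0; exists h; split=> //.
  move=> a; rewrite hE kE phi'E; apply/pi_eqP; rewrite cps_subst_comp //.
  apply: subst_cong_ideal => // j; first by rewrite cps_subst_coef0.
  apply: idealr_trans (TK (ph' j)).
  by have := hphi j; rewrite IE (cps_substB _ _ kap0).
rewrite -[G]reprK; apply/(right_inducedP (ph := phi)) => //.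
  by move=> j; rewrite hE cps_substX.
exists Phi, alpha; split=> // [i|]; last by rewrite sol subrr rpred0.
by rewrite (ext_ideal_eq_at_t0 (hPhi i)).
Qed.

Lemma right_versal_linear : right_versal f F.
Proof.
split; [exact: unfolding_linear|exact: right_complete_linear|exact: lifting_linear].
Qed.

End Versal.

(** * Differentiation at [t = 0] along a tangent vector *)

Lemma cps_derivB k (i : 'I_k) (a b : cps v k) :
  cps_deriv i (a - b) = cps_deriv i a - cps_deriv i b.
Proof. apply: cpsP; exact: fps_derivB. Qed.

Lemma cps_derivD k (i : 'I_k) (a b : cps v k) :
  cps_deriv i (a + b) = cps_deriv i a + cps_deriv i b.
Proof. apply: cpsP; exact: fps_derivD. Qed.

Lemma cps_derivM k (i : 'I_k) (a b : cps v k) :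
  cps_deriv i (a * b) = cps_deriv i a * b + a * cps_deriv i b.
Proof. apply: cpsP; exact: fps_derivM. Qed.

(* [lam] is a tangent vector of the parameter space at [t = 0]. *)
Section Tangent.
Variables (q : nat) (lam : 'I_q -> K).

Definition tangent (a : cps v (n + q)) : cps v n :=
  \sum_l lam l *: at_t0 (cps_deriv (rshift n l) a).

Definition linpart (a : cps v q) : 'rV[K]_q := \row_l a U_(l)%MM.

Definition lin_eval (a : cps v q) : K := \sum_l lam l * a U_(l)%MM.

Lemma tangentB a b : tangent (a - b) = tangent a - tangent b.
Proof.
rewrite /tangent -sumrB; apply: eq_bigr => l _; rewrite -scalerBr; congr (_ *: _).
rewrite cps_derivB /at_t0 -cps_substB //; exact: join_X0_coef0.
Qed.

Lemma tangentD a b : tangent (a + b) = tangent a + tangent b.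
Proof.
rewrite /tangent -big_split; apply: eq_bigr => l _ /=; rewrite -scalerDr; congr (_ *: _).
rewrite cps_derivD /at_t0 -cps_substD //; exact: join_X0_coef0.
Qed.

Lemma tangentM a b : tangent (a * b) = tangent a * at_t0 b + at_t0 a * tangent b.
Proof.
have J0 := @join_X0_coef0 R K v n q.
rewrite /tangent mulr_suml mulr_sumr -big_split; apply: eq_bigr => l _ /=.
rewrite cps_derivM /at_t0 cps_substD ?cps_substM //.
by rewrite scalerDr scalerAl scalerAr.
Qed.

Lemma tangent_sum (I : Type) (r : seq I) (E : I -> cps v (n + q)) :
  tangent (\sum_(i <- r) E i) = \sum_(i <- r) tangent (E i).
Proof.
apply: (big_morph tangent tangentD).
by rewrite -[X in tangent X](subrr 0) tangentB subrr.
Qed.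

Lemma tangent_incl_x a : tangent (incl_x q a) = 0.
Proof.
rewrite /tangent big1 // => l _; rewrite (_ : cps_deriv _ _ = 0).
  rewrite /at_t0 cps_subst_zero ?scaler0 //; exact: join_X0_coef0.
apply: cpsP; rewrite /= /incl_x cps_substE; last exact: XL0.
rewrite fps_chain; last exact: (@XL0 R K v).
by rewrite big1 // => i _; rewrite fps_derivX eq_rlshift mulr0.
Qed.

Lemma tangent_incl_t a : tangent (incl_t n a) = (lin_eval a)%:A.
Proof.
rewrite /tangent /lin_eval scaler_suml; apply: eq_bigr => l _.
rewrite -scalerA; congr (_ *: _).
have -> : cps_deriv (rshift n l) (incl_t n a) = incl_t n (cps_deriv l a).
  apply: cpsP; rewrite /= /incl_t !cps_substE; try exact: XR0.
  rewrite fps_chain; last exact: (@XR0 R K v).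
  rewrite (bigD1 l) //= fps_derivX eqxx mulr1 big1 ?addr0 // => i ne.
  by rewrite fps_derivX eq_rshift eq_sym (negPf ne) mulr0.
rewrite -[cps_deriv l a](subrK ((a U_(l)%MM)%:A)) incl_tD.
rewrite /at_t0 cps_substD; last exact: join_X0_coef0.
rewrite -[X in X + _]/(at_t0 _) at_t0_incl_t ?add0r; last first.
  by rewrite /= add0m mnm0E mulr1n eqxx mulr1 subrr.
rewrite incl_tZ cps_substZ; last exact: join_X0_coef0.
rewrite /incl_t cps_subst_eq1; last exact: XR0.
by rewrite cps_subst_eq1 //; exact: join_X0_coef0.
Qed.

(** The chain rule at [t = 0], where [Phi] is the identity; the variables [t], left fixed by the
    substitution, contribute the term [tangent G]. *)
Lemma tangent_subst (G : cps v (n + q)) (Phi : 'I_n -> cps v (n + q)) :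
    (forall i, at_t0 (Phi i) = cpsX i) ->
  tangent (cps_subst G (join Phi (XR n q))) =
  \sum_k cps_deriv k (at_t0 G) * tangent (Phi k) + tangent G.
Proof.
move=> hPhi; have P0 := at_t0_X_coef0 hPhi.
have J0 := @join_X0_coef0 R K v n q.
have j0 := join_coef0 P0 (@XR0 R K v n q).
pose Th := join Phi (XR n q).
have hTh b : at_t0 (cps_subst b Th) = at_t0 b.
  rewrite /at_t0 subst_join_comp //; last exact: XR0.
  congr cps_subst; congr join; apply/funext => i.
    by rewrite -[LHS]/(at_t0 _) hPhi.
  by rewrite cps_substX // join_rshift.
have chain l : at_t0 (cps_deriv (rshift n l) (cps_subst G Th)) =
    \sum_k cps_deriv k (at_t0 G) * at_t0 (cps_deriv (rshift n l) (Phi k)) +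
    at_t0 (cps_deriv (rshift n l) G).
  have -> : cps_deriv (rshift n l) (cps_subst G Th) =
      \sum_k cps_subst (cps_deriv k G) Th * cps_deriv (rshift n l) (Th k).
    apply: cpsP; rewrite /= cps_substE // fps_chain //.
    rewrite (big_morph (@cps_val R K v _) (id1 := 0) (op1 := +%R)) //.
    apply: eq_bigr => k _.
    rewrite -[RHS]/(cps_val (cps_subst (cps_deriv k G) Th) * cps_val (cps_deriv _ (Th k))).
    by rewrite cps_substE.
  rewrite big_split_ord /= /at_t0 cps_substD // !cps_subst_sum //; congr (_ + _).
    apply: eq_bigr => k _; rewrite cps_substM // -[X in X * _]/(at_t0 _) hTh.
    by rewrite at_t0_deriv /Th join_lshift.
  rewrite (bigD1 l) //= big1 ?addr0 => [|k ne].
    rewrite cps_substM // -[X in X * _]/(at_t0 _) hTh /Th join_rshift.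
    rewrite (_ : cps_deriv _ (cpsX _) = 1) ?cps_subst_eq1 ?mulr1 //.
    by apply: cpsP; rewrite /= fps_derivX eqxx.
  rewrite cps_substM // /Th join_rshift (_ : cps_deriv _ (cpsX _) = 0).
    by rewrite cps_subst_zero ?mulr0.
  by apply: cpsP; rewrite /= fps_derivX eq_rshift eq_sym (negPf ne).
rewrite /tangent; under eq_bigr => l _ do rewrite chain scalerDr scaler_sumr.
rewrite big_split exchange_big /=; congr (_ + _); apply: eq_bigr => k _.
by rewrite mulr_sumr; apply: eq_bigr => l _; rewrite scalerAr.
Qed.

(** In a product [h * j] with [j] in [J], the product rule leaves only terms with the factor [j (0)]
    or the value of [lam] on the linear part of [j]. A tangent vector of [S] thus sees only classes
    modulo [J K{x,t}]. *)
Lemma tangent_ext_ideal (J : idealr (cps v q)) a :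
  (forall b, b \in J -> lin_eval b = 0) -> a \in ext_ideal n J -> tangent a = 0.
Proof.
move=> hJ /asboolP[k [h [j [Jj ->]]]]; rewrite tangent_sum big1 // => i _.
rewrite tangentM tangent_incl_t hJ // scale0r mulr0 addr0.
by rewrite at_t0_incl_t ?mulr0 //; exact: idealr_coef0 (Jj i).
Qed.

End Tangent.

End Unfolding.

(** * Semiuniversality *)

(** Among the matrices with rows in [P] take one of maximal rank: adjoining a further vector of [P]
    cannot raise the rank. *)
Lemma subspace_matrix (K : fieldType) q (P : 'rV[K]_q -> Prop) :
    P 0 -> (forall c u w, P u -> P w -> P (c *: u + w)) ->
  exists B : 'M[K]_q, forall u, P u <-> (u <= B)%MS.
Proof.
move=> P0 PL; have Pspan m (C : 'M[K]_(m, q)) u :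
    (forall i, P (row i C)) -> (u <= C)%MS -> P u.
  move=> hC /submxP[D ->]; rewrite mulmx_sum_row.
  apply: big_ind => // [x y hx hy|i _]; first by rewrite -[x]scale1r; exact: PL.
  by rewrite -[_ *: _]addr0; exact: PL.
pose S r := `[< exists B : 'M[K]_q, (forall i, P (row i B)) /\ \rank B = r >].
have exS : exists r, S r.
  exists 0%N; apply/asboolP; exists 0; split=> [i|]; last exact: mxrank0.
  by rewrite row0.
have bS r : S r -> (r <= q)%N by move=> /asboolP[B [_ <-]]; exact: rank_leq_col.
case: (ex_maxnP exS bS) => r /asboolP[B [PB rB]] rmax; exists B => u.
split=> [Pu|]; last exact: Pspan.
have /rmax : S (\rank (B + u)%MS).
  apply/asboolP; exists (B + u)%MS; split=> // i.
  apply: (@Pspan _ (col_mx B u)); last first.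
    by rewrite -addsmxE row_sub.
  by move=> j; case: (split_ordP j) => l ->; rewrite ?rowKu ?rowKd // row_id.
rewrite -rB => le_r; have le := addsmxSl B u.
have /eqP := eqn_leq (\rank B) (\rank (B + u)%MS); rewrite le_r mxrankS // => /eqP.
rewrite (mxrank_leqif_sup le) => /eqP; rewrite eqb_id => hs.
exact: submx_trans (addsmxSr B u) hs.
Qed.

(** * The square of the maximal ideal of [S] *)

Section IdealProd.
Variables (R : realType) (K : fieldType) (v : real_valuation R K).
Variables (q : nat) (J : idealr (cps v q)).
Local Notation QM := (@quot_max R K v q J).
Local Notation IP := (ideal_prod QM QM).

Lemma ideal_prodD a b : IP a -> IP b -> IP (a + b).
Proof.
move=> [k [c [d [hc hd ->]]]] [k' [c' [d' [hc' hd' ->]]]].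
exists (k + k')%N, (join c c'), (join d d'); split.
- exact: join_ind.
- exact: join_ind.
rewrite big_split_ord /=; congr (_ + _); apply: eq_bigr => i _;
  by rewrite ?join_lshift ?join_rshift.
Qed.

Lemma ideal_prod_mul a b : QM a -> QM b -> IP (a * b).
Proof.
by move=> ha hb; exists 1, (fun=> a), (fun=> b); split=> //; rewrite big_ord1.
Qed.

Lemma ideal_prod0 : IP 0.
Proof.
exists 0, (fun=> 0), (fun=> 0); split; rewrite ?big_ord0 //; by case.
Qed.

Lemma ideal_prodMl a b : IP b -> IP (a * b).
Proof.
move=> [k [c [d [hc hd ->]]]]; exists k, (fun i => a * c i), d; split=> //.
  move=> i; rewrite -[a]reprK -[c i]reprK -rmorphM; apply/quot_maxP.
  by rewrite cps_coef0M (quot_max_repr (c i)).1 ?mulr0.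
by rewrite mulr_sumr; apply: eq_bigr => i _; rewrite mulrA.
Qed.

Lemma ideal_prod_sum (I : Type) (r : seq I) (E : I -> {ideal_quot J}) :
  (forall i, IP (E i)) -> IP (\sum_(i <- r) E i).
Proof.
by move=> h; apply: big_ind => //; [exact: ideal_prod0|exact: ideal_prodD].
Qed.

Lemma ideal_prod_pi a : fps_ord 2 (a : cps v q) -> IP (\pi_{ideal_quot J} a).
Proof.
move=> /cps_ord2_max2[k [b [c [hb hc ->]]]]; rewrite rmorph_sum.
apply: ideal_prod_sum => i; rewrite rmorphM; apply: ideal_prod_mul.
  by exists (b i).
by exists (c i).
Qed.
End IdealProd.

Section Semiuniversal.
Variables (R : realType) (K : fieldType) (v : real_valuation R K).
Variables (n p : nat) (f : cps v n) (g : 'I_p -> cps v n).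
Hypothesis f_m2 : ideal_prod (@cps_max R K v n) (@cps_max R K v n) f.

Lemma deriv_coef0 k : cps_deriv k f 0%MM = 0.
Proof.
have [m [b [c [hb hc ->]]]] := f_m2.
rewrite (big_morph (cps_deriv k) (id1 := 0) (op1 := +%R)); last first.
- by apply: cpsP; apply/fpsP => l /=; rewrite mul0rn.
- exact: cps_derivD.
rewrite (big_morph (fun a : cps v n => a 0%MM) (id1 := 0) (op1 := +%R)) //.
rewrite big1 // => i _; rewrite cps_derivM.
rewrite -[LHS]/((cps_deriv k (b i) * c i) 0%MM + (b i * cps_deriv k (c i)) 0%MM).
by rewrite !cps_coef0M ((cps_maxP _).1 (hb i)) ((cps_maxP _).1 (hc i)) mulr0 mul0r addr0.
Qed.

Lemma tangent_lin_unf q (lam : 'I_q -> K) (ph : 'I_p -> cps v q) :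
  tangent lam (lin_unf f g ph) = \sum_j lin_eval lam (ph j) *: g j.
Proof.
rewrite /lin_unf tangentD tangent_incl_x add0r tangent_sum; apply: eq_bigr => j _.
rewrite tangentM tangent_incl_x mul0r add0r tangent_incl_t at_t0_incl_x.
by rewrite -scalerAr mulr1.
Qed.

Lemma tangent_relation q (lam : 'I_q -> K) (G : cps v (n + q))
    (Phi : 'I_n -> cps v (n + q)) (ph : 'I_p -> cps v q) (alpha : cps v q) :
    (forall i, at_t0 (Phi i) = cpsX i) ->
  tangent lam (cps_subst G (join Phi (fun j => cpsX (rshift n j)))
      - (lin_unf f g ph + incl_t n alpha)) =
  \sum_k cps_deriv k (at_t0 G) * tangent lam (Phi k) + tangent lam G
    - (\sum_j lin_eval lam (ph j) *: g j + (lin_eval lam alpha)%:A).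
Proof.
move=> hPhi.
by rewrite tangentB tangentD (tangent_subst _ _ hPhi) tangent_lin_unf tangent_incl_t.
Qed.

Hypothesis fg : jac_basis f g.

(** The difference of the two tangent equations puts a combination of the [g j] plus a constant into
    the Jacobian ideal. Evaluation at 0 kills the constant, as the [g j] lie in [m] and so do the
    partial derivatives of [f], which is in [m^2]; independence of the [g j] kills the
    coefficients. *)
Lemma induced_lin_eval q (J : idealr (cps v q)) (lam : 'I_q -> K)
    (G : cps v (n + q)) (Phi Phi' : 'I_n -> cps v (n + q))
    (ph ph' : 'I_p -> cps v q) (alpha alpha' : cps v q) :
    at_t0 G = f -> (forall b, b \in J -> lin_eval lam b = 0) ->
    (forall i, at_t0 (Phi i) = cpsX i) -> (forall i, at_t0 (Phi' i) = cpsX i) ->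
    cps_subst G (join Phi (fun j => cpsX (rshift n j)))
      - (lin_unf f g ph + incl_t n alpha) \in ext_ideal n J ->
    cps_subst G (join Phi' (fun j => cpsX (rshift n j)))
      - (lin_unf f g ph' + incl_t n alpha') \in ext_ideal n J ->
  forall j, lin_eval lam (ph j) = lin_eval lam (ph' j).
Proof.
move=> Gf hlam hPhi hPhi' /(tangent_ext_ideal hlam) e /(tangent_ext_ideal hlam) e'.
move: e e'; rewrite (tangent_relation _ _ _ _ hPhi) (tangent_relation _ _ _ _ hPhi') Gf.
set s := \sum_j lin_eval lam (ph j) *: g j; set s' := \sum_j lin_eval lam (ph' j) *: g j.
set d := \sum_k _ * tangent lam (Phi k); set d' := \sum_k _ * tangent lam (Phi' k).
set c := lin_eval lam alpha; set c' := lin_eval lam alpha' => e e'.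
have ds : s - s' + (c - c')%:A = d - d'.
  have : d + tangent lam G - (s + c%:A) - (d' + tangent lam G - (s' + c'%:A)) = 0.
    by rewrite e e' subrr.
  rewrite scalerBl => h; apply/eqP; rewrite -subr_eq0 -oppr_eq0; apply/eqP.
  by rewrite -[RHS]h; ring.
have jd : jacobian_ideal f (d - d').
  exists (fun k => tangent lam (Phi k) - tangent lam (Phi' k)).
  by rewrite -sumrB; apply: eq_bigr => k _; rewrite -mulrBr mulrC.
have ss : s - s' = \sum_j (lin_eval lam (ph j) - lin_eval lam (ph' j)) *: g j.
  by rewrite -sumrB; apply: eq_bigr => j _; rewrite scalerBl.
have g0 j : g j 0%MM = 0 by apply/cps_maxP; exact: fg.1.1.
have cc : c - c' = 0.
  have [h hd] := jd; have := congr1 (fun a : cps v n => a 0%MM) ds.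
  rewrite hd (big_morph (fun a : cps v n => a 0%MM) (id1 := 0) (op1 := +%R)) //.
  rewrite [RHS]big1 => [|k _]; last by rewrite cps_coef0M deriv_coef0 mulr0.
  rewrite -[LHS]/((s - s') 0%MM + (c - c') * _) ss.
  rewrite (big_morph (fun a : cps v n => a 0%MM) (id1 := 0) (op1 := +%R)) //.
  rewrite big1 ?add0r => [|j _]; first by rewrite /= eqxx mulr1.
  by rewrite -[LHS]/(_ * g j 0%MM) g0 mulr0.
move=> j; apply/eqP; rewrite -subr_eq0; apply/eqP; move: j; apply: fg.2.
by rewrite -ss -[s - s']addr0 -(scale0r 1) -cc ds.
Qed.

Lemma lin_evalB q (lam : 'I_q -> K) (a b : cps v q) :
  lin_eval lam (a - b) = lin_eval lam a - lin_eval lam b.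
Proof.
by rewrite /lin_eval -sumrB; apply: eq_bigr => l _; rewrite -mulrBr.
Qed.

Lemma lin_eval_mul q (C : 'M[K]_q) (l : 'I_q) (a : cps v q) :
  lin_eval (fun i => C i l) a = (linpart a *m C) 0 l.
Proof. by rewrite mxE; apply: eq_bigr => i _; rewrite mxE mulrC. Qed.

(** Linear duality: the linear parts of [J] form a row space, and the columns of its cokernel matrix
    are functionals vanishing on [J] that detect membership. *)
Lemma linpart_ideal q (J : idealr (cps v q)) (a : cps v q) :
    (forall lam, (forall b, b \in J -> lin_eval lam b = 0) -> lin_eval lam a = 0) ->
  exists2 b, b \in J & linpart b = linpart a.
Proof.
move=> ha; have [||B hB] :=
    @subspace_matrix K q (fun u => exists2 b, b \in J & linpart b = u).
- exists 0; first exact: rpred0.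
  by apply/rowP => l; rewrite !mxE.
- move=> c _ _ [b Jb <-] [b' Jb' <-]; exists (c *: b + b').
    by rewrite rpredD // -mulr_algl idealMr.
  by apply/rowP => l; rewrite !mxE.
apply/hB; rewrite submxE; apply/eqP/rowP => l; rewrite [RHS]mxE -lin_eval_mul.
apply: ha => b Jb; rewrite lin_eval_mul.
have : (linpart b <= B)%MS by apply/hB; exists b.
by rewrite submxE => /eqP ->; rewrite mxE.
Qed.

(** The tangent vectors of [S] are the [lam] that kill the linear parts of [J]. All of them agree on
    [phi (s_j)] and [phi' (s_j)], so by duality the difference has a representative of order 2 and
    lies in the square of the maximal ideal. *)
Lemma right_semiuniversal_linear : right_semiuniversal f (linear_unfolding f g).
Proof.
split; first exact: right_versal_linear fg.1.
move=> q J G phi phi' hG philoc hphi phi'loc hphi' a /cps_maxP a0.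
have [ph0 phiE] := lrmorphism_subst philoc.
have [ph'0 phi'E] := lrmorphism_subst phi'loc.
set ph := fun j => _ in ph0 phiE; set ph' := fun j => _ in ph'0 phi'E.
have phX j : phi (cpsX j) = \pi_{ideal_quot J} (ph j) by rewrite reprK.
have ph'X j : phi' (cpsX j) = \pi_{ideal_quot J} (ph' j) by rewrite reprK.
move: hphi hphi'; rewrite -[G]reprK.
move=> /(right_inducedP f g _ ph0 phX)[Phi [alpha [hPhi _ e]]].
move=> /(right_inducedP f g _ ph'0 ph'X)[Phi' [alpha' [hPhi' _ e']]].
have hX j : ideal_prod (@quot_max R K v q J) (@quot_max R K v q J)
    (phi (cpsX j) - phi' (cpsX j)).
  have [b Jb hb] : exists2 b, b \in J & linpart b = linpart (ph j - ph' j).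
    apply: linpart_ideal => lam hlam; rewrite lin_evalB.
    by rewrite (induced_lin_eval hG hlam hPhi hPhi' e e') subrr.
  rewrite phX ph'X -rmorphB /=.
  have -> : \pi_{ideal_quot J} (ph j - ph' j) = \pi_{ideal_quot J} (ph j - ph' j - b).
    by apply/pi_eqP; rewrite subKr.
  apply: ideal_prod_pi => m; rewrite ltnS leq_eqVlt => /orP[/mdeg1P[l /eqP ->]|].
    have /rowP/(_ l) := hb; rewrite !mxE => hl.
    by rewrite -[LHS]/((ph j - ph' j) U_(l)%MM - b U_(l)%MM) hl subrr.
  rewrite ltnS leqn0 mdeg_eq0 => /eqP ->.
  rewrite -[LHS]/((ph j 0%MM - ph' j 0%MM) - b 0%MM).
  by rewrite ph0 ph'0 (idealr_coef0 Jb) !subrr.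
have [h ->] := (cps_maxP a).2 a0.
rewrite !rmorph_sum -sumrB; apply: ideal_prod_sum => i; rewrite !rmorphM.
(* The second summand is a product of two elements of the maximal ideal, because [phi (h i)] and
   [phi' (h i)] have the same constant term. *)
have -> : phi (h i) * phi (cpsX i) - phi' (h i) * phi' (cpsX i) =
    phi (h i) * (phi (cpsX i) - phi' (cpsX i)) +
    (phi (h i) - phi' (h i)) * phi' (cpsX i) by ring.
apply: ideal_prodD; first exact: ideal_prodMl.
apply: ideal_prod_mul.
  rewrite phiE phi'E -rmorphB; apply/quot_maxP.
  rewrite -[LHS]/(cps_subst (h i) ph 0%MM - cps_subst (h i) ph' 0%MM).
  by rewrite !cps_subst_coef0 // subrr.
by rewrite ph'X; apply/quot_maxP; exact: ph'0.
Qed.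

End Semiuniversal.

Theorem theorem4p3 (R : realType) (K : fieldType) (v : real_valuation R K)
    (n p : nat) (f : cps v n) (g : 'I_p -> cps v n)
    (f_m2 : ideal_prod (@cps_max R K v n) (@cps_max R K v n) f)
    (f_fin : jac_finite_dim f)
    (g_m : forall i : 'I_p, cps_max (g i)) :
  (jac_generating f g -> right_versal f (linear_unfolding f g)) /\
  (jac_basis f g -> right_semiuniversal f (linear_unfolding f g)).
Proof.
split; first exact: right_versal_linear.
exact: right_semiuniversal_linear.
Qed.
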